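(* Let $(\mu_n)_{n\in\mathbb N}$ be a sequence of positive definite measures on $\mathbb R^d$, and let $\mu$ be a measure on $\mathbb R^d$ such that (i) for all $f\in\mathcal S(\mathbb R^d)$, $\lim_{n\to\infty}\mu_n(e^{-2\pi it\cdot}f)=\mu(e^{-2\pi it\cdot}f)$ uniformly in $t\in\mathbb R^d$, and (ii) $\{\mu_n:n\in\mathbb N\}$ is vaguely bounded. Then $\mu$ is positive definite and $\lim_{n\to\infty}\widehat{\mu_n}=\widehat\mu$ in the product topology.
   Context: Measures on $\mathbb R^d$ are complex Radon measures. With $\widetilde f(x)=\overline{f(-x)}$, $\mu$ is positive definite if $\mu(f*\widetilde f)\ge0$ for all $f\in C_c(\mathbb R^d)$; such $\mu$ is tempered and has a Fourier transform $\widehat\mu$, the measure with $\check f\in L^2(\widehat\mu)$ and $\mu(f*\widetilde f)=\widehat\mu(|\check f|^2)$ for all $f\in C_c$, $\check f(y)=\int f(x)e^{2\pi ixy}dx$. $e^{-2\pi it\cdot}f$ is $x\mapsto e^{-2\pi itx}f(x)$, and for Schwartz $g$, $\mu(g)$ is the action as a tempered distribution. Vaguely bounded: $\{\mu_n(f)\}$ bounded for each $f\in C_c$. Product topology: $\nu_n\to\nu$ iff $\|(\nu_n-\nu)*g\|_\infty\to0$ for all $g\in C_c(\mathbb R^d)$. *)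

(* Defs.v *)
From HB Require Import structures.
From mathcomp Require Import all_boot all_order all_algebra.
From mathcomp Require Import all_classical all_reals all_analysis.
From mathcomp Require Import complex.

Set Implicit Arguments.
Unset Strict Implicit.
Unset Printing Implicit Defensive.

Import Order.TTheory GRing.Theory Num.Theory.
Local Open Scope classical_set_scope.
Local Open Scope ring_scope.

Section MeasuresOnRd.
Variables (R : realType) (d : nat).

Local Notation C := (R[i]).
Local Notation pt := ('rV[R]_d).

Definition cre (z : C) : R := complex.Re z.
Definition cim (z : C) : R := complex.Im z.
Definition cmod (z : C) : R := Num.sqrt (cre z ^+ 2 + cim z ^+ 2).
Definition cconj (z : C) : C := Complex (cre z) (- cim z).
Definition cofR (x : R) : C := Complex x 0.

Definition expi (th : R) : C := Complex (cos th) (sin th).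

Definition dot (x y : pt) : R := \sum_(i < d) x ord0 i * y ord0 i.
Definition enorm (x : pt) : R := Num.sqrt (dot x x).

Definition ccont (f : pt -> C) : Prop :=
  forall x (e : R), 0 < e -> exists del : R, 0 < del /\
    forall y, enorm (y - x) < del -> cmod (f y - f x) < e.

Definition Cc (f : pt -> C) : Prop :=
  ccont f /\ exists r : R, forall x, r < enorm x -> f x = 0.

Definition cint1 (g : R -> C) : C :=
  Complex (Rintegral (@lebesgue_measure R) setT (fun t => cre (g t)))
          (Rintegral (@lebesgue_measure R) setT (fun t => cim (g t))).

Definition vcons (k : nat) (t : R) (v : 'rV[R]_k) : 'rV[R]_k.+1 :=
  \row_(i < k.+1) (if unlift ord0 i is Some j then v ord0 j else t).

Fixpoint intRd_gen (k : nat) : ('rV[R]_k -> C) -> C :=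
  match k return ('rV[R]_k -> C) -> C with
  | 0 => fun f => f 0
  | k'.+1 => fun f => cint1 (fun t => @intRd_gen k' (fun v => f (vcons t v)))
  end.

Definition intRd (f : pt -> C) : C := @intRd_gen d f.

Definition fconv (f g : pt -> C) : pt -> C :=
  fun x => intRd (fun y => f y * g (x - y)).
Definition ftilde (f : pt -> C) : pt -> C := fun x => cconj (f (- x)).
Definition fcheck (f : pt -> C) : pt -> C :=
  fun y => intRd (fun x => f x * expi (2 * pi * dot x y)).

Definition modul (t : pt) (f : pt -> C) : pt -> C :=
  fun x => expi (- (2 * pi * dot t x)) * f x.

(* measures = complex Radon measures, seen (Bourbaki style) as linear
   functionals on C_c(R^d) continuous for the inductive limit topology *)
Definition measure_on := (pt -> C) -> C.

Definition is_measure (mu : measure_on) : Prop :=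
  [/\ (forall f g, Cc f -> Cc g -> mu (f \+ g) = mu f + mu g),
      (forall (c : C) f, Cc f -> mu (fun x => c * f x) = c * mu f) &
      (forall r : R, exists K : R, forall f (M : R), Cc f ->
         (forall x, r < enorm x -> f x = 0) ->
         (forall x, cmod (f x) <= M) -> cmod (mu f) <= K * M)].

Definition pos_def (mu : measure_on) : Prop :=
  forall f, Cc f -> cim (mu (fconv f (ftilde f))) = 0 /\
                    0 <= cre (mu (fconv f (ftilde f))).

Definition vaguely_bounded (mus : nat -> measure_on) : Prop :=
  forall f, Cc f -> exists K : R, forall n, cmod (mus n f) <= K.

Definition evec (j : 'I_d) : pt := delta_mx ord0 j.
Definition dpart (j : 'I_d) (f : pt -> C) : pt -> C :=
  fun x => Complex ('D_(evec j) (fun y => cre (f y)) x)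
                   ('D_(evec j) (fun y => cim (f y)) x).
Definition dlist (l : seq 'I_d) (f : pt -> C) : pt -> C := foldr dpart f l.

Definition smooth (f : pt -> C) : Prop :=
  forall l : seq 'I_d,
    ccont (dlist l f) /\
    forall j x, derivable (fun y => cre (dlist l f y)) x (evec j) /\
                derivable (fun y => cim (dlist l f y)) x (evec j).

Definition schwartz (f : pt -> C) : Prop :=
  smooth f /\ forall (l : seq 'I_d) (N : nat), exists K : R,
    forall x, (1 + enorm x) ^+ N * cmod (dlist l f x) <= K.

Definition tempered (mu : measure_on) : Prop :=
  exists (K : R) (N : nat), forall phi (M : R), smooth phi -> Cc phi ->
    (forall (l : seq 'I_d) x, (size l <= N)%N ->
        (1 + enorm x) ^+ N * cmod (dlist l phi x) <= M) ->
    cmod (mu phi) <= K * M.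

(* smooth cutoffs chi_k : equal to 1 on the ball of radius k+1, 0 outside
   the ball of radius 2(k+1) *)
Definition hexp (s : R) : R := if 0 < s then expR (- s^-1) else 0.
Definition chi (x : pt) : R :=
  hexp (4 - dot x x) / (hexp (4 - dot x x) + hexp (dot x x - 1)).
Definition cutoff (k : nat) (x : pt) : R := chi ((k.+1%:R)^-1 *: x).

(* extension of mu to functions g outside C_c, by exhaustion:
   mu(g) := lim_k mu(g chi_k) (when the limit exists).
   For a tempered mu and Schwartz g this is the action of mu as a tempered
   distribution; for g in L^1(|mu|) it is the integral of g against mu. *)
Definition ext_lim (mu : measure_on) (g : pt -> C) (z : C) : Prop :=
  forall e : R, 0 < e -> exists K : nat, forall k, (K <= k)%N ->
    cmod (mu (fun x => g x * cofR (cutoff k x)) - z) < e.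
Definition ext (mu : measure_on) (g : pt -> C) : C :=
  xget 0 [set z | ext_lim mu g z].

(* total variation |nu| on nonnegative C_c functions, and the (upper)
   integral of a nonnegative continuous function against |nu| *)
Definition totvar (nu : measure_on) (phi : pt -> R) : R :=
  sup [set cmod (nu psi) | psi in [set psi | Cc psi /\
                                    forall x, cmod (psi x) <= phi x]].
Definition upint_tv (nu : measure_on) (h : pt -> R) : \bar R :=
  ereal_sup [set (totvar nu phi)%:E | phi in
     [set phi | Cc (fun x => cofR (phi x)) /\
                forall x, 0 <= phi x <= h x]].

Definition is_FT (mu nu : measure_on) : Prop :=
  is_measure nu /\
  forall f, Cc f ->
    (upint_tv nu (fun y => cmod (fcheck f y) ^+ 2) < +oo%E)%O /\
    mu (fconv f (ftilde f)) = ext nu (fun y => cofR (cmod (fcheck f y) ^+ 2)).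

Definition mconv (nu : measure_on) (g : pt -> C) : pt -> C :=
  fun x => nu (fun y => g (x - y)).
Definition prod_top_cvg (nus : nat -> measure_on) (nu : measure_on) : Prop :=
  forall g, Cc g -> forall e : R, 0 < e -> exists N : nat, forall n,
    (N <= n)%N -> forall x, cmod (mconv (nus n) g x - mconv nu g x) < e.

End MeasuresOnRd.

(* Main.v *)
(* By (ii) and a gliding hump, the mu_n are equicontinuous on the functions of
   C_c supported in a fixed ball. Smooth functions being dense there, (i) holds
   for every f in C_c, uniformly in t. In particular mu is a limit of positive
   definite measures.

   The transforms nu_n and nu are positive: every p >= 0 in C_c is approximated,
   with an error at most e |k^|^2 for a fixed k in C_c, by squares |H^|^2 with H
   in C_c, and nu_n(|H^|^2) = mu_n(H * H~) >= 0. This rests on the density of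
   transforms of C_c functions for the sup norm, which replaces
   Stone-Weierstrass: products of differences of arctangents, that is, of Riemann
   sums of Poisson kernels, form approximate partitions of unity on fine grids.

   Translating |H^|^2 by t multiplies H * H~ by a character, so
   nu_n(|H^|^2(. - t)) converges to nu(|H^|^2(. - t)) uniformly in t. As
   nu_n(|k^|^2(. - t)) = mu_n(e_t (k * k~)) is bounded uniformly in n and t, the
   error e |k^|^2 is harmless, and every g in C_c is a combination of four such
   functions p. *)
Require Import Defs.
From HB Require Import structures.
From mathcomp Require Import all_boot all_order all_algebra.
From mathcomp Require Import all_classical all_reals all_analysis.
From mathcomp Require Import complex.
From mathcomp Require Import measurable_realfun.
From mathcomp Require Import ring lra.

Set Implicit Arguments.
Unset Strict Implicit.
Unset Printing Implicit Defensive.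

Import Order.TTheory GRing.Theory Num.Theory.
Import numFieldNormedType.Exports.
Import Normc.
Local Open Scope classical_set_scope.
Local Open Scope ring_scope.

(** * Complex numbers and continuity *)

(** The obstacle is that [is_FT] informs about [nu] only through the squares |f^|^2 with f in C_c,
    which in general have no compact support, while the conclusion tests [nu] on C_c. Moreover [nu]
    may have infinite mass, so a sup-norm approximation of p by squares says nothing about
    integrals: the error has to be measured against a function known to be integrable. The weight
    |k^|^2 is one. Taking k^ close to a Poisson kernel makes it nonvanishing on the support of p;
    then sqrt p / k^ is in C_c, a sup-norm approximation of it by a transform suffices, and
    multiplying back by k^ stays within transforms by the convolution theorem. The weight is chosen
    before the accuracy e, so the bounds on its integrals do not depend on e. For translates,
    positivity of [nu] bounds the error by the integral of the translated weight, without passing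
    through the total variation, and that integral is a value of mu at a modulated k * k~. *)

Section ComplexModulus.
Variable R : realType.
Local Notation C := (R[i]).
Implicit Types (z w : C) (a b : R).

Lemma cmodE z : cmod z = normc z. Proof. by case: z. Qed.

Lemma cmod_ge0 z : 0 <= cmod z. Proof. exact: sqrtr_ge0. Qed.

Lemma cmod0 : cmod (0 : C) = 0.
Proof. by rewrite cmodE; exact: normc0. Qed.

Lemma cmod_eq0 z : cmod z = 0 -> z = 0.
Proof. by rewrite cmodE; exact: eq0_normc. Qed.

Lemma cmodM z w : cmod (z * w) = cmod z * cmod w.
Proof. by rewrite !cmodE normcM. Qed.

Lemma cmodD z w : cmod (z + w) <= cmod z + cmod w.
Proof. by rewrite !cmodE; exact: le_normcD. Qed.

Lemma cmodN z : cmod (- z) = cmod z.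
Proof. by rewrite !cmodE; exact: normcN. Qed.

Lemma cmodC z w : cmod (z - w) = cmod (w - z).
Proof. by rewrite -cmodN opprB. Qed.

Lemma cmodB z w : cmod (z - w) <= cmod z + cmod w.
Proof. by rewrite -(cmodN w); exact: cmodD. Qed.

Lemma cmod_tri w z v : cmod (z - v) <= cmod (z - w) + cmod (w - v).
Proof. by rewrite (_ : z - v = (z - w) + (w - v)) ?cmodD//; ring. Qed.

Lemma cmodV z : cmod z^-1 = (cmod z)^-1.
Proof. by rewrite !cmodE; exact: normcV. Qed.

Lemma cmod_cofR a : cmod (cofR a) = `|a|.
Proof. by rewrite /cmod/= expr0n addr0 sqrtr_sqr. Qed.

Lemma cmod_conj z : cmod (cconj z) = cmod z.
Proof. by rewrite /cmod /= sqrrN. Qed.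

Lemma cmod_expi a : cmod (expi a) = 1.
Proof. by rewrite /cmod/= cos2Dsin2 sqrtr1. Qed.

Lemma cre_le_cmod z : `|cre z| <= cmod z.
Proof. by rewrite /cmod -sqrtr_sqr ler_wsqrtr// lerDl sqr_ge0. Qed.

Lemma cim_le_cmod z : `|cim z| <= cmod z.
Proof. by rewrite /cmod -sqrtr_sqr ler_wsqrtr// lerDr sqr_ge0. Qed.

Lemma cmod_sqr z : cmod z ^+ 2 = cre z ^+ 2 + cim z ^+ 2.
Proof. by rewrite sqr_sqrtr// addr_ge0// sqr_ge0. Qed.

Lemma cmod_le_sum z : cmod z <= `|cre z| + `|cim z|.
Proof.
rewrite -(@ler_sqr _ (cmod z)) ?nnegrE ?addr_ge0 ?cmod_ge0// cmod_sqr.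
by rewrite sqrrD !real_normK ?num_real// lerD2r lerDl mulrn_wge0// mulr_ge0.
Qed.

Lemma creD z w : cre (z + w) = cre z + cre w. Proof. by case: z; case: w. Qed.
Lemma cimD z w : cim (z + w) = cim z + cim w. Proof. by case: z; case: w. Qed.
Lemma creN z : cre (- z) = - cre z. Proof. by case: z. Qed.
Lemma cimN z : cim (- z) = - cim z. Proof. by case: z. Qed.
Lemma creM z w : cre (z * w) = cre z * cre w - cim z * cim w.
Proof. by case: z; case: w. Qed.
Lemma cimM z w : cim (z * w) = cre z * cim w + cim z * cre w.
Proof. by case: z; case: w => c d a b /=. Qed.
Lemma complex_ext z w : cre z = cre w -> cim z = cim w -> z = w.
Proof. by case: z; case: w => c d a b /= -> ->. Qed.

Lemma cofRD a b : cofR (a + b) = cofR a + cofR b.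
Proof. by apply: complex_ext; rewrite ?creD ?cimD/= ?addr0. Qed.
Lemma cofRM a b : cofR (a * b) = cofR a * cofR b.
Proof. by apply: complex_ext; rewrite ?creM ?cimM/= ?mulr0 ?mul0r ?addr0 ?subr0. Qed.
Lemma cofRN a : cofR (- a) = - cofR a.
Proof. by apply: complex_ext; rewrite ?creN ?cimN/= ?oppr0. Qed.
Lemma cofR_prod (I : Type) (s : seq I) (P : pred I) (F : I -> R) :
  cofR (\prod_(i <- s | P i) F i) = \prod_(i <- s | P i) cofR (F i).
Proof. by apply: (big_morph (@cofR R)) => //; exact: cofRM. Qed.
Lemma cofR_sum (I : Type) (s : seq I) (P : pred I) (F : I -> R) :
  cofR (\sum_(i <- s | P i) F i) = \sum_(i <- s | P i) cofR (F i).
Proof. by apply: (big_morph (@cofR R)) => //; exact: cofRD. Qed.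

Lemma cconjM z w : cconj (z * w) = cconj z * cconj w.
Proof.
apply: complex_ext; rewrite ?creM ?cimM /= ?creM ?cimM//; ring.
Qed.
Lemma mul_cconj z : z * cconj z = cofR (cmod z ^+ 2).
Proof.
by apply: complex_ext; rewrite ?creM ?cimM/= ?cmod_sqr; ring.
Qed.

Lemma expiD a b : expi (a + b) = expi a * expi b.
Proof.
apply: complex_ext; rewrite ?creM ?cimM/= ?cosD ?sinD//.
by rewrite addrC.
Qed.
Lemma expi0 : expi (0 : R) = 1.
Proof. by rewrite /expi cos0 sin0. Qed.
Lemma cconj_expi a : cconj (expi a) = expi (- a).
Proof. by rewrite /cconj /expi /= cosN sinN. Qed.

Lemma cmod_sum (I : Type) (s : seq I) (P : pred I) (F : I -> C) :
  cmod (\sum_(i <- s | P i) F i) <= \sum_(i <- s | P i) cmod (F i).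
Proof.
elim/big_ind2 : _ => //; first by rewrite cmod0.
by move=> x1 x2 y1 y2 h1 h2; apply: le_trans (cmodD _ _) _; exact: lerD.
Qed.

Lemma cmod_prod (I : Type) (s : seq I) (P : pred I) (F : I -> C) :
  cmod (\prod_(i <- s | P i) F i) = \prod_(i <- s | P i) cmod (F i).
Proof.
apply: (big_morph (@cmod R)); first exact: cmodM.
by rewrite -expi0 cmod_expi.
Qed.

Lemma cre_sum (I : Type) (s : seq I) (P : pred I) (F : I -> C) :
  cre (\sum_(i <- s | P i) F i) = \sum_(i <- s | P i) cre (F i).
Proof. by apply: (big_morph (@cre R)) => //; exact: creD. Qed.
Lemma cim_sum (I : Type) (s : seq I) (P : pred I) (F : I -> C) :
  cim (\sum_(i <- s | P i) F i) = \sum_(i <- s | P i) cim (F i).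
Proof. by apply: (big_morph (@cim R)) => //; exact: cimD. Qed.

(* a unimodular factor rotating z onto the nonnegative half-line *)
Lemma rotation z : exists c : C, cmod c = 1 /\ c * z = cofR (cmod z).
Proof.
have [z0|z0] := eqVneq (cmod z) 0.
  exists 1; rewrite z0 (cmod_eq0 z0) mulr0; split=> //.
  by rewrite -expi0 cmod_expi.
exists (cconj z * (cofR (cmod z))^-1); split.
  by rewrite cmodM cmod_conj cmodV cmod_cofR ger0_norm ?cmod_ge0// divff.
rewrite mulrAC [cconj z * z]mulrC mul_cconj expr2 cofRM mulfK//.
by apply: contra z0 => /eqP/(congr1 (@cre R))/= ->.
Qed.

End ComplexModulus.

Section GeneralContinuity.
Variables (R : realType) (T : topologicalType).
Local Notation C := (R[i]).
Implicit Types (u v : T -> R) (f g : T -> C).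

Lemma rcontD u v : continuous u -> continuous v ->
  continuous (fun x => u x + v x).
Proof. by move=> cu cv x; apply: continuousD; [exact: cu|exact: cv]. Qed.

Lemma rcontM u v : continuous u -> continuous v ->
  continuous (fun x => u x * v x).
Proof. by move=> cu cv x; apply: continuousM; [exact: cu|exact: cv]. Qed.

Lemma rcontN u : continuous u -> continuous (fun x => - u x).
Proof. by move=> cu x; apply: continuousN; exact: cu. Qed.

Lemma rcontV u : (forall x, u x != 0) -> continuous u ->
  continuous (fun x => (u x)^-1).
Proof. by move=> u0 cu x; apply: continuousV => //; exact: cu. Qed.

Lemma rcont_cst (c : R) : continuous (fun _ : T => c).
Proof. by move=> x; exact: cst_continuous. Qed.

Lemma rcont_sum (I : Type) (s : seq I) (F : I -> T -> R) :
  (forall i, continuous (F i)) -> continuous (fun x => \sum_(i <- s) F i x).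
Proof.
move=> cF; elim: s => [|i s ih].
  by under [X in continuous X]eq_fun do rewrite big_nil; exact: rcont_cst.
by under [X in continuous X]eq_fun do rewrite big_cons; exact: rcontD.
Qed.

Lemma rcont_comp u (v : R -> R) : continuous u -> continuous v ->
  continuous (fun x => v (u x)).
Proof. by move=> cu cv x; apply: (@continuous_comp _ _ _ u v); [exact: cu|exact: cv]. Qed.

(* continuity of complex-valued functions, componentwise: [R[i]] carries no
   topology of its own here *)
Definition cc f :=
  continuous (fun x => cre (f x)) /\ continuous (fun x => cim (f x)).

Lemma cofR_cont u : continuous u -> cc (fun x => cofR (u x)).
Proof. by move=> cu; split => //; exact: rcont_cst. Qed.

Lemma ccD f g : cc f -> cc g -> cc (fun x => f x + g x).
Proof.
move=> [fr fi] [gr gi]; split.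
  by under [X in continuous X]eq_fun do rewrite creD; exact: rcontD.
by under [X in continuous X]eq_fun do rewrite cimD; exact: rcontD.
Qed.

Lemma ccM f g : cc f -> cc g -> cc (fun x => f x * g x).
Proof.
move=> [fr fi] [gr gi]; split.
  under [X in continuous X]eq_fun do rewrite creM.
  by apply: rcontD; [|apply: rcontN]; exact: rcontM.
under [X in continuous X]eq_fun do rewrite cimM.
by apply: rcontD; exact: rcontM.
Qed.

Lemma cc_cst (c : C) : cc (fun=> c).
Proof. by split; exact: rcont_cst. Qed.

Lemma cc_conj f : cc f -> cc (fun x => cconj (f x)).
Proof. by move=> [fr fi]; split => //; exact: rcontN. Qed.

Lemma cc_prod (I : Type) (s : seq I) (F : I -> T -> C) :
  (forall i, cc (F i)) -> cc (fun x => \prod_(i <- s) F i x).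
Proof.
move=> cF; elim: s => [|i s ih].
  by under [X in cc X]eq_fun do rewrite big_nil; exact: cc_cst.
by under [X in cc X]eq_fun do rewrite big_cons; exact: ccM.
Qed.

Lemma cc_cmod f : cc f -> continuous (fun x => cmod (f x)).
Proof.
move=> [fr fi].
apply: (@rcont_comp (fun x => cre (f x) ^+ 2 + cim (f x) ^+ 2) Num.sqrt).
  by apply: rcontD; exact: rcontM.
exact: sqrt_continuous.
Qed.

Lemma cc_expi u : continuous u -> cc (fun x => expi (u x)).
Proof.
move=> cu; split.
  by apply: (@rcont_comp u cos) => //; exact: continuous_cos.
by apply: (@rcont_comp u sin) => //; exact: continuous_sin.
Qed.

End GeneralContinuity.

Section Continuity.
Variables (R : realType) (d : nat).
Local Notation C := (R[i]).
Local Notation pt := ('rV[R]_d).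
Implicit Types (f g : pt -> C) (x y : pt).

Lemma mx_norm_le x (e : R) : 0 <= e -> (`|x| <= e) = [forall j, `|x ord0 j| <= e].
Proof.
move=> e0; rewrite [`|x|]mx_normrE; apply/idP/forallP.
  move=> h j; apply: le_trans h.
  exact: (@le_bigmax _ _ _ _ (fun ij => `|x ij.1 ij.2|) (ord0, j)).
by move=> h; apply/bigmax_leP; split => // -[i j] _ /=; rewrite ord1.
Qed.

Lemma dot_ge0 x : 0 <= dot x x.
Proof. by apply: sumr_ge0 => i _; rewrite -expr2 sqr_ge0. Qed.

Lemma enorm_ge0 x : 0 <= enorm x. Proof. exact: sqrtr_ge0. Qed.

Lemma enorm_sqr x : enorm x ^+ 2 = dot x x.
Proof. by rewrite sqr_sqrtr// dot_ge0. Qed.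

Lemma coord_le_enorm x j : `|x ord0 j| <= enorm x.
Proof.
rewrite -sqrtr_sqr ler_wsqrtr// /dot (bigD1 j)//= -expr2 lerDl.
by apply: sumr_ge0 => i _; rewrite -expr2 sqr_ge0.
Qed.

Lemma norm_le_enorm x : `|x| <= enorm x.
Proof.
by rewrite mx_norm_le ?enorm_ge0//; apply/forallP => j; exact: coord_le_enorm.
Qed.

Lemma coord_le_norm x j : `|x ord0 j| <= `|x|.
Proof.
by have := lexx `|x|; rewrite {1}mx_norm_le// => /forallP.
Qed.

(** The sharp factor, the square root of [d], is relaxed to [d]: after squaring, [d <= d ^ 2] is all
    that is needed. *)
Lemma enorm_le_norm x : enorm x <= d%:R * `|x|.
Proof.
rewrite -(@ler_sqr _ (enorm x)) ?nnegrE ?enorm_ge0 ?mulr_ge0// enorm_sqr.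
rewrite exprMn; apply: (@le_trans _ _ (\sum_(i < d) `|x| ^+ 2)).
  apply: ler_sum => i _; rewrite -expr2 -real_normK ?num_real//.
  by rewrite ler_sqr ?nnegrE// coord_le_norm.
rewrite sumr_const card_ord -[leLHS]mulr_natl ler_wpM2r ?sqr_ge0//.
by rewrite -natrX ler_nat; case: d => // n; rewrite expnS expn1 leq_pmull.
Qed.

Lemma rcontP (u : pt -> R) (x : pt) :
  (forall e : R, 0 < e -> \forall y \near x, `|u x - u y| < e) ->
  {for x, continuous u}.
Proof. by move=> h; apply/(@cvgrPdist_lt R _ _ (nbhs x)) => e e0; exact: h. Qed.

(** Bridge between the epsilon-delta definition in [enorm] and the topology of row vectors, which
    comes from the sup norm; afterwards continuity is handled componentwise. *)
Lemma ccontP f : ccont f <-> cc f.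
Proof.
have near_enorm x (del : R) : 0 < del -> \forall y \near x, enorm (y - x) < del.
  (* [d.+1] replaces [d] so that the comparison factor can be divided by even in dimension 0. *)
  move=> del0; have d1 : (0 : R) < d.+1%:R by rewrite ltr0n.
  near=> y; apply: le_lt_trans (enorm_le_norm _) _.
  apply: (@le_lt_trans _ _ (d.+1%:R * `|y - x|)).
    by rewrite ler_wpM2r// ler_nat.
  rewrite mulrC -ltr_pdivlMr//; near: y.
  by apply: cvgr_distC_lt => //; rewrite divr_gt0.
split=> [cf|[cr ci] x e e0].
  split => x; apply: rcontP => e e0; have [del [del0 h]] := cf x e e0.
    near=> y; rewrite distrC -creN -creD.
    by apply: le_lt_trans (cre_le_cmod _) _; apply: h; near: y; exact: near_enorm.
  near=> y; rewrite distrC -cimN -cimD.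
  by apply: le_lt_trans (cim_le_cmod _) _; apply: h; near: y; exact: near_enorm.
have e2 : 0 < e / 2 by rewrite divr_gt0.
have : \forall y \near x, cmod (f y - f x) < e.
  near=> y; apply: le_lt_trans (cmod_le_sum _) _.
  rewrite creD cimD creN cimN (splitr e); apply: ltrD; rewrite distrC.
    by near: y; move/cvgrPdist_lt : (cr x); exact.
  by near: y; move/cvgrPdist_lt : (ci x); exact.
move=> /nbhs_normP[del /= del0 h]; exists del; split => // y xy; apply: h => /=.
by rewrite distrC; apply: le_lt_trans xy; exact: norm_le_enorm.
Unshelve. all: by end_near. Qed.

Lemma ccont_cofR (u : pt -> R) : continuous u -> ccont (fun x => cofR (u x)).
Proof. by move=> cu; apply/ccontP; exact: cofR_cont. Qed.

Lemma ccontD f g : ccont f -> ccont g -> ccont (fun x => f x + g x).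
Proof. by move=> /ccontP cf /ccontP cg; apply/ccontP; exact: ccD. Qed.

Lemma ccontM f g : ccont f -> ccont g -> ccont (fun x => f x * g x).
Proof. by move=> /ccontP cf /ccontP cg; apply/ccontP; exact: ccM. Qed.

Lemma ccont_cst (c : C) : ccont (fun _ : pt => c).
Proof. by apply/ccontP; exact: cc_cst. Qed.

Lemma ccont_conj f : ccont f -> ccont (fun x => cconj (f x)).
Proof. by move=> /ccontP cf; apply/ccontP; exact: cc_conj. Qed.

Lemma ccont_prod (I : Type) (s : seq I) (F : I -> pt -> C) :
  (forall i, ccont (F i)) -> ccont (fun x => \prod_(i <- s) F i x).
Proof. by move=> cF; apply/ccontP; apply: cc_prod => i; apply/ccontP. Qed.

Lemma cmod_continuous f : ccont f -> continuous (fun x => cmod (f x)).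
Proof. by move=> /ccontP; exact: cc_cmod. Qed.

Lemma coord_cont (j : 'I_d) : continuous (fun x : pt => x ord0 j).
Proof. exact: coord_continuous. Qed.

Lemma dot_continuous y : continuous (fun x => dot x y).
Proof.
apply: rcont_sum => i.
by apply: rcontM; [exact: coord_cont|exact: rcont_cst].
Qed.

Lemma dotC x y : dot x y = dot y x.
Proof. by apply: eq_bigr => i _; rewrite mulrC. Qed.
Lemma dotDl x y z : dot (x + y) z = dot x z + dot y z.
Proof. by rewrite /dot -big_split; apply: eq_bigr => i _; rewrite mxE mulrDl. Qed.
Lemma dotNl x z : dot (- x) z = - dot x z.
Proof. by rewrite /dot -sumrN; apply: eq_bigr => i _; rewrite mxE mulNr. Qed.
Lemma dotDr x y z : dot z (x + y) = dot z x + dot z y.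
Proof. by rewrite dotC dotDl !(dotC z). Qed.
Lemma dotNr x z : dot z (- x) = - dot z x.
Proof. by rewrite dotC dotNl dotC. Qed.

Lemma ccont_expi (u : pt -> R) : continuous u -> ccont (fun x => expi (u x)).
Proof. by move=> cu; apply/ccontP; exact: cc_expi. Qed.

End Continuity.

Lemma ccont_comp (R : realType) (k d : nat) (h : 'rV[R]_k -> 'rV[R]_d)
    (f : 'rV[R]_d -> R[i]) :
  continuous h -> ccont f -> ccont (fun x => f (h x)).
Proof.
move=> ch /ccontP[fr fi]; apply/ccontP; split => x.
  by apply: (@continuous_comp _ _ _ h (fun y => cre (f y))); [exact: ch|exact: fr].
by apply: (@continuous_comp _ _ _ h (fun y => cim (f y))); [exact: ch|exact: fi].
Qed.


(** * Compactly supported functions: boundedness and uniform continuity *)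

Section CompactSupport.
Variables (R : realType) (d : nat).
Local Notation C := (R[i]).
Local Notation pt := ('rV[R]_d).
Implicit Types (f g : pt -> C) (x y : pt).

(* supports measured with the sup norm of the library rather than [enorm] *)
Definition supp_in (r : R) f := forall x, r < `|x| -> f x = 0.

Lemma CcP f : Cc f <-> ccont f /\ exists2 r, 0 < r & supp_in r f.
Proof.
split=> [[cf [r hr]]|[cf [r r0 hr]]]; split => //.
  exists (`|r| + 1); first by rewrite ltr_wpDl.
  move=> x hx; apply: hr; apply: lt_le_trans (norm_le_enorm x).
  by apply: le_lt_trans (ler_norm r) _; apply: lt_trans hx; rewrite ltrDl.
exists (d%:R * r) => x hx; apply: hr.
have := lt_le_trans hx (enorm_le_norm x).
(* The factor [d%:R] cancels only for positive [d]; in dimension 0 the hypothesis reduces to 0 <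
   0. *)
case: d x hx => [|n] x hx; last by rewrite ltr_pM2l ?ltr0n.
by rewrite !mul0r ltxx.
Qed.

Lemma box_compact (r : R) : compact [set x : pt | `|x| <= r].
Proof.
have [r0|r0] := leP 0 r; last first.
  rewrite (_ : [set _ | _] = set0); first exact: compact0.
  by apply/seteqP; split => // x /= h; have := lt_le_trans r0 (le_trans (normr_ge0 x) h); rewrite ltxx.
rewrite (_ : [set x | _] = [set v : pt | forall i, `[- r, r]%classic (v ord0 i)]).
  by apply: (@rV_compact R d (fun=> `[- r, r]%classic)) => i; exact: segment_compact.
apply/seteqP; split => x /=; rewrite mx_norm_le//.
  by move=> /forallP h i; rewrite in_itv /= -ler_norml.
by move=> h; apply/forallP => i; have := h i; rewrite in_itv /= -ler_norml.
Qed.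

Lemma cont_bounded (u : pt -> R) (r : R) : continuous u ->
  exists2 M, 0 < M & forall x, `|x| <= r -> `|u x| <= M.
Proof.
move=> cu; have ck := @box_compact r.
have : compact (u @` [set x : pt | `|x| <= r]).
  by apply: continuous_compact => //; exact: continuous_subspaceT.
move=> /compact_bounded[M [Mr hM]].
exists (`|M| + 1); first by rewrite ltr_wpDl.
by move=> x hx; apply: (hM (`|M| + 1)); [rewrite (le_lt_trans (ler_norm M))// ltrDl|exists x].
Qed.

Lemma Cc_bounded f : Cc f -> exists2 M, 0 < M & forall x, cmod (f x) <= M.
Proof.
move=> /CcP[cf [r r0 hr]].
have [M M0 hM] := cont_bounded r (cmod_continuous cf).
exists M => // x; have [xr|xr] := leP `|x| r.
  by apply: le_trans (hM x xr); exact: ler_norm.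
by rewrite hr// cmod0 ltW.
Qed.

(** Heine-Cantor through the near-covering form of compactness, the filter being that of small
    positive moduli. Only [x] is confined to the box: a function supported in the box is compared
    with its values just outside. *)
Lemma box_unif_cont f (r e : R) : ccont f -> 0 < e ->
  exists2 del : R, 0 < del & forall x y, `|x| <= r -> `|x - y| < del ->
    cmod (f x - f y) < e.
Proof.
move=> cf e0.
have /compact_near_coveringP := @box_compact r.
move=> /(_ R 0^'+ (fun del x => forall y, `|x - y| < del -> cmod (f x - f y) < e)).
case=> [x xr|del /= del0 h].
  have [del [del0 hd]] := cf x (e / 2) (divr_gt0 e0 (ltr0n _ 2)).
  have d1 : (0 : R) < d.+1%:R by rewrite ltr0n.
  have en y : `|y - x| < del / d.+1%:R -> enorm (y - x) < del.
    rewrite ltr_pdivlMr// mulrC; apply: le_lt_trans.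
    apply: le_trans (enorm_le_norm _) _.
    by rewrite ler_wpM2r// ler_nat.
  have dd : 0 < del / d.+1%:R / 2 by rewrite !divr_gt0.
  near=> x' i.
  have hi : i < del / d.+1%:R / 2 by near: i; exact: nbhs_right_lt.
  move=> y /= xy.
  have hx' : `|x - x'| < del / d.+1%:R / 2.
    by near: x'; apply: cvgr_dist_lt.
  apply: le_lt_trans (cmod_tri (f x) _ _) _; rewrite (splitr e); apply: ltrD.
    by apply: hd; apply: en; rewrite distrC; apply: lt_trans hx' _; rewrite ltr_pdivrMr ?ltr_pMr ?divr_gt0// ltr1n.
  rewrite cmodC; apply: hd; apply: en.
  rewrite (_ : y - x = - (x' - y) + (x' - x)); last by rewrite opprB addrA subrK.
  apply: le_lt_trans (ler_normD _ _) _; rewrite normrN (splitr (del / _)).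
  apply: ltrD; last by rewrite distrC.
  exact: lt_trans xy hi.
have := h (del / 2) => /=; rewrite sub0r normrN gtr0_norm ?divr_gt0//.
rewrite ltr_pdivrMr// ltr_pMr// ltr1n => /(_ isT isT) hh.
by exists (del / 2); [rewrite divr_gt0|move=> x y xr; apply: hh].
Unshelve. all: by end_near. Qed.

Lemma Cc_unif_cont f (e : R) : Cc f -> 0 < e ->
  exists2 del : R, 0 < del & forall x y, `|x - y| < del -> cmod (f x - f y) < e.
Proof.
move=> /CcP[cf [r r0 hr]] e0; have [del del0 h] := box_unif_cont r cf e0.
exists del => // x y xy; have [xr|xr] := leP `|x| r; first exact: h.
have [yr|yr] := leP `|y| r; first by rewrite cmodC; apply: h; rewrite // distrC.
by rewrite !hr// subrr cmod0.
Qed.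

Lemma Cc_mull f g : ccont f -> Cc g -> Cc (fun x => f x * g x).
Proof.
move=> cf [cg [r hr]]; split; first exact: ccontM.
by exists r => x /hr ->; rewrite mulr0.
Qed.
Lemma Cc_scale (c : C) f : Cc f -> Cc (fun x => c * f x).
Proof. by apply: Cc_mull; exact: ccont_cst. Qed.
Lemma Cc_add f g : Cc f -> Cc g -> Cc (fun x => f x + g x).
Proof.
move=> [cf [r hr]] [cg [s hs]]; split; first exact: ccontD.
exists (Num.max r s) => x; rewrite gt_max => /andP[/hr -> /hs ->].
by rewrite addr0.
Qed.
Lemma Cc_0 : Cc (fun _ : pt => 0 : C).
Proof. by split; [exact: ccont_cst|exists 0]. Qed.
Lemma Cc_sub f g : Cc f -> Cc g -> Cc (fun x => f x - g x).
Proof.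
move=> cf cg; apply: Cc_add => //.
have := Cc_scale (-1) cg.
by under [X in Cc X]eq_fun do rewrite mulN1r.
Qed.
Lemma Cc_sum (I : Type) (s : seq I) (F : I -> pt -> C) :
  (forall i, Cc (F i)) -> Cc (fun x => \sum_(i <- s) F i x).
Proof.
move=> cF; elim: s => [|i s ih].
  by under [X in Cc X]eq_fun do rewrite big_nil; exact: Cc_0.
by under [X in Cc X]eq_fun do rewrite big_cons; exact: Cc_add.
Qed.

End CompactSupport.

(** * Integration and convolution *)

Section Integral1.
Variable R : realType.
Local Notation C := (R[i]).
Local Notation mu := (@lebesgue_measure R).
Implicit Types (u v : R -> R) (f g : R -> C) (r M : R).

Definition Rsupp_in (V : nmodType) r (u : R -> V) := forall x, r < `|x| -> u x = 0.

Lemma Rsupp_restrict r u : Rsupp_in r u -> u \_ `[- r, r]%classic = u.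
Proof.
move=> hu; apply/funext => x; rewrite patchE; case: ifPn => //.
rewrite notin_setE /= in_itv /= -ler_norml => /negP; rewrite -ltNge.
by move/hu.
Qed.

Lemma supp_integrable r u : continuous u -> Rsupp_in r u ->
  mu.-integrable setT (EFin \o u).
Proof.
move=> cu hu; rewrite -(Rsupp_restrict hu) -restrict_EFin.
apply/integrable_restrict => //=; rewrite setTI.
apply: continuous_compact_integrable; first exact: segment_compact.
exact: continuous_subspaceT.
Qed.

Lemma Rintegral_supp r u : Rsupp_in r u ->
  Rintegral mu setT u = Rintegral mu `[- r, r]%classic u.
Proof. by move=> hu; rewrite [RHS]Rintegral_mkcond Rsupp_restrict. Qed.

Lemma Rintegral_bound r M u : 0 < r -> continuous u -> Rsupp_in r u ->
  (forall x, `|u x| <= M) -> `|Rintegral mu setT u| <= 2 * r * M.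
Proof.
move=> r0 cu hu uM; rewrite (Rintegral_supp hu).
have cK (w : R -> R) : continuous w -> mu.-integrable `[- r, r]%classic (EFin \o w).
  move=> cw; apply: continuous_compact_integrable; first exact: segment_compact.
  exact: continuous_subspaceT.
apply: le_trans (le_normr_Rintegral _ (cK _ cu)) _; first exact: measurable_itv.
apply: (@le_trans _ _ (Rintegral mu `[- r, r]%classic (cst M))).
  apply: le_Rintegral => [| | |x _]; [exact: measurable_itv| | |exact: uM].
    by apply: (cK (fun x => `|u x|)); apply: rcont_comp => //; exact: norm_continuous.
  by apply: (cK (cst M)); exact: rcont_cst.
rewrite Rintegral_cst; last exact: measurable_itv.
have h : lebesgue_measure (`[- r, r]%classic : set R) = (2 * r)%:E.
  rewrite lebesgue_measure_itv /= lte_fin ifT; last by lra.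
  by rewrite -EFinB opprK; congr EFin; lra.
by rewrite [X in fine X]h /= mulrC.
Qed.

Definition Cc1 r f := cc f /\ Rsupp_in r f.

Lemma Cc1_int_re r f : Cc1 r f -> mu.-integrable setT (EFin \o (fun x => cre (f x))).
Proof.
move=> [[cf _] hf]; apply: (@supp_integrable r) => // x /hf ->; by [].
Qed.

Lemma Cc1_int_im r f : Cc1 r f -> mu.-integrable setT (EFin \o (fun x => cim (f x))).
Proof.
move=> [[_ cf] hf]; apply: (@supp_integrable r) => // x /hf ->; by [].
Qed.

Lemma cint1D r s f g : Cc1 r f -> Cc1 s g ->
  cint1 (fun x => f x + g x) = cint1 f + cint1 g.
Proof.
move=> cf cg; apply: complex_ext; rewrite /cint1 ?creD ?cimD /=.
  under [LHS]eq_Rintegral do rewrite creD.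
  by apply: RintegralD => //; [exact: Cc1_int_re cf|exact: Cc1_int_re cg].
under [LHS]eq_Rintegral do rewrite cimD.
by apply: RintegralD => //; [exact: Cc1_int_im cf|exact: Cc1_int_im cg].
Qed.

Lemma cint1Z r (c : C) f : Cc1 r f -> cint1 (fun x => c * f x) = c * cint1 f.
Proof.
move=> cf; have fr := Cc1_int_re cf; have fi := Cc1_int_im cf.
have sc (a : R) (u : R -> R) : mu.-integrable setT (EFin \o u) ->
    mu.-integrable setT (EFin \o (fun x => a * u x)).
  move=> iu; have := integrableZl measurableT a iu.
  by apply: eq_integrable => // x _; rewrite /= EFinM.
apply: complex_ext; rewrite /cint1 ?creM ?cimM /=.
  under [LHS]eq_Rintegral do rewrite creM.
  by rewrite RintegralB ?RintegralZl//; exact: sc.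
under [LHS]eq_Rintegral do rewrite cimM.
by rewrite RintegralD ?RintegralZl//; exact: sc.
Qed.

(** The constant is twice the length [2 * r] of the segment, once for the real and once for the
    imaginary part; its powers reappear in dimension [d]. *)
Lemma cint1_bound r M f : 0 < r -> Cc1 r f -> (forall x, cmod (f x) <= M) ->
  cmod (cint1 f) <= 4 * r * M.
Proof.
move=> r0 [[fr fi] hf] fM; apply: le_trans (cmod_le_sum _) _ => /=.
have b1 : `|Rintegral mu setT (fun x => cre (f x))| <= 2 * r * M.
  apply: Rintegral_bound => // [x /hf -> //|x].
  by apply: le_trans (fM x); exact: cre_le_cmod.
have b2 : `|Rintegral mu setT (fun x => cim (f x))| <= 2 * r * M.
  apply: Rintegral_bound => // [x /hf -> //|x].
  by apply: le_trans (fM x); exact: cim_le_cmod.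
by apply: le_trans (lerD b1 b2) _; lra.
Qed.

Lemma cc1_eps f : (forall t e, 0 < e -> exists2 del : R, 0 < del &
    forall s, `|t - s| < del -> cmod (f t - f s) < e) -> cc f.
Proof.
move=> h; split => t; apply/(@cvgrPdist_lt R) => e e0; have [del del0 hd] := h t e e0.
  near=> s; rewrite -creN -creD; apply: le_lt_trans (cre_le_cmod _) _; apply: hd.
  by near: s; apply: cvgr_dist_lt.
near=> s; rewrite -cimN -cimD; apply: le_lt_trans (cim_le_cmod _) _; apply: hd.
by near: s; apply: cvgr_dist_lt.
Unshelve. all: by end_near. Qed.

Lemma Cc1_add r f g : Cc1 r f -> Cc1 r g -> Cc1 r (fun x => f x + g x).
Proof.
move=> [cf hf] [cg hg]; split; first exact: ccD.
by move=> x rx; rewrite hf// hg// addr0.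
Qed.

Lemma Cc1_mulr r f g : Cc1 r f -> cc g -> Cc1 r (fun x => f x * g x).
Proof.
move=> [cf hf] cg; split; first exact: ccM.
by move=> x rx; rewrite hf// mul0r.
Qed.

Lemma Cc1_scale r (c : C) f : Cc1 r f -> Cc1 r (fun x => c * f x).
Proof.
move=> [cf hf]; split; first by apply: ccM => //; exact: cc_cst.
by move=> x rx; rewrite hf// mulr0.
Qed.

Lemma Cc1_le r s f : r <= s -> Cc1 r f -> Cc1 s f.
Proof. by move=> rs [cf hf]; split => // x sx; apply: hf; exact: le_lt_trans sx. Qed.

Lemma Cc1_bounded r f : Cc1 r f -> exists2 M, 0 < M & forall x, cmod (f x) <= M.
Proof.
move=> [cf hf].
have : compact ((fun x => cmod (f x)) @` `[- r, r]%classic).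
  apply: continuous_compact; last exact: segment_compact.
  by apply: continuous_subspaceT; exact: cc_cmod.
move=> /compact_bounded[M [Mr hM]].
exists (`|M| + 1); first by rewrite ltr_wpDl.
move=> x; have [xr|xr] := leP `|x| r; last by rewrite hf// cmod0 addr_ge0.
apply: le_trans (ler_norm _) _; apply: (hM (`|M| + 1)).
  by rewrite (le_lt_trans (ler_norm M))// ltrDl.
by exists x => //=; rewrite in_itv /= -ler_norml.
Qed.

End Integral1.

(** * The iterated integral on R^d *)

Section IntegralRd.
Variable R : realType.
Local Notation C := (R[i]).
Implicit Types (r M : R).

Lemma vcons0 k (t : R) (v : 'rV[R]_k) : vcons t v ord0 ord0 = t.
Proof. by rewrite mxE unlift_none. Qed.
Lemma vconsS k (t : R) (v : 'rV[R]_k) j : vcons t v ord0 (lift ord0 j) = v ord0 j.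
Proof. by rewrite mxE liftK. Qed.

Lemma vcons_normP k (t : R) (v : 'rV[R]_k) e : 0 <= e ->
  (`|vcons t v| <= e) = (`|t| <= e) && (`|v| <= e).
Proof.
move=> e0; rewrite !mx_norm_le//; apply/forallP/andP.
  move=> h; split; first by have := h ord0; rewrite vcons0.
  by apply/forallP => j; have := h (lift ord0 j); rewrite vconsS.
move=> [ht /forallP hv] j; case: (unliftP ord0 j) => [i|] ->.
  by rewrite vconsS.
by rewrite vcons0.
Qed.

Lemma vconsB k (t s : R) (v w : 'rV[R]_k) : vcons t v - vcons s w = vcons (t - s) (v - w).
Proof.
apply/rowP => j; rewrite !mxE; case: unliftP => [i _|_] //; by rewrite !mxE.
Qed.

Lemma ccont_eps k (f : 'rV[R]_k -> C) :
  (forall x e, 0 < e -> exists2 del : R, 0 < del &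
    forall y, `|x - y| < del -> cmod (f x - f y) < e) -> ccont f.
Proof.
move=> h x e e0; have [del del0 hd] := h x e e0; exists del; split => // y xy.
by rewrite cmodC; apply: hd; rewrite distrC; apply: le_lt_trans xy; exact: norm_le_enorm.
Qed.

Lemma ccont_vcons k (t : R) (f : 'rV[R]_k.+1 -> C) :
  ccont f -> ccont (fun v => f (vcons t v)).
Proof.
move=> cf; apply: ccont_eps => v e e0.
have [del del0 h] := box_unif_cont `|vcons t v| cf e0.
exists del => // w vw; apply: h => //; rewrite vconsB subrr.
apply: le_lt_trans vw; rewrite vcons_normP// normr0 normr_ge0 lexx//.
Qed.

Lemma supp_vcons k r (t : R) (f : 'rV[R]_k.+1 -> C) :
  supp_in r f -> supp_in r (fun v => f (vcons t v)).
Proof.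
move=> hf v rv; apply: hf; apply: lt_le_trans rv _.
by have := lexx `|vcons t v|; rewrite {1}vcons_normP// => /andP[].
Qed.

(** The radius is explicit because the bounds for integrals and measures depend on the support
    through it alone. *)
Definition Ccr k r (f : 'rV[R]_k -> C) := ccont f /\ supp_in r f.

Lemma Ccr_Cc k r (f : 'rV[R]_k -> C) : Ccr r f -> Cc f.
Proof.
move=> [cf hf]; apply/CcP; split => //; exists (`|r| + 1); first by rewrite ltr_wpDl.
move=> x hx; apply: hf; apply: lt_trans hx.
by apply: le_lt_trans (ler_norm r) _; rewrite ltrDl.
Qed.

Lemma Cc_Ccr k (f : 'rV[R]_k -> C) : Cc f -> exists2 r, 0 < r & Ccr r f.
Proof. by move=> /CcP[cf [r r0 hr]]; exists r. Qed.

Lemma Ccr_le k r s (f : 'rV[R]_k -> C) : r <= s -> Ccr r f -> Ccr s f.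
Proof. by move=> rs [cf hf]; split => // x sx; apply: hf; exact: le_lt_trans sx. Qed.

Lemma Ccr_scale k r (c : C) (f : 'rV[R]_k -> C) : Ccr r f -> Ccr r (fun x => c * f x).
Proof.
move=> [cf hf]; split; first by apply: ccontM => //; exact: ccont_cst.
by move=> x /hf ->; rewrite mulr0.
Qed.

Lemma Ccr_add k r (f g : 'rV[R]_k -> C) : Ccr r f -> Ccr r g ->
  Ccr r (fun x => f x + g x).
Proof.
move=> [cf hf] [cg hg]; split; first exact: ccontD.
by move=> x xr; rewrite hf// hg// addr0.
Qed.

(** The three facts need a common induction: to integrate once more, the inner integral must be
    continuous in the outer variable, and this follows from linearity and the bound, applied to the
    difference of two slices, which is small by uniform continuity. *)
Lemma intRd_gen_facts k r : 0 < r ->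
  [/\ forall f M, Ccr r f -> (forall x, cmod (f x) <= M) ->
        cmod (@intRd_gen R k f) <= (4 * r) ^+ k * M,
      forall f g, Ccr r f -> Ccr r g ->
        @intRd_gen R k (fun x => f x + g x) = intRd_gen f + intRd_gen g &
      forall c f, Ccr r f -> @intRd_gen R k (fun x => c * f x) = c * intRd_gen f].
Proof.
move=> r0; elim: k => [|k [ihb ihD ihZ]].
  by split => //= f M _ hM; rewrite expr0 mul1r.
have r4 : 0 < 4 * r by rewrite mulr_gt0.
have inner f : Ccr r f -> Cc1 r (fun t => @intRd_gen R k (fun v => f (vcons t v))).
  move=> cf; have ct t : Ccr r (fun v => f (vcons t v)).
    by split; [apply: ccont_vcons; exact: cf.1|apply: supp_vcons; exact: cf.2].
  split; last first.
    move=> t rt; apply: cmod_eq0; apply/eqP; rewrite eq_le cmod_ge0 andbT.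
    rewrite -(mulr0 ((4 * r) ^+ k)); apply: ihb => // v; rewrite cf.2 ?cmod0//.
    apply: lt_le_trans rt _.
    by have := lexx `|vcons t v|; rewrite {1}vcons_normP// => /andP[].
  apply: cc1_eps => t e e0.
  have e1 : 0 < e / 2 / (4 * r) ^+ k by rewrite !divr_gt0// exprn_gt0.
  have [del del0 hd] := Cc_unif_cont (Ccr_Cc cf) e1.
  exists del => // s ts.
  have -> : @intRd_gen R k (fun v => f (vcons t v)) - @intRd_gen R k (fun v => f (vcons s v)) =
     @intRd_gen R k (fun v => f (vcons t v) + (-1) * f (vcons s v)).
    rewrite ihD//; last exact: Ccr_scale.
    by rewrite ihZ// mulN1r.
  apply: (@le_lt_trans _ _ (e / 2)); last by rewrite ltr_pdivrMr// ltr_pMr// ltr1n.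
  rewrite -(divfK (lt0r_neq0 (exprn_gt0 k r4)) (e / 2)) mulrC.
  apply: ihb; first by apply: Ccr_add => //; exact: Ccr_scale.
  move=> v; rewrite mulN1r ltW//; apply: hd; rewrite vconsB subrr.
  by apply: le_lt_trans ts; rewrite vcons_normP// lexx normr0 normr_ge0.
split.
- move=> f M cf fM /=; rewrite exprS -mulrA.
  apply: cint1_bound => //; first exact: inner.
  move=> t; apply: ihb => //.
  by split; [apply: ccont_vcons; exact: cf.1|apply: supp_vcons; exact: cf.2].
- move=> f g cf cg /=; rewrite -(cint1D (inner _ cf) (inner _ cg)); congr cint1.
  apply/funext => t; apply: ihD.
    by split; [apply: ccont_vcons; exact: cf.1|apply: supp_vcons; exact: cf.2].
  by split; [apply: ccont_vcons; exact: cg.1|apply: supp_vcons; exact: cg.2].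
- move=> c f cf /=; rewrite -(cint1Z c (inner _ cf)); congr cint1.
  apply/funext => t; apply: ihZ.
  by split; [apply: ccont_vcons; exact: cf.1|apply: supp_vcons; exact: cf.2].
Qed.

Lemma Ccr_prod k r (f : 'I_k -> R -> C) : (forall j, Cc1 r (f j)) -> 0 < r ->
  Ccr r (fun x : 'rV[R]_k => \prod_(j < k) f j (x ord0 j)).
Proof.
move=> cf r0; split.
  apply: ccont_prod => j; apply/ccontP; have [[fr fi] _] := cf j; split => x.
    by apply: (@continuous_comp _ _ _ (fun x : 'rV[R]_k => x ord0 j) (fun t => cre (f j t)));
      [exact: coord_cont|exact: fr].
  by apply: (@continuous_comp _ _ _ (fun x : 'rV[R]_k => x ord0 j) (fun t => cim (f j t)));
    [exact: coord_cont|exact: fi].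
move=> x; rewrite ltNge mx_norm_le ?ltW// => /forallPn[j]; rewrite -ltNge => h.
by rewrite (bigD1 j)//= (cf j).2// mul0r.
Qed.

(** The integral is iterated by definition, so the factor in the outer variable is a constant for
    all inner integrations and linearity pulls it out. *)
Lemma intRd_gen_prod k r (f : 'I_k -> R -> C) : (forall j, Cc1 r (f j)) -> 0 < r ->
  @intRd_gen R k (fun x => \prod_(j < k) f j (x ord0 j)) = \prod_(j < k) cint1 (f j).
Proof.
move=> + r0; elim: k f => [|k ih] f cf /=; first by rewrite !big_ord0.
rewrite big_ord_recl -(ih (fun j => f (lift ord0 j)))// mulrC.
rewrite -(cint1Z _ (cf ord0)); congr cint1; apply/funext => t.
have [_ _ hZ] := intRd_gen_facts k r0.
rewrite mulrC -hZ; last by apply: (Ccr_prod (f := fun j => f (lift ord0 j))).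
congr intRd_gen; apply/funext => v; rewrite big_ord_recl vcons0; congr (_ * _).
by apply: eq_bigr => j _; rewrite vconsS.
Qed.

End IntegralRd.

(** * Convolution, modulation and the transform on C_c(R^d) *)

Section Convolution.
Variables (R : realType) (d : nat).
Local Notation C := (R[i]).
Local Notation pt := ('rV[R]_d).
Implicit Types (f g : pt -> C) (r M : R).

Lemma intRd_bound r M f : 0 < r -> Ccr r f -> (forall x, cmod (f x) <= M) ->
  cmod (intRd f) <= (4 * r) ^+ d * M.
Proof. by move=> r0; have [h _ _] := intRd_gen_facts (R := R) d r0; exact: h. Qed.

Lemma intRdD f g : Cc f -> Cc g -> intRd (fun x => f x + g x) = intRd f + intRd g.
Proof.
move=> /Cc_Ccr[r r0 cf] /Cc_Ccr[s s0 cg].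
have rs : 0 < Num.max r s by rewrite lt_max r0.
have [_ h _] := intRd_gen_facts (R := R) d rs; apply: h.
  by apply: Ccr_le cf; rewrite le_max lexx.
by apply: Ccr_le cg; rewrite le_max lexx orbT.
Qed.

Lemma intRdZ (c : C) f : Cc f -> intRd (fun x => c * f x) = c * intRd f.
Proof.
move=> /Cc_Ccr[r r0 cf].
by have [_ _ h] := intRd_gen_facts (R := R) d r0; apply: h.
Qed.

Lemma intRdB f g : Cc f -> Cc g -> intRd (fun x => f x - g x) = intRd f - intRd g.
Proof.
move=> cf cg; rewrite -mulN1r -intRdZ// -intRdD//; last exact: Cc_scale.
by congr intRd; apply/funext => x; rewrite mulN1r.
Qed.

Lemma intRd0 : intRd (fun _ : pt => 0 : C) = 0.
Proof.
rewrite -[RHS](mul0r (intRd (fun _ : pt => 0 : C))) -intRdZ; last exact: Cc_0.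
by congr intRd; apply/funext => x; rewrite mul0r.
Qed.

Lemma intRd_sum (I : Type) (s : seq I) (F : I -> pt -> C) :
  (forall i, Cc (F i)) ->
  intRd (fun x => \sum_(i <- s) F i x) = \sum_(i <- s) intRd (F i).
Proof.
move=> cF; elim: s => [|i s ih].
  rewrite big_nil -[RHS]intRd0; congr intRd.
  by apply/funext => x; rewrite big_nil.
rewrite big_cons -ih -intRdD//; last exact: Cc_sum.
by congr intRd; apply/funext => x; rewrite big_cons.
Qed.

Lemma Cc_mulr f g : Cc f -> ccont g -> Cc (fun x => f x * g x).
Proof.
move=> cf cg; have := Cc_mull cg cf.
by under [X in Cc X -> _]eq_fun do rewrite mulrC.
Qed.

Lemma opp_cont : continuous (fun x : pt => - x).
Proof. by move=> x; apply: continuousN; exact: cvg_id. Qed.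

Lemma sub_cont (a : pt) : continuous (fun x : pt => x - a).
Proof. by move=> x; apply: continuousB; [exact: cvg_id|exact: cst_continuous]. Qed.

Lemma subr_cont (a : pt) : continuous (fun x : pt => a - x).
Proof. by move=> x; apply: continuousB; [exact: cst_continuous|exact: cvg_id]. Qed.

Lemma Cc_ftilde f : Cc f -> Cc (ftilde f).
Proof.
move=> /Cc_Ccr[r r0 [cf hf]]; apply: (@Ccr_Cc _ _ r); split.
  by apply: ccont_conj; apply: (ccont_comp (h := fun x => - x)) => //; exact: opp_cont.
by move=> x xr; rewrite /ftilde hf ?normrN// /cconj /= oppr0.
Qed.

Lemma Cc_shift (a : pt) f : Cc f -> Cc (fun x => f (x - a)).
Proof.
move=> /Cc_Ccr[r r0 [cf hf]]; apply: (@Ccr_Cc _ _ (r + `|a|)); split.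
  by apply: (ccont_comp (h := fun x => x - a)) => //; exact: sub_cont.
move=> x xr; apply: hf; have := lerB_dist x a; lra.
Qed.

Lemma Cc_refl (a : pt) f : Cc f -> Cc (fun x => f (a - x)).
Proof.
move=> /Cc_Ccr[r r0 [cf hf]]; apply: (@Ccr_Cc _ _ (r + `|a|)); split.
  by apply: (ccont_comp (h := fun x => a - x)) => //; exact: subr_cont.
move=> x xr; apply: hf; have := lerB_dist x a; rewrite distrC; lra.
Qed.

Lemma Cc_fconv f g : Cc f -> Cc g -> Cc (fconv f g).
Proof.
move=> cf cg; have [r r0 [_ hf]] := Cc_Ccr cf; have [s s0 [_ hg]] := Cc_Ccr cg.
have [M M0 hM] := Cc_bounded cf.
have cint x : Cc (fun y => f y * g (x - y)) by apply: Cc_mulr => //; exact: (Cc_refl x cg).1.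
apply: (@Ccr_Cc _ _ (r + s)); split; last first.
  move=> x xrs; rewrite /fconv -intRd0; congr intRd; apply/funext => y.
  have [yr|yr] := leP `|y| r; last by rewrite hf// mul0r.
  rewrite hg ?mulr0//; have := lerB_dist x y; lra.
apply: ccont_eps => x e e0.
pose A := (4 * r) ^+ d * M; have A0 : 0 < A by rewrite mulr_gt0// exprn_gt0// mulr_gt0.
have [del del0 hd] := Cc_unif_cont cg (divr_gt0 (divr_gt0 e0 (ltr0n _ 2)) A0).
exists del => // z xz; rewrite /fconv -intRdB//.
apply: (@le_lt_trans _ _ (e / 2)); last by rewrite ltr_pdivrMr// ltr_pMr// ltr1n.
rewrite -(divfK (lt0r_neq0 A0) (e / 2)) mulrC /A -mulrA.
have -> : (fun y => f y * g (x - y) - f y * g (z - y)) =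
   (fun y => f y * (g (x - y) - g (z - y))) by apply/funext => y; rewrite mulrBr.
apply: intRd_bound => //.
  split; last by move=> y yr; rewrite hf// mul0r.
  apply: ccontM; first exact: cf.1.
  exact: (Cc_sub (Cc_refl x cg) (Cc_refl z cg)).1.
move=> y; rewrite cmodM; apply: ler_pM; rewrite ?cmod_ge0 ?hM// ltW//.
by apply: hd; rewrite opprB addrA subrK.
Qed.

Lemma ccont_char (y : pt) : ccont (fun x : pt => expi (2 * pi * dot x y) : C).
Proof.
apply: ccont_expi; apply: rcontM; [exact: rcont_cst|exact: dot_continuous].
Qed.

Lemma Cc_char f (y : pt) : Cc f -> Cc (fun x => f x * expi (2 * pi * dot x y)).
Proof. by move=> cf; apply: Cc_mulr => //; exact: ccont_char. Qed.

Lemma ccont_modul (t : pt) f : ccont f -> ccont (modul t f).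
Proof.
move=> cf; apply: ccontM => //; apply: ccont_expi; apply: rcontN.
apply: rcontM; first exact: rcont_cst.
rewrite (_ : dot t = fun x => dot x t); first exact: dot_continuous.
by apply/funext => x; exact: dotC.
Qed.

Lemma Cc_modul (t : pt) f : Cc f -> Cc (modul t f).
Proof.
move=> [cf [r hr]]; split; first exact: ccont_modul.
by exists r => x /hr; rewrite /modul => ->; rewrite mulr0.
Qed.

Lemma cmod_modul (t : pt) f x : cmod (modul t f x) = cmod (f x).
Proof. by rewrite cmodM cmod_expi mul1r. Qed.

(** The character at [y] from the first factor and the one at [x - y] from the second, which
    [ftilde] reflects and conjugates, multiply to the character at [x]; this one leaves the integral
    over [y]. *)
Lemma fconv_modul (t : pt) f : Cc f ->
  fconv (modul t f) (ftilde (modul t f)) = modul t (fconv f (ftilde f)).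
Proof.
move=> cf; apply/funext => x; rewrite /fconv /modul -intRdZ; last first.
  apply: Cc_mulr => //; exact: (Cc_refl x (Cc_ftilde cf)).1.
congr intRd; apply/funext => y; rewrite /ftilde cconjM cconj_expi opprK.
rewrite (_ : dot t (- (x - y)) = dot t y - dot t x); last first.
  by rewrite opprB dotDr dotNr.
rewrite mulrACA -expiD; congr (expi _ * _); ring.
Qed.

Lemma fcheck_modul (t y : pt) f : fcheck (modul t f) y = fcheck f (y - t).
Proof.
rewrite /fcheck /modul; congr intRd; apply/funext => x.
rewrite mulrC mulrA -expiD mulrC; congr (_ * expi _).
by rewrite dotDr dotNr (dotC x t); ring.
Qed.

Lemma expi_lip (a b : R) : cmod (expi a - expi b : C) <= 2 * `|a - b|.
Proof.
have lip (u v : R -> R) : (forall x : R, is_derive x (1 : R) u (v x)) -> (forall x, `|v x| <= 1) ->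
    `|u a - u b| <= `|a - b|.
  move=> du vb; wlog ab : a b / b <= a.
    move=> h; have [ba|/ltW ab] := leP b a; first exact: h.
    by rewrite distrC (distrC a); exact: h.
  have du' (x : R) : x \in `]b, a[ -> is_derive x (1 : R) u (v x) by move=> _.
  have cu : {within `[b, a], continuous u}.
    apply: derivable_within_continuous => x _.
    by have := du x; case.
  have [c _ ->] := MVT_segment ab du' cu.
  by rewrite normrM ler_piMl.
apply: le_trans (cmod_le_sum _) _ => /=.
rewrite mulr_natl mulr2n; apply: lerD.
  apply: (lip cos (fun x => - sin x)) => x.
  by rewrite normrN ler_norml sin_geN1 sin_le1.
by apply: (lip sin cos) => x; rewrite ler_norml cos_geN1 cos_le1.
Qed.

Lemma norm_dot_le (x y : pt) : `|dot x y| <= d%:R * (`|x| * `|y|).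
Proof.
apply: le_trans (ler_norm_sum _ _ _) _.
apply: (@le_trans _ _ (\sum_(i < d) (`|x| * `|y|))).
  by apply: ler_sum => i _; rewrite normrM ler_pM// coord_le_norm.
by rewrite sumr_const card_ord mulr_natl.
Qed.

Lemma ccont_fcheck f : Cc f -> ccont (fcheck f).
Proof.
move=> cf; have [r r0 [_ hf]] := Cc_Ccr cf; have [M M0 hM] := Cc_bounded cf.
apply: ccont_eps => y e e0.
(* [A] is a Lipschitz constant of the transform: the integral bound times [M] times the Lipschitz
   constant in [y] of the characters at points [x] of the support. Again [d.+1] keeps it positive
   when [d = 0]. *)
pose A := (4 * r) ^+ d * (M * (2 * (2 * pi * (d.+1%:R * r)))).
have A0 : 0 < A by rewrite /A !mulr_gt0// ?exprn_gt0// ?mulr_gt0// ?pi_gt0// ltr0n.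
exists (e / A) => [|z yz]; first exact: divr_gt0.
rewrite /fcheck -intRdB; [|exact: Cc_char|exact: Cc_char].
have -> : (fun x => f x * expi (2 * pi * dot x y) - f x * expi (2 * pi * dot x z)) =
  (fun x => f x * (expi (2 * pi * dot x y) - expi (2 * pi * dot x z))).
  by apply/funext => x; rewrite mulrBr.
apply: (@le_lt_trans _ _ (A * `|y - z|)); last by rewrite mulrC -ltr_pdivlMr.
rewrite /A -mulrA; apply: intRd_bound => //.
  split; last by move=> x xr; rewrite hf// mul0r.
  apply: ccontM; first exact: cf.1.
  apply: ccontD; first exact: ccont_char.
  have := ccontM (ccont_cst (-1)) (ccont_char z).
  by under [X in ccont X -> _]eq_fun do rewrite mulN1r.
move=> x; have [xr|xr] := leP `|x| r; last first.
  by rewrite hf// mul0r cmod0 !mulr_ge0// ?pi_ge0// ?ltW// ltr0n.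
rewrite cmodM -!mulrA; apply: ler_pM; rewrite ?cmod_ge0 ?hM//.
apply: le_trans (expi_lip _ _) _; rewrite ler_pM2l//.
rewrite -!mulrBr !normrM (ger0_norm (pi_ge0 R)) normr_nat ler_pM2l//.
rewrite ler_pM2l ?pi_gt0// -dotNr -dotDr.
apply: le_trans (norm_dot_le _ _) _.
by apply: ler_pM; rewrite ?mulr_ge0 ?ler_nat// ler_wpM2r.
Qed.

End Convolution.

(** * Quasi-interpolation on grids *)

Section Grid.
Variable R : realType.
Implicit Types (T : R -> R) (y s del eps : R).

(** The union bound for independent events of probabilities [c j]: it passes the deficit of
    one-dimensional partitions of unity on to their tensor product. *)
Lemma prod_defect (d : nat) (c : 'I_d -> R) : (forall j, 0 <= c j <= 1) ->
  0 <= \prod_(j < d) c j <= 1 /\ 1 - \prod_(j < d) c j <= \sum_(j < d) (1 - c j).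
Proof.
elim: d c => [|d ih] c hc; first by rewrite !big_ord0 subrr ler01 !lexx.
have [/andP[p0 p1] h] := ih (fun j => c (lift ord0 j)) (fun j => hc _).
rewrite !big_ord_recl; have /andP[c0 c1] := hc ord0; split.
  by rewrite mulr_ge0//= mulr_ile1.
move: h p0 p1; set p := \prod_(i < d) _; set q := \sum_(i < d) _ => h p0 p1; nra.
Qed.

(** A blurred Heaviside function. Only these properties enter the interpolation, so it serves both
    for [sstep], which gives smooth interpolants, and for [atan_step], which gives limits of
    transforms. *)
Definition is_step T del eps :=
  [/\ forall x y, x <= y -> T x <= T y, forall x, 0 <= T x <= 1,
      T (- del) <= eps & 1 - eps <= T del].

Definition incr T del s y := T (y - s) - T (y - s - del).

Definition gridpt (K : nat) del (i : nat) : R := (i%:R - K%:R) * del.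

Lemma gridptS K del i : gridpt K del i.+1 = gridpt K del i + del.
Proof. by rewrite /gridpt -natr1; ring. Qed.

Section Step.
Variables (T : R -> R) (del eps : R) (K : nat).
Hypotheses (del0 : 0 < del) (stepT : is_step T del eps).
Local Notation N := (K + K)%N.
Local Notation s := (gridpt K del).

Lemma incr_ge0 z y : 0 <= incr T del z y.
Proof.
by case: stepT => h _ _ _; rewrite subr_ge0 h// gerBl ltW.
Qed.

(** The freedom in [F] is for the tail estimate, which telescopes truncations of [T] instead of [T]
    itself. *)
Let tele (F : R -> R) y :
  \sum_(i < N) (F (T (y - s i)) - F (T (y - s i - del))) =
  F (T (y - s 0%N)) - F (T (y - s N)).
Proof.
rewrite -(big_mkord xpredT (fun i => F (T (y - s i)) - F (T (y - s i - del)))).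
rewrite -[RHS]opprB -(telescope_sumr (fun i => F (T (y - s i))))// -sumrN.
by apply: eq_big_nat => i _; rewrite opprB gridptS opprD addrA.
Qed.

Lemma sum_incr_ge0le1 y : 0 <= \sum_(i < N) incr T del (s i) y <= 1.
Proof.
rewrite sumr_ge0/=; last by move=> i _; exact: incr_ge0.
rewrite (tele id) /=; case: stepT => _ h _ _.
have /andP[_ h1] := h (y - s 0%N); have /andP[h2 _] := h (y - s N); lra.
Qed.

Lemma sum_incr_defect y : `|y| + del <= K%:R * del ->
  1 - \sum_(i < N) incr T del (s i) y <= 2 * eps.
Proof.
move=> hy; rewrite (tele id) /=; case: stepT => h _ h1 h2.
have := ler_norm y; have := ler_norm (- y); rewrite normrN => y1 y2.
have a : T del <= T (y - s 0%N) by apply: h; rewrite /gridpt sub0r; lra.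
have b : T (y - s N) <= T (- del) by apply: h; rewrite /gridpt natrD; lra.
lra.
Qed.

(** Estimating the terms one by one would cost a factor [N]. If [y] is farther than [2 * del] from
    the node, both values of [T] in the increment lie above [1 - eps] or both lie below [eps], so
    the increment is at most that of [hi] plus that of [lo] along [T]. Each of these telescopes,
    with total variation at most [eps]. *)
Lemma sum_incr_tail y :
  \sum_(i < N | 2 * del < `|y - s i|) incr T del (s i) y <= 2 * eps.
Proof.
case: stepT => mT T01 h1 h2.
pose lo (x : R) := Num.min x eps; pose hi (x : R) := Num.max x (1 - eps).
have loP x : lo x = x /\ x <= eps \/ lo x = eps /\ eps <= x.
  by rewrite /lo; have [h|h] := leP x eps; [left|right]; split => //; exact: ltW.
have hiP x : hi x = x /\ 1 - eps <= x \/ hi x = 1 - eps /\ x <= 1 - eps.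
  by rewrite /hi; have [h|h] := leP x (1 - eps); [right|left]; split => //; exact: ltW.
have mlo : forall x z, x <= z -> lo x <= lo z by move=> x z xz; move: (loP x) (loP z); lra.
have mhi : forall x z, x <= z -> hi x <= hi z by move=> x z xz; move: (hiP x) (hiP z); lra.
have dT i : T (y - s i - del) <= T (y - s i) by apply: mT; rewrite gerBl ltW.
have := tele lo y; have := tele hi y.
have /andP[a1 a2] := T01 (y - s 0%N); have /andP[b1 b2] := T01 (y - s N).
have /andP[t0 _] := T01 (- del).
move=> e1 e2.
have : \sum_(i < N | 2 * del < `|y - s i|) incr T del (s i) y <=
  \sum_(i < N) (hi (T (y - s i)) - hi (T (y - s i - del))) +
  \sum_(i < N) (lo (T (y - s i)) - lo (T (y - s i - del))).
  rewrite -big_split big_mkcond /=; apply: ler_sum => i _.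
  have := mlo _ _ (dT i); have := mhi _ _ (dT i).
  case: ifPn => [|_]; last by lra.
  rewrite lter_normr => /orP[yi|yi].
    have : T del <= T (y - s i - del) by apply: mT; lra.
    have := dT i; rewrite /incr; move: (loP (T (y - s i))) (loP (T (y - s i - del))) (hiP (T (y - s i))) (hiP (T (y - s i - del))); lra.
  have : T (y - s i) <= T (- del).
    by apply: mT; move: yi del0; rewrite ltrNr; set z := y - _; lra.
  have := dT i; rewrite /incr; move: (loP (T (y - s i))) (loP (T (y - s i - del))) (hiP (T (y - s i))) (hiP (T (y - s i - del))); lra.
rewrite e1 e2; move: (loP (T (y - s 0%N))) (loP (T (y - s N))) (hiP (T (y - s 0%N))) (hiP (T (y - s N))); lra.
Qed.

End Step.

Variable d : nat.
Local Notation C := (R[i]).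
Local Notation pt := ('rV[R]_d).

Definition gridvec (K : nat) del (m : {ffun 'I_d -> 'I_(K + K)}) : pt :=
  \row_j gridpt K del (m j).

Definition grid_sum T del K (psi : pt -> C) (y : pt) : C :=
  \sum_(m : {ffun 'I_d -> 'I_(K + K)})
    psi (gridvec del m) * cofR (\prod_j incr T del (gridpt K del (m j)) (y ord0 j)).

(* The increments of a step function form an approximate partition of unity
   on a grid, so their tensor products quasi-interpolate [psi]. *)
Lemma grid_approx (psi : pt -> C) (e : R) : Cc psi -> 0 < e ->
  exists del eps : R, exists K : nat, [/\ 0 < del <= 1 / 2, 0 < eps &
    forall T, is_step T del eps -> forall y : pt, cmod (psi y - grid_sum T del K psi y) <= e].
Proof.
move=> cpsi e0.
have [M M0 hM] := Cc_bounded cpsi; have [r r0 [_ hr]] := Cc_Ccr cpsi.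
have [d0 d00 hd] := Cc_unif_cont cpsi (divr_gt0 e0 (ltr0n _ 2)).
(* The first bound keeps the window [2 * del] below the modulus of continuity [d0]; the second keeps
   it below 1, which limits the growth of supports in [smooth_dense]. *)
pose del := Num.min (d0 / 3) (1 / 2).
have del0 : 0 < del by rewrite /del lt_min !divr_gt0.
have del3 : 2 * del < d0 by have : del <= d0 / 3; [by rewrite ge_min lexx|lra].
(* Half of [e] goes to the oscillation of [psi] in the window. The other half is 6 units
   [M * d.+1%:R * eps]: 2 for the deficit of the weights, 4 for the tails. *)
pose eps := e / (12 * (M * d.+1%:R)).
have Md0 : 0 < M * d.+1%:R by rewrite mulr_gt0// ltr0n.
have eps0 : 0 < eps by rewrite divr_gt0// mulr_gt0.
have epsE : 6 * (M * d.+1%:R * eps) = e / 2.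
  rewrite /eps; field; rewrite !lt0r_neq0// ltr0n//.
pose K := (Num.truncn ((r + del) / del)).+1.
have hK : r + del <= K%:R * del.
  rewrite -ler_pdivrMr// ltW// /K; apply: truncnS_gt.
exists del, eps, K; split => //; first by rewrite del0 /del ge_min lexx orbT.
move=> T sT y.
pose a (j : 'I_d) (k : 'I_(K + K)) := incr T del (gridpt K del k) (y ord0 j).
pose W (m : {ffun 'I_d -> 'I_(K + K)}) := \prod_j a j (m j).
have a0 j k : 0 <= a j k by exact: incr_ge0 sT _ _.
have W0 m : 0 <= W m by apply: prodr_ge0.
have sumW : \sum_m W m = \prod_j \sum_k a j k by rewrite bigA_distr_bigA.
have [/andP[P0 P1] Pd] : 0 <= \sum_m W m <= 1 /\ 1 - \sum_m W m <= \sum_(j < d) (1 - \sum_k a j k).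
  rewrite sumW; apply: prod_defect => j; exact: sum_incr_ge0le1 sT _.
pose tl (j : 'I_d) (k : 'I_(K + K)) := 2 * del < `|y ord0 j - gridpt K del k|.
have tailj j : \sum_(m : {ffun 'I_d -> 'I_(K + K)} | tl j (m j)) W m <= 2 * eps.
  rewrite big_mkcond /=.
  (* The restriction on [m j] is absorbed into the [j]-th factor, so that the restricted sum over
     [m] still factors into one-dimensional sums. *)
  pose b (i : 'I_d) k := a i k * (if (i == j) && ~~ tl j k then 0 else 1).
  rewrite (eq_bigr (fun m : {ffun 'I_d -> 'I_(K + K)} => \prod_i b i (m i))); last first.
    move=> m _; case: ifPn => h.
      apply: eq_bigr => i _; rewrite /b; case: eqP => [->|_]; last by rewrite mulr1.
      by rewrite h mulr1.
    by rewrite (bigD1 j)//= /b eqxx h mulr0 mul0r.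
  rewrite -bigA_distr_bigA (bigD1 j)//=.
  have bj : 0 <= \sum_k b j k <= 2 * eps.
    rewrite sumr_ge0 /= => [|k _]; last by rewrite /b; case: ifP; rewrite ?mulr0 ?mulr1.
    apply: le_trans (sum_incr_tail K del0 sT (y ord0 j)).
    rewrite [leRHS]big_mkcond; apply: ler_sum => k _; rewrite /b eqxx /= /tl.
    by case: (2 * del < _); rewrite /= ?mulr0 ?mulr1.
  have bi : 0 <= \prod_(i < d | i != j) \sum_k b i k <= 1.
    rewrite prodr_ge0 /= => [|i _]; last by apply: sumr_ge0 => k _; rewrite /b; case: ifP; rewrite ?mulr0 ?mulr1.
    apply: prodr_ile1 => i ij; have /andP[h1 h2] := sum_incr_ge0le1 K del0 sT (y ord0 i).
    rewrite (eq_bigr (a i)) ?h1 ?h2//.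
    by move=> k _; rewrite /b (negbTE ij) mulr1.
  by case/andP: bj => bj0 bj1; case/andP: bi => bi0 bi1; rewrite -[leRHS]mulr1 ler_pM.
have -> : psi y - grid_sum T del K psi y =
  psi y * cofR (1 - \sum_m W m) + \sum_m (psi y - psi (gridvec del m)) * cofR (W m).
  rewrite cofRD cofRN cofR_sum mulrDr mulrN mulr_sumr.
  under [X in _ = _ + X]eq_bigr do rewrite mulrBl.
  rewrite sumrB addrA subrK; congr (_ - _).
  by rewrite (_ : cofR 1 = 1)// mulr1.
apply: le_trans (cmodD _ _) _.
have dM : d%:R * (M * eps) <= d.+1%:R * (M * eps).
  apply: ler_wpM2r; first by rewrite mulr_ge0 ?(ltW M0) ?(ltW eps0).
  by rewrite ler_nat leqnSn.
have h1 : cmod (psi y * cofR (1 - \sum_m W m)) <= 2 * (M * d.+1%:R * eps).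
  rewrite cmodM cmod_cofR; have [yr|yr] := leP `|y| r; last first.
    by rewrite hr// cmod0 mul0r mulr_ge0// mulr_ge0 ?(ltW Md0) ?(ltW eps0).
  rewrite ger0_norm ?subr_ge0//.
  have : 1 - \sum_m W m <= d%:R * (2 * eps).
    apply: le_trans Pd _; rewrite -[X in _ <= X%:R * _]card_ord mulr_natl -sumr_const.
    apply: ler_sum => j _; apply: sum_incr_defect => //.
    by apply: le_trans hK; rewrite lerD2r (le_trans (coord_le_norm _ _)).
  move=> hW; apply: (@le_trans _ _ (M * (d%:R * (2 * eps)))).
    by apply: ler_pM => //; rewrite ?cmod_ge0 ?subr_ge0.
  by move: dM; lra.
have h2 : cmod (\sum_m (psi y - psi (gridvec del m)) * cofR (W m)) <=
    e / 2 + 4 * (M * d.+1%:R * eps).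
  apply: le_trans (cmod_sum _ _ _) _.
  have : \sum_m cmod ((psi y - psi (gridvec del m)) * cofR (W m)) <=
    \sum_m (e / 2 * W m) + \sum_j \sum_(m : {ffun 'I_d -> 'I_(K + K)} | tl j (m j)) 2 * M * W m.
    rewrite (exchange_big_dep xpredT)//= -big_split /=; apply: ler_sum => m _.
    rewrite cmodM cmod_cofR (ger0_norm (W0 m)).
    (* A node far from [y] in some coordinate is charged to that coordinate with the trivial bound
       [2 * M]; any other node lies in the window, where uniform continuity applies. *)
    have [/existsP[j hj]|] := boolP [exists j, tl j (m j)].
      apply: (@le_trans _ _ (2 * M * W m)).
        rewrite ler_wpM2r//; apply: le_trans (cmodB _ _) _.
        by rewrite mulr_natl mulr2n lerD.
      rewrite (bigD1 j)//= addrCA lerDl addr_ge0//.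
        by rewrite mulr_ge0// ltW// divr_gt0.
      by apply: sumr_ge0 => i _; rewrite mulr_ge0// mulr_ge0// ltW.
    rewrite negb_exists => /forallP hn.
    apply: (@le_trans _ _ (e / 2 * W m)); last first.
      by rewrite lerDl; apply: sumr_ge0 => i _; rewrite mulr_ge0// mulr_ge0// ltW.
    rewrite ler_wpM2r// ltW//; apply: hd; apply: le_lt_trans del3.
    rewrite mx_norm_le ?mulr_ge0 ?ltW//; apply/forallP => j; rewrite !mxE leNgt.
    exact: hn.
  move=> /le_trans; apply; apply: lerD.
    by rewrite -mulr_sumr ler_piMr// divr_ge0// ltW.
  apply: (@le_trans _ _ (\sum_(j < d) 2 * M * (2 * eps))).
    apply: ler_sum => j _; rewrite -mulr_sumr; apply: ler_wpM2l; last exact: tailj.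
    by rewrite mulr_ge0// ltW.
  rewrite sumr_const card_ord -[leLHS]mulr_natl.
  by move: dM; lra.
by apply: le_trans (lerD h1 h2) _; move: epsE; lra.
Qed.

End Grid.

(** * Smooth cutoffs and density of smooth functions *)

Section FlatFunction.
Variable R : realType.

(** [hexp] is the case [k = 0]. The linear span of these functions is stable under differentiation,
    which makes smoothness of [hexp] an induction. *)
Definition flat (k : nat) (s : R) : R := if 0 < s then s ^- k * expR (- s^-1) else 0.

Lemma flat_ge0 k s : 0 <= flat k s.
Proof.
rewrite /flat; case: ifPn => // s0.
by rewrite mulr_ge0 ?expR_ge0// invr_ge0 exprn_ge0// ltW.
Qed.

(** The term of degree [k + 2] of the exponential series at 1/s gives the factorial. Two more powers
    than [k] are used, so that the bound is quadratic and forces derivative 0 at the origin. *)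
Lemma flat_bound k s : `|flat k s| <= (k.+2)`!%:R * s ^+ 2.
Proof.
rewrite ger0_norm ?flat_ge0// /flat; case: ifPn => [s0|_]; last by rewrite mulr_ge0 ?sqr_ge0.
have si : 0 < s^-1 by rewrite invr_gt0.
have := @expR_ge1Dxn R s^-1 k.+1 (ltW si).
set F : R := (k.+2)`!%:R; have F0 : 0 < F by rewrite ltr0n fact_gt0.
move=> h; have {}h : s^-1 ^+ k.+2 / F <= expR s^-1 by apply: le_trans h; rewrite lerDr.
rewrite expRN -exprVn ler_pdivrMr ?expR_gt0//.
have : F * s ^+ 2 * (s^-1 ^+ k.+2 / F) <= F * s ^+ 2 * expR s^-1.
  by rewrite ler_pM2l// mulr_gt0// exprn_gt0.
apply: le_trans; rewrite (_ : _ * (_ / F) = s^-1 ^+ k)//.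
have E1 : s ^+ 2 * s^-1 ^+ 2 = 1 by rewrite -exprMn divff ?expr1n ?lt0r_neq0.
have E2 : F / F = 1 by rewrite divff ?lt0r_neq0.
rewrite -(addn2 k) (exprD s^-1) (_ : _ * (_ / F) = s^-1 ^+ k * (s ^+ 2 * s^-1 ^+ 2) * (F / F)).
  by rewrite E1 E2 !mulr1.
ring.
Qed.

Lemma is_derive_quad (f : R -> R) (c : R) : (forall s, `|f s| <= c * s ^+ 2) ->
  is_derive (0 : R) (1 : R) f 0.
Proof.
move=> hf; have f0 : f 0 = 0.
  by apply/eqP; rewrite -normr_le0 (le_trans (hf 0))// expr0n mulr0.
have h : h^-1 *: (f (h *: (1 : R) + 0) - f 0) @[h --> (0 : R)^'] --> (0 : R).
  apply/(@cvgrPdist_lt R) => e e0; near=> x.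
  have x0 : x != 0 by near: x; exact: nbhs_dnbhs_neq.
  rewrite sub0r normrN f0 subr0 addr0 [x *: _]mulr1 normrZ normfV.
  rewrite mulrC ltr_pdivrMr ?normr_gt0//.
  apply: le_lt_trans (hf x) _; rewrite -[x ^+ 2]real_normK ?num_real// expr2 mulrA.
  rewrite ltr_pM2r ?normr_gt0//.
  apply: (@le_lt_trans _ _ (`|c| * `|x|)); first by rewrite ler_wpM2r// ler_norm.
  apply: (@le_lt_trans _ _ ((`|c| + 1) * `|x|)); first by rewrite ler_wpM2r// lerDl.
  rewrite mulrC -ltr_pdivlMr; last by rewrite ltr_wpDl.
  near: x; apply: dnbhs0_lt; by rewrite divr_gt0// ltr_wpDl.
by apply: DeriveDef; [apply/cvg_ex; exists 0|exact: cvg_lim h].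
Unshelve. all: by end_near. Qed.

Lemma is_derive_flat k (s : R) :
  is_derive s (1 : R) (flat k) (flat k.+2 s - k%:R * flat k.+1 s).
Proof.
have [s0|s0|s0] := ltgtP s 0.
- have e : \forall z \near s, cst (0 : R) z = flat k z.
    near=> z; rewrite /flat ifF//; apply/negbTE; rewrite -leNgt ltW//; near: z.
    exact: lt_nbhsl.
  have -> : flat k.+2 s - k%:R * flat k.+1 s = 0 :> R.
    by rewrite /flat !ifF ?mulr0 ?subrr//; apply/negbTE; rewrite -leNgt ltW.
  by apply: (near_eq_is_derive e); exact: is_derive_cst.
- pose iv (z : R) := z^-1.
  have sn : s != 0 by rewrite lt0r_neq0.
  have e : \forall z \near s, (iv ^+ k * (expR \o (fun z => - iv z))) z = flat k z.
    near=> z; rewrite /flat ifT; last by near: z; exact: lt_nbhsr.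
    by rewrite -exprVn !fctE.
  have di : is_derive s (1 : R) iv (- s ^- 2).
    by have := @is_deriveV R id s 1 1 sn (is_derive_id s 1); rewrite [_ *: 1]mulr1.
  have de : is_derive s (1 : R) (expR \o (fun z => - iv z)) (expR (- iv s) * s ^- 2).
    apply: is_derive1_comp; rewrite -[s ^- 2]opprK; exact: is_deriveN.
  apply: near_eq_is_derive e _; apply: is_derive_eq.
  rewrite /flat s0 !fctE /= /iv -!exprVn; set E := expR _.
  rewrite /GRing.scale /=; case: (k) => [|k'] /=; first by ring.
  by rewrite !exprS expr0; ring.
- rewrite s0 /flat ltxx mulr0 subrr; exact: is_derive_quad (flat_bound k).
Unshelve. all: by end_near. Qed.

Lemma flat_cont k : continuous (flat k).
Proof.
move=> s; apply: differentiable_continuous; apply/derivable1_diffP.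
by have [] := is_derive_flat k s.
Qed.

Lemma hexp_flat : @hexp R = flat 0.
Proof. by apply/funext => s; rewrite /hexp /flat expr0 invr1 mul1r. Qed.

Lemma hexp_ge0 (s : R) : 0 <= hexp s.
Proof. by rewrite hexp_flat flat_ge0. Qed.

Lemma hexp_gt0 (s : R) : 0 < s -> 0 < hexp s.
Proof. by rewrite /hexp => ->; exact: expR_gt0. Qed.

Lemma hexp_eq0 (s : R) : s <= 0 -> hexp s = 0.
Proof. by rewrite /hexp ltNge => ->. Qed.

Lemma hexp_mono (s t : R) : s <= t -> hexp s <= hexp t.
Proof.
move=> st; have [s0|s0] := leP s 0; first by rewrite (hexp_eq0 s0) hexp_ge0.
have t0 := lt_le_trans s0 st.
by rewrite /hexp s0 t0 ler_expR lerN2 lef_pV2.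
Qed.

Lemma hexp_den (a b : R) : 0 < a \/ 0 < b -> 0 < hexp a + hexp b.
Proof.
move=> [/hexp_gt0 h|/hexp_gt0 h]; [apply: ltr_wpDr => //|apply: ltr_wpDl => //]; exact: hexp_ge0.
Qed.

End FlatFunction.

(** * Functions with continuous partial derivatives, and smooth approximation in C_c *)

Section Smooth.
Variables (R : realType) (d : nat).
Local Notation C := (R[i]).
Local Notation pt := ('rV[R]_d).
Implicit Types (u v : pt -> R).

(** Differentiability is asked along the basis vectors only, one derivative at a time, to match the
    way [smooth] iterates [dpart] through [dlist]. *)
Fixpoint Cn (n : nat) (u : pt -> R) : Prop :=
  continuous u /\
  if n is n'.+1 then
    forall j : 'I_d, (forall x, derivable u x (evec R j)) /\
      Cn n' (fun x => 'D_(evec R j) u x)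
  else True.

Lemma CnS n u : Cn n.+1 u -> Cn n u.
Proof.
elim: n u => [|n ih] u [cu h]; split => //.
by move=> j; have [hd hn] := h j; split => //; exact: ih.
Qed.

Lemma Cn_cont n u : Cn n u -> continuous u.
Proof. by case: n => [|n] []. Qed.

Lemma Cn_cst n (c : R) : Cn n (fun=> c).
Proof.
elim: n c => [|n ih] c; first by split => //; exact: rcont_cst.
split; first exact: rcont_cst.
move=> j; split => [x|]; first exact: derivable_cst.
have -> : 'D_(evec R j) (fun _ : pt => c) = fun=> 0; last exact: ih.
by apply/funext => x; exact: derive_cst.
Qed.

Lemma CnD n u v : Cn n u -> Cn n v -> Cn n (fun x => u x + v x).
Proof.
elim: n u v => [|n ih] u v [cu hu] [cv hv]; first by split => //; exact: rcontD.
split; first exact: rcontD.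
move=> j; have [du nu] := hu j; have [dv nv] := hv j; split => [x|].
  exact: derivableD.
rewrite (_ : (fun x => _) = fun x => 'D_(evec R j) u x + 'D_(evec R j) v x); first exact: ih.
by apply/funext => x; apply: deriveD.
Qed.

Lemma CnM n u v : Cn n u -> Cn n v -> Cn n (fun x => u x * v x).
Proof.
elim: n u v => [|n ih] u v cnu cnv.
  by case: cnu => cu _; case: cnv => cv _; split => //; exact: rcontM.
have [cu hu] := cnu; have [cv hv] := cnv; split; first exact: rcontM.
move=> j; have [du nu] := hu j; have [dv nv] := hv j; split => [x|].
  exact: derivableM.
rewrite (_ : (fun x => _) = fun x => u x * 'D_(evec R j) v x + v x * 'D_(evec R j) u x).
  by apply: CnD; apply: ih => //; exact: CnS.
by apply/funext => x; apply: deriveM.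
Qed.

Lemma CnN n u : Cn n u -> Cn n (fun x => - u x).
Proof.
move=> h; have := CnM (Cn_cst n (-1)) h.
by under [X in Cn n X -> _]eq_fun do rewrite mulN1r.
Qed.

Lemma CnV n u : (forall x, u x != 0) -> Cn n u -> Cn n (fun x => (u x)^-1).
Proof.
move=> u0; elim: n u u0 => [|n ih] u u0 cnu.
  by case: cnu => cu _; split => // x; apply: continuousV => //; exact: cu.
have [cu hu] := cnu; split; first by move=> x; apply: continuousV => //; exact: cu.
move=> j; have [du nu] := hu j; split => [x|]; first exact: derivableV.
have h := ih u u0 (CnS cnu).
rewrite (_ : (fun x => _) = fun x => - (((u x)^-1 * (u x)^-1) * 'D_(evec R j) u x)).
  by apply: CnN; apply: CnM => //; exact: CnM.
apply/funext => x; rewrite (@deriveV _ _ u)// -mulNr -[LHS]/(_ * _).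
by congr (_ * _); rewrite -exprVn expr2.
Qed.

Lemma Cn_sum n (I : Type) (s : seq I) (F : I -> pt -> R) :
  (forall i, Cn n (F i)) -> Cn n (fun x => \sum_(i <- s) F i x).
Proof.
move=> cF; elim: s => [|i s ih].
  by under [X in Cn n X]eq_fun do rewrite big_nil; exact: Cn_cst.
by under [X in Cn n X]eq_fun do rewrite big_cons; exact: CnD.
Qed.

Lemma Cn_prod n (I : Type) (s : seq I) (F : I -> pt -> R) :
  (forall i, Cn n (F i)) -> Cn n (fun x => \prod_(i <- s) F i x).
Proof.
move=> cF; elim: s => [|i s ih].
  by under [X in Cn n X]eq_fun do rewrite big_nil; exact: Cn_cst.
by under [X in Cn n X]eq_fun do rewrite big_cons; exact: CnM.
Qed.

Lemma is_derive_line (u : pt -> R) x w (l : R) :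
  is_derive (0 : R) (1 : R) (fun h : R => u (h *: w + x)) l ->
  is_derive x w u l.
Proof.
move=> [h1 h2]; apply: DeriveDef; first exact/derivable1P.
rewrite -h2 /derive; congr (lim _); apply/funext => A /=.
by congr (nbhs _ _); apply/funext => h /=; rewrite addr0 scale0r add0r [h *: 1]mulr1.
Qed.

Lemma Cn_coord n (j : 'I_d) : Cn n (fun x : pt => x ord0 j).
Proof.
have dc x i : is_derive x (evec R i) (fun x : pt => x ord0 j) (i == j)%:R.
  apply: is_derive_line.
  rewrite (_ : (fun h => _) = fun h : R => h * (i == j)%:R + x ord0 j); last first.
    by apply/funext => h; rewrite !mxE eqxx /= eq_sym.
  have -> : (fun h : R => h * (i == j)%:R + x ord0 j) =
      (i == j)%:R \*: id + cst (x ord0 j) :> (R -> R).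
    by apply/funext => h; rewrite mulrC.
  by apply: is_derive_eq; rewrite addr0 [_ *: 1]mulr1.
case: n => [|n]; first by split => //; exact: coord_cont.
split; first exact: coord_cont.
move=> i; split => [x|]; first by case: (dc x i).
rewrite (_ : (fun x => _) = fun=> (i == j)%:R); first exact: Cn_cst.
by apply/funext => x; case: (dc x i).
Qed.

(** Induction on [n] with [k] free, as the chain rule trades [flat k] for [flat k.+1] and
    [flat k.+2]; the regularity [n.+1] of [u] supplies the inner derivative. *)
Lemma Cn_flat n k u : (forall m, Cn m u) -> Cn n (fun x => flat k (u x)).
Proof.
move=> cu; elim: n k => [|n ih] k.
  by split => //; apply: rcont_comp; [exact: Cn_cont (cu 0%N)|exact: flat_cont].
split; first by apply: rcont_comp; [exact: Cn_cont (cu 0%N)|exact: flat_cont].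
move=> j; have [_ /(_ j) [du _]] := cu 1%N.
have dc x : is_derive x (evec R j) (fun x => flat k (u x))
    ('D_(evec R j) u x * (flat k.+2 (u x) - k%:R * flat k.+1 (u x))).
  apply: is_derive_line.
  have h1 : is_derive (0 : R) (1 : R) (fun h : R => u (h *: evec R j + x)) ('D_(evec R j) u x).
    have d1 := (derivable1P u x (evec R j)).1 (du x).
    apply: (DeriveDef d1).
    rewrite /derive; congr (lim _); apply/funext => A /=.
    by congr (nbhs _ _); apply/funext => h /=; rewrite addr0 scale0r add0r [h *: 1]mulr1.
  have h2 := is_derive_flat k (u (0 *: evec R j + x)).
  have := @is_derive1_comp R (flat k) (fun h : R => u (h *: evec R j + x)) 0 _ _ h2 h1.
  by rewrite scale0r add0r mulrC.
split => [x|]; first by case: (dc x).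
rewrite (_ : (fun x => _) = fun x => 'D_(evec R j) u x *
     (flat k.+2 (u x) + - (k%:R * flat k.+1 (u x)))); last first.
  by apply/funext => x; case: (dc x).
apply: CnM; first by have [_ /(_ j) []] := cu n.+1.
by apply: CnD => //; apply: CnN; apply: CnM => //; exact: Cn_cst.
Qed.

Lemma dlist_Cn (f : pt -> C) l :
  (forall n, Cn n (fun x => cre (f x))) -> (forall n, Cn n (fun x => cim (f x))) ->
  (forall n, Cn n (fun x => cre (dlist l f x))) /\
  (forall n, Cn n (fun x => cim (dlist l f x))).
Proof.
move=> fr fi; elim: l => [|j l [ihr ihi]] //=; split => n.
  by have [_ /(_ j) []] := ihr n.+1.
by have [_ /(_ j) []] := ihi n.+1.
Qed.

Lemma smooth_Cn (f : pt -> C) :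
  (forall n, Cn n (fun x => cre (f x))) -> (forall n, Cn n (fun x => cim (f x))) ->
  smooth f.
Proof.
move=> fr fi l; have [hr hi] := dlist_Cn l fr fi; split.
  by apply/ccontP; split; [exact: Cn_cont (hr 0%N)|exact: Cn_cont (hi 0%N)].
move=> j x; have [_ /(_ j) [h _]] := hr 1%N; have [_ /(_ j) [h' _]] := hi 1%N.
by split; [exact: h|exact: h'].
Qed.

(** The region beyond radius [r] is open, so near each of its points the function being
    differentiated is identically zero. *)
Lemma dlist_supp (f : pt -> C) r l : supp_in r f -> supp_in r (dlist l f).
Proof.
move=> hf; elim: l => [|j l ih] //= x xr.
have ev (w : C -> R) : w 0 = 0 -> 'D_(evec R j) (fun y => w (dlist l f y)) x = 0.
  move=> w0; have vn : evec R j != 0.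
    apply/eqP => /rowP /(_ j); rewrite !mxE !eqxx => /eqP; by rewrite oner_eq0.
  have e : \forall z \near x, cst (0 : R) z = w (dlist l f z).
    near=> z; rewrite ih ?w0//; near: z.
    by apply: (cvgr_gt `|x|) => //; exact: norm_continuous.
  by rewrite -(near_eq_derive _ e) derive_cst.
by rewrite /dpart !ev.
Unshelve. all: by end_near. Qed.

Lemma schwartz_of_Cn (f : pt -> C) r : 0 < r -> supp_in r f ->
  (forall n, Cn n (fun x => cre (f x))) -> (forall n, Cn n (fun x => cim (f x))) ->
  schwartz f.
Proof.
move=> r0 hf fr fi; have sf := smooth_Cn fr fi; split => // l N.
have cl := (sf l).1; have hl := @dlist_supp f r l hf.
have [M M0 hM] := cont_bounded r (cmod_continuous cl).
exists ((1 + d%:R * r) ^+ N * M) => x; have [xr|xr] := leP `|x| r; last first.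
  by rewrite hl// cmod0 mulr0 mulr_ge0 ?exprn_ge0 ?addr_ge0 ?mulr_ge0// ltW.
apply: ler_pM; rewrite ?exprn_ge0 ?cmod_ge0 ?addr_ge0 ?enorm_ge0//.
  rewrite lerXn2r ?nnegrE ?addr_ge0 ?enorm_ge0 ?mulr_ge0 ?(ltW r0)// lerD2l.
  by apply: le_trans (enorm_le_norm x) _; rewrite ler_wpM2l.
by apply: le_trans (hM x xr); exact: ler_norm.
Qed.

(** Smooth transition from 0 on the negative axis to 1 beyond 1, by the same quotient as in
    [chi]. *)
Definition sstep (x : R) : R := hexp x / (hexp x + hexp (1 - x)).

Lemma sstep_den x : 0 < hexp x + hexp (1 - x) :> R.
Proof. by apply: hexp_den; have [h|h] := ltP 0 x; [left|right]; lra. Qed.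

(** The value [eps = 0] is allowed because [sstep] is exactly constant on both sides of its
    transition; this makes the smooth interpolants compactly supported. *)
Lemma sstep_is_step (del eps : R) : 0 < del -> 0 <= eps ->
  is_step (fun y => sstep (y / del)) del eps.
Proof.
move=> del0 eps0; split.
- move=> x y xy; have {}xy : x / del <= y / del by rewrite ler_pM2r ?invr_gt0.
  move: xy; set a := x / del; set b := y / del => ab.
  rewrite /sstep ler_pdivrMr ?sstep_den// mulrAC ler_pdivlMr ?sstep_den//.
  have h1 := hexp_mono ab; have h2 : hexp (1 - b) <= hexp (1 - a) by apply: hexp_mono; lra.
  have := hexp_ge0 a; have := hexp_ge0 (1 - b); nra.
- move=> x; rewrite divr_ge0 ?hexp_ge0 ?(ltW (sstep_den _))//=.
  by rewrite ler_pdivrMr ?sstep_den// mul1r lerDl hexp_ge0.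
- by rewrite mulNr divff ?lt0r_neq0// /sstep hexp_eq0 ?mul0r// lerN10.
- rewrite divff ?lt0r_neq0// /sstep subrr (hexp_eq0 (lexx 0)) addr0 divff; first by lra.
  by rewrite lt0r_neq0// hexp_gt0.
Qed.

(** Quasi-interpolation with [sstep]. The increments vanish exactly off windows of radius
    [2 * del <= 1], so the support grows by at most 1 whatever [e] is, and one ball serves for all
    approximations. *)
Lemma smooth_dense r e (psi : pt -> C) : 0 < r -> Ccr r psi -> 0 < e ->
  exists phi, [/\ schwartz phi, Ccr (r + 1) phi & forall y, cmod (psi y - phi y) <= e].
Proof.
move=> r0 cpsi e0.
have [del [eps [K [/andP[del0 del2] eps0 h]]]] := grid_approx (Ccr_Cc cpsi) e0.
pose T y := sstep (y / del).
have sT : is_step T del eps by apply: sstep_is_step => //; exact: ltW.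
pose phi := grid_sum T del K psi.
have r1 : 0 < r + 1 by lra.
have CT n j s : Cn n (fun x : pt => incr T del s (x ord0 j)).
  have aff m t : Cn m (fun x : pt => (x ord0 j + t) * del^-1).
    by apply: CnM; [apply: CnD; [exact: Cn_coord|exact: Cn_cst]|exact: Cn_cst].
  have ss m t : Cn m (fun x : pt => sstep ((x ord0 j + t) / del)).
    have h1 k : Cn k (fun x : pt => hexp ((x ord0 j + t) / del)).
      by rewrite hexp_flat; apply: Cn_flat => q; exact: aff.
    have h2 k : Cn k (fun x : pt => hexp (1 - (x ord0 j + t) / del)).
      rewrite hexp_flat; apply: Cn_flat => q; apply: CnD; first exact: Cn_cst.
      by apply: CnN; exact: aff.
    apply: CnM => //; apply: CnV; last exact: CnD.
    by move=> x; rewrite lt0r_neq0// sstep_den.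
  apply: CnD; first exact: ss.
  apply: CnN; rewrite /T.
  by under [X in Cn n X]eq_fun do rewrite -addrA; exact: ss.
have CnP n m : Cn n (fun x : pt => \prod_j incr T del (gridpt K del (m j)) (x ord0 j)).
  by apply: Cn_prod => j; exact: CT.
have phir n : Cn n (fun x => cre (phi x)).
  under [X in Cn n X]eq_fun do rewrite /phi /grid_sum cre_sum.
  apply: Cn_sum => m; under [X in Cn n X]eq_fun do rewrite creM /= mulr0 subr0.
  by apply: CnM => //; exact: Cn_cst.
have phii n : Cn n (fun x => cim (phi x)).
  under [X in Cn n X]eq_fun do rewrite /phi /grid_sum cim_sum.
  apply: Cn_sum => m; under [X in Cn n X]eq_fun do rewrite cimM /= mulr0 add0r.
  by apply: CnM => //; exact: Cn_cst.
have supp : supp_in (r + 1) phi.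
  move=> y yr; apply: big1 => m _.
  have [mr|mr] := ltP r `|gridvec del m|; first by rewrite cpsi.2// mul0r.
  have [j hj] : exists j, 2 * del < `|y ord0 j - gridpt K del (m j)|.
    apply/existsP; apply: contraT; rewrite negb_exists => /forallP hn.
    have : `|y - gridvec del m| <= 2 * del.
      rewrite mx_norm_le ?mulr_ge0 ?ltW//; apply/forallP => j; rewrite !mxE leNgt.
      exact: hn.
    have := lerB_dist y (gridvec del m); lra.
  rewrite (bigD1 j)//= (_ : incr _ _ _ _ = 0) ?mul0r ?mulr0//.
  (* With error 0, both values of [T] in a far increment are equal to 1 or both are equal to 0, and
     the increment vanishes. *)
  have [mT T01 Tl Th] : is_step T del 0 by exact: sstep_is_step.
  move: hj; rewrite /incr; set z := y ord0 j - _ => hj.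
  have := T01 z; have := T01 (z - del); move: hj; rewrite lter_normr => /orP[hz|hz].
    have a : T del <= T z by apply: mT; lra.
    have b : T del <= T (z - del) by apply: mT; lra.
    lra.
  have a : T z <= T (- del) by apply: mT; lra.
  have b : T (z - del) <= T (- del) by apply: mT; lra.
  lra.
exists phi; split; last exact: h.
  exact: schwartz_of_Cn supp phir phii.
by split => //; apply/ccontP; split; [exact: Cn_cont (phir 0%N)|exact: Cn_cont (phii 0%N)].
Qed.

End Smooth.

(** * Measures and uniform boundedness *)

Section MeasureFunctional.
Variables (R : realType) (d : nat).
Local Notation C := (R[i]).
Local Notation pt := ('rV[R]_d).
Implicit Types (f g : pt -> C) (m : measure_on R d).

Lemma measD m f g : is_measure m -> Cc f -> Cc g ->
  m (fun x => f x + g x) = m f + m g.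
Proof. by move=> [h _ _]; exact: h. Qed.

Lemma measZ m (c : C) f : is_measure m -> Cc f -> m (fun x => c * f x) = c * m f.
Proof. by move=> [_ h _]; exact: h. Qed.

Lemma measB m f g : is_measure m -> Cc f -> Cc g ->
  m (fun x => f x - g x) = m f - m g.
Proof.
move=> hm cf cg; rewrite -mulN1r -measZ// -measD//; last exact: Cc_scale.
by congr m; apply/funext => x; rewrite mulN1r.
Qed.

Lemma meas_bound m (r : R) : is_measure m -> exists2 K, 0 <= K &
  forall f M, Ccr r f -> (forall x, cmod (f x) <= M) -> cmod (m f) <= K * M.
Proof.
move=> [_ _ h]; have [K hK] := h (d%:R * r); exists `|K| => // f M cf fM.
have M0 : 0 <= M by apply: le_trans (fM 0); exact: cmod_ge0.
apply: (@le_trans _ _ (K * M)); last by rewrite ler_wpM2r// ler_norm.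
apply: hK => //; first exact: Ccr_Cc cf.
move=> x xr; apply: cf.2; have := lt_le_trans xr (enorm_le_norm x).
case: d x {xr} => [|n] x; last by rewrite ltr_pM2l ?ltr0n.
by rewrite !mul0r ltxx.
Qed.

Lemma hexp_cont : continuous (@hexp R).
Proof. by rewrite hexp_flat; exact: flat_cont. Qed.

Lemma chi_den (x : pt) : 0 < hexp (4 - dot x x) + hexp (dot x x - 1).
Proof. by apply: hexp_den; have [h|h] := ltP (dot x x) 4; [left|right]; lra. Qed.

Lemma chi_ge0le1 (x : pt) : 0 <= chi x <= 1.
Proof.
rewrite /chi divr_ge0 ?hexp_ge0 ?(ltW (chi_den _))//=.
by rewrite ler_pdivrMr ?chi_den// mul1r lerDl hexp_ge0.
Qed.

Lemma chi_eq1 (x : pt) : dot x x <= 1 -> chi x = 1.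
Proof.
move=> h; rewrite /chi (@hexp_eq0 _ (dot x x - 1)); last by lra.
by rewrite addr0 divff// lt0r_neq0// hexp_gt0//; lra.
Qed.

Lemma chi_eq0 (x : pt) : 4 <= dot x x -> chi x = 0.
Proof. by move=> h; rewrite /chi hexp_eq0 ?mul0r//; lra. Qed.

Lemma dotself_cont : continuous (fun x : pt => dot x x).
Proof. by apply: rcont_sum => i; apply: rcontM; exact: coord_cont. Qed.

Lemma chi_cont : continuous (@chi R d).
Proof.
rewrite /chi; apply: rcontM.
  apply: rcont_comp; last exact: hexp_cont.
  by apply: rcontD; [exact: rcont_cst|apply: rcontN; exact: dotself_cont].
apply: rcontV => [x|]; first by rewrite lt0r_neq0// chi_den.
apply: rcontD; apply: rcont_comp; try exact: hexp_cont.
  by apply: rcontD; [exact: rcont_cst|apply: rcontN; exact: dotself_cont].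
by apply: rcontD; [exact: dotself_cont|exact: rcont_cst].
Qed.

Lemma dotZ (c : R) (x : pt) : dot (c *: x) (c *: x) = c ^+ 2 * dot x x.
Proof. by rewrite /dot mulr_sumr; apply: eq_bigr => i _; rewrite !mxE; ring. Qed.

Lemma cutoff_ge0le1 k (x : pt) : 0 <= cutoff k x <= 1.
Proof. exact: chi_ge0le1. Qed.

Lemma cutoff_eq1 k (r : R) (x : pt) : d%:R * r <= k.+1%:R -> `|x| <= r ->
  cutoff k x = 1.
Proof.
move=> hk xr; apply: chi_eq1; rewrite dotZ -enorm_sqr -exprMn.
have k0 : (0 : R) < k.+1%:R by rewrite ltr0n.
rewrite expr_le1// ?mulr_ge0 ?invr_ge0 ?enorm_ge0// mulrC ler_pdivrMr// mul1r.
by apply: le_trans (enorm_le_norm x) _; apply: le_trans hk; rewrite ler_wpM2l.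
Qed.

Lemma Cc_cutoff k : Cc (fun x : pt => cofR (cutoff k x) : C).
Proof.
apply: (@Ccr_Cc _ _ (2 * k.+1%:R)); split.
  apply: ccont_cofR; rewrite /cutoff => x.
  apply: (@continuous_comp _ _ _ (fun x : pt => (k.+1%:R^-1 *: x)) (@chi R d)).
    by apply: continuousZr; exact: cvg_id.
  exact: chi_cont.
move=> x xk; rewrite /cutoff chi_eq0// dotZ -enorm_sqr -exprMn.
have k0 : (0 : R) < k.+1%:R by rewrite ltr0n.
have h : 2 <= k.+1%:R^-1 * enorm x.
  rewrite mulrC ler_pdivlMr//; apply: le_trans (ltW xk) _; exact: norm_le_enorm.
by rewrite (_ : 4 = 2 ^+ 2) ?lerXn2r ?nnegrE ?(le_trans _ h)//; ring.
Qed.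

Lemma eventually_cutoff (r : R) : exists K : nat, forall k, (K <= k)%N ->
  forall x : pt, `|x| <= r -> cutoff k x = 1.
Proof.
exists (Num.truncn (d%:R * r)) => k hk x; apply: cutoff_eq1.
apply: le_trans (ltW (truncnS_gt _)) _.
by rewrite ler_nat.
Qed.

Lemma ext_lim_uniq m g z w : ext_lim m g z -> ext_lim m g w -> z = w.
Proof.
move=> hz hw; apply/eqP; rewrite -subr_eq0; apply/eqP/cmod_eq0/eqP.
rewrite eq_le cmod_ge0 andbT leNgt; apply/negP => e0.
have [K hK] := hz _ (divr_gt0 e0 (ltr0n _ 2)).
have [L hL] := hw _ (divr_gt0 e0 (ltr0n _ 2)).
have := hK _ (leq_maxl K L); have := hL _ (leq_maxr K L).
set a := m _ => h1 h2; have := cmod_tri a z w; rewrite (cmodC z a); lra.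
Qed.

Lemma ext_eq m g z : ext_lim m g z -> ext m g = z.
Proof.
move=> h; rewrite /ext; apply: (ext_lim_uniq (m := m) (g := g)) => //.
exact: (@xgetPex _ 0 [set z | ext_lim m g z]) (ex_intro _ z h).
Qed.

(** The truncations by cutoffs are eventually equal to [g]; hence on smooth functions of compact
    support hypothesis (i) speaks of plain values. *)
Lemma ext_Cc m g : Cc g -> ext m g = m g.
Proof.
move=> /Cc_Ccr[r r0 [_ hg]]; apply: ext_eq => e e0.
have [K hK] := eventually_cutoff r; exists K => k /hK hk.
rewrite (_ : (fun x => _) = g) ?subrr ?cmod0//.
apply/funext => x; have [xr|xr] := leP `|x| r; last by rewrite hg// mul0r.
by rewrite hk// -[cofR 1]/(1 : C) mulr1.
Qed.

End MeasureFunctional.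

(** * Equicontinuity on a fixed ball, and passage from Schwartz functions to C_c *)

Section UniformBoundedness.
Variables (R : realType) (d : nat).
Local Notation C := (R[i]).
Local Notation pt := ('rV[R]_d).
Implicit Types (f g : pt -> C).

(** The half-width [7^-1 ^+ k / 6] is the sum of all later steps, so the intervals around the [a k]
    are nested; the limit is the supremum of their left ends. *)
Lemma geometric_limit (a : nat -> R) :
  (forall k, `|a k.+1 - a k| <= 7^-1 ^+ k.+1) ->
  exists x, forall k, `|x - a k| <= 7^-1 ^+ k / 6.
Proof.
move=> ha; pose b k := 7^-1 ^+ k / 6 : R.
have step k : a k - b k <= a k.+1 - b k.+1 /\ a k.+1 + b k.+1 <= a k + b k.
  by have := ha k; rewrite ler_norml /b exprS => /andP[]; set q := _ ^+ k; lra.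
have b0 k : 0 <= b k by rewrite /b divr_ge0// exprn_ge0// invr_ge0.
have lo k n : a k - b k <= a (k + n)%N - b (k + n)%N.
  by elim: n => [|n ih]; rewrite ?addn0// addnS (le_trans ih)//; case: (step (k + n)%N).
have hi k n : a (k + n)%N + b (k + n)%N <= a k + b k.
  by elim: n => [|n ih]; rewrite ?addn0// addnS (le_trans _ ih)//; case: (step (k + n)%N).
have ub j k : a j - b j <= a k + b k.
  apply: le_trans (lo j k) _; apply: le_trans (hi k j); rewrite addnC.
  by have := b0 (k + j)%N; lra.
pose A := range (fun j => a j - b j).
have supA : has_sup A.
  split; first by exists (a 0%N - b 0%N), 0%N.
  by exists (a 0%N + b 0%N) => _ [j _ <-].
exists (sup A) => k; have h1 : a k - b k <= sup A by apply: sup_upper_bound => //; exists k.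
have h2 : sup A <= a k + b k by apply: ge_sup; [exact: supA.1|move=> _ [j _ <-]].
by rewrite ler_norml -/(b k); lra.
Qed.

Lemma geometric_small (e : R) : 0 < e -> exists k : nat, 7^-1 ^+ k < e.
Proof.
move=> e0; exists (Num.truncn e^-1).+1; rewrite exprVn invf_plt ?posrE ?exprn_gt0//.
apply: lt_trans (truncnS_gt _) _.
rewrite -natrX ltr_nat; exact: ltn_expl.
Qed.

Lemma unif_lim_Ccr (r : R) (X : nat -> pt -> C) f :
  (forall k, Ccr r (X k)) -> (forall k t, cmod (f t - X k t) <= 7^-1 ^+ k) -> Ccr r f.
Proof.
move=> hX hf; split.
  move=> x e e0; have [k hk] := geometric_small (divr_gt0 e0 (ltr0n _ 3)).
  have [del [del0 hd]] := (hX k).1 x (e / 3) (divr_gt0 e0 (ltr0n _ 3)).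
  exists del; split => // y xy; have h1 := hd y xy.
  have := hf k x; have := hf k y.
  have := cmod_tri (X k y) (f y) (f x); have := cmod_tri (X k x) (X k y) (f x).
  rewrite (cmodC (X k x)); lra.
move=> t tr; apply: cmod_eq0; apply/eqP; rewrite eq_le cmod_ge0 andbT leNgt.
apply/negP => e0; have [k hk] := geometric_small e0.
by have := hf k t; rewrite (hX k).2// subr0; lra.
Qed.

(* Banach-Steinhaus for functionals on the functions supported in a fixed
   ball, by the gliding hump: with [cmod (T_k f_k)] nearly the norm of [T_k],
   the signs in [sum_k +- 7^-k f_k] are chosen so that no later term can undo
   the size of [T_k] at the partial sum. *)
Lemma uniform_boundedness (mus : nat -> measure_on R d) (r : R) :
  (forall n, is_measure (mus n)) -> vaguely_bounded mus ->
  exists2 K, 0 <= K & forall n f M, Ccr r f -> (forall x, cmod (f x) <= M) ->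
    cmod (mus n f) <= K * M.
Proof.
move=> hm vb.
pose A n := [set cmod (mus n f) | f in [set f | Ccr r f /\ forall x, cmod (f x) <= 1]].
have c0 : Ccr r (fun _ : pt => 0 : C) by split; [exact: ccont_cst|].
have m0 n : mus n (fun=> 0) = 0.
  rewrite -[RHS](mul0r (mus n (fun=> 0))) -(measZ 0 (hm n) (@Cc_0 R d)).
  by congr (mus n); apply/funext => x; rewrite mul0r.
have supA n : has_sup (A n).
  split; first by exists (cmod (mus n (fun=> 0))), (fun=> 0) => //; split => // x; rewrite cmod0.
  have [K K0 hK] := meas_bound r (hm n); exists K => _ [f [cf f1] <-].
  by rewrite -[K]mulr1; exact: hK.
pose S n := sup (A n).
have S0 n : 0 <= S n.
  apply: sup_upper_bound => //; exists (fun=> 0); last by rewrite m0 cmod0.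
  by split => // x; rewrite cmod0.
have Sb n f M : Ccr r f -> (forall x, cmod (f x) <= M) -> cmod (mus n f) <= S n * M.
  move=> cf fM; have M0 : 0 <= M by apply: le_trans (fM 0); exact: cmod_ge0.
  have [M00|Mn0] := eqVneq M 0.
    rewrite M00 mulr0 (_ : f = fun=> 0) ?m0 ?cmod0//.
    apply/funext => x; apply: cmod_eq0; apply/eqP; rewrite eq_le cmod_ge0 andbT.
    by rewrite -M00.
  have Mp : 0 < M by rewrite lt_def Mn0.
  rewrite -ler_pdivrMr//.
  have -> : cmod (mus n f) / M = cmod (mus n (fun x => cofR M^-1 * f x)).
    rewrite measZ//; last exact: Ccr_Cc cf.
    by rewrite cmodM cmod_cofR ger0_norm ?invr_ge0// mulrC.
  apply: sup_upper_bound => //; exists (fun x => cofR M^-1 * f x) => //; split.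
    exact: Ccr_scale.
  move=> x; rewrite cmodM cmod_cofR ger0_norm ?invr_ge0// mulrC ler_pdivrMr// mul1r.
  exact: fM.
have [[K hK]|nK] := pselect (exists K, forall n, S n <= K).
  exists `|K| => // n f M cf fM; apply: le_trans (Sb n f M cf fM) _.
  rewrite ler_wpM2r//; last by apply: le_trans (hK n) _; exact: ler_norm.
  by apply: le_trans (fM 0); exact: cmod_ge0.
exfalso.
have big K : exists n, K < S n.
  apply: contrapT => h; apply: nK; exists K => n; rewrite leNgt; apply/negP => hn.
  by apply: h; exists n.
(* The constants fit as follows. At the [k]-th partial sum the functional is at least 2/3 S 7^-k;
   the remaining tail has sup norm at most 7^-k / 3 (1/6 each for real and imaginary part), so it
   removes at most S 7^-k / 3. What is left is at least S 7^-k / 3, hence at least k / 3 since S >=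
   k 7^k. *)
have hump k : exists nf : nat * (pt -> C), [/\ Ccr r nf.2, forall x, cmod (nf.2 x) <= 1,
    k%:R * 7 ^+ k <= S nf.1 & 2 / 3 * S nf.1 <= cmod (mus nf.1 nf.2)].
  have [n hn] := big (k%:R * 7 ^+ k).
  have Sn : 0 < S n by apply: le_lt_trans hn; rewrite mulr_ge0// exprn_ge0.
  have : 2 / 3 * S n < S n by lra.
  move=> /(sup_gt (supA n).1)[_ [f [cf f1] <-]] h.
  by exists (n, f); split => //; exact: ltW.
have [nf hnf] := choice hump.
pose T k := mus (nf k).1; pose F k x := cofR (7^-1 ^+ k) * (nf k).2 x.
have q0 k : (0 : R) <= 7^-1 ^+ k by rewrite exprn_ge0// invr_ge0.
have cF k : Ccr r (F k) by apply: Ccr_scale; case: (hnf k).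
have Fb k x : cmod (F k x) <= 7^-1 ^+ k.
  rewrite cmodM cmod_cofR ger0_norm// ler_piMr//; by case: (hnf k).
have TF k : 2 / 3 * S (nf k).1 * 7^-1 ^+ k <= cmod (T k (F k)).
  case: (hnf k) => cf _ _ h; rewrite /T measZ; [|exact: hm|exact: Ccr_Cc cf].
  by rewrite cmodM cmod_cofR ger0_norm// mulrC ler_wpM2l.
(* The values at [X + F] and [X - F] differ by twice the value at [F], so one of the two signs
   yields a modulus at least that of the value at [F]. *)
pose sg (X : pt -> C) k : C :=
  if cmod (T k (F k)) <= cmod (T k (fun x => X x + F k x)) then 1 else -1.
have sg1 X k : cmod (sg X k) = 1.
  rewrite /sg; case: ifP => _; rewrite ?cmodN; by rewrite -(expi0 R) cmod_expi.
pose X := fix X k := if k is k'.+1 then fun x => X k' x + sg (X k') k * F k x else fun=> 0.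
have cX k : Ccr r (X k).
  by elim: k => [|k ih] //=; apply: Ccr_add => //; exact: Ccr_scale.
have XS k x : cmod (X k.+1 x - X k x) <= 7^-1 ^+ k.+1.
  by rewrite /= addrC addKr cmodM sg1 mul1r; exact: Fb.
have TX k : cmod (T k.+1 (F k.+1)) <= cmod (T k.+1 (X k.+1)).
  have cXk := Ccr_Cc (cX k); have cFk := Ccr_Cc (cF k.+1).
  rewrite /= {1}/sg; case: ifPn => [h|].
    rewrite (_ : (fun x => _) = fun x => X k x + F k.+1 x)//.
    by apply/funext => x; rewrite mul1r.
  rewrite -ltNge => h; rewrite (_ : (fun x => _) = fun x => X k x - F k.+1 x); last first.
    by apply/funext => x; rewrite mulN1r.
  rewrite /T measB//; move: h; rewrite /T measD// -/(T _) => h.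
  set u := T k.+1 (X k) in h *; set v := T k.+1 (F k.+1) in h *.
  have := cmodB (u + v) (u - v); rewrite (_ : u + v - (u - v) = v + v); last by ring.
  rewrite (_ : v + v = cofR 2 * v) ?cmodM ?cmod_cofR ?normr_nat; last first.
    by rewrite (cofRD 1 1) -[cofR 1]/(1 : C); ring.
  by move: h; lra.
have lim x : exists z : C, forall k, cmod (z - X k x) <= 7^-1 ^+ k / 3.
  have [a ha] : exists a, forall k, `|a - cre (X k x)| <= 7^-1 ^+ k / 6.
    apply: geometric_limit => k; apply: le_trans (XS k x).
    by rewrite -creN -creD; exact: cre_le_cmod.
  have [b hb] : exists b, forall k, `|b - cim (X k x)| <= 7^-1 ^+ k / 6.
    apply: geometric_limit => k; apply: le_trans (XS k x).
    by rewrite -cimN -cimD; exact: cim_le_cmod.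
  exists (Complex a b) => k; apply: le_trans (cmod_le_sum _) _.
  rewrite creD cimD creN cimN /=; have := ha k; have := hb k; lra.
have [f hf] := choice lim.
have cf : Ccr r f.
  apply: (unif_lim_Ccr cX) => k t; apply: le_trans (hf t k) _.
  by have := q0 k; lra.
have [B hB] := vb f (Ccr_Cc cf).
(* At index [k.+1] the lower bound [k.+1%:R / 3] exceeds [B]. *)
pose k := Num.truncn (3 * B); have hk : 3 * B < k.+1%:R by exact: truncnS_gt.
have := hB (nf k.+1).1; rewrite -/(T k.+1).
have [_ _ h1 _] := hnf k.+1; have h2 := TF k.+1; have h3 := TX k.
have h4 : cmod (T k.+1 (fun x => f x - X k.+1 x)) <= S (nf k.+1).1 * (7^-1 ^+ k.+1 / 3).
  apply: Sb; last by move=> x; exact: hf.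
  apply: Ccr_add => //; have := Ccr_scale (-1) (cX k.+1).
  by under [Y in Ccr _ Y -> _]eq_fun do rewrite mulN1r.
move: h4; rewrite /T measB//; [|exact: Ccr_Cc cf|exact: Ccr_Cc (cX k.+1)].
rewrite -/(T _) => h4.
have h5 := cmodB (T k.+1 (X k.+1) - T k.+1 f) (- T k.+1 f).
move: h5; rewrite opprK subrK cmodN (cmodC (T k.+1 (X k.+1))) => h5.
have h6 : k.+1%:R <= S (nf k.+1).1 * 7^-1 ^+ k.+1.
  by rewrite exprVn ler_pdivlMr// exprn_gt0.
move: h2 h3 h4 h5 h6 hk; lra.
Qed.

(** Modulation changes neither supports nor absolute values, so replacing [f] by a smooth [phi]
    costs the same for every [t]; the equicontinuity constant [K] makes this cost independent of [n]
    as well. *)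
Lemma unif_cvg_Cc (mus : nat -> measure_on R d) (mu : measure_on R d) :
  (forall n, is_measure (mus n)) -> is_measure mu ->
  (forall f, schwartz f -> forall e : R, 0 < e -> exists N : nat,
     forall n, (N <= n)%N -> forall t : pt,
       cmod (ext (mus n) (modul t f) - ext mu (modul t f)) < e) ->
  vaguely_bounded mus ->
  forall f, Cc f -> forall e : R, 0 < e -> exists N : nat,
     forall n, (N <= n)%N -> forall t : pt,
       cmod (mus n (modul t f) - mu (modul t f)) < e.
Proof.
move=> hms hm hyp vb f /Cc_Ccr[r r0 cf] e e0.
have [K K0 hK] := uniform_boundedness (r + 1) hms vb.
have [L L0 hL] := meas_bound (r + 1) hm.
pose eta := e / 3 / (K + L + 1).
have KL : 0 < K + L + 1 by lra.
have eta0 : 0 < eta by rewrite !divr_gt0.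
have etaE : eta * (K + L + 1) = e / 3 by rewrite divfK// lt0r_neq0.
have [phi [sphi cphi hphi]] := smooth_dense r0 cf eta0.
have [N hN] := hyp phi sphi (e / 3) (divr_gt0 e0 (ltr0n _ 3)).
exists N => n /hN h t; have {h} := h t.
have cfr : Ccr (r + 1) f by apply: Ccr_le cf; lra.
have Cphi := Ccr_Cc cphi; have Cf := Ccr_Cc cf.
rewrite !ext_Cc; try exact: Cc_modul.
have D (m : measure_on R d) B : is_measure m -> 0 <= B ->
    (forall g M, Ccr (r + 1) g -> (forall x, cmod (g x) <= M) -> cmod (m g) <= B * M) ->
    cmod (m (modul t f) - m (modul t phi)) <= B * eta.
  move=> mm B0 hB; rewrite -measB//; try exact: Cc_modul.
  apply: hB => [|x]; last by rewrite /modul -mulrBr cmodM cmod_expi mul1r.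
  split; first exact: (Cc_sub (Cc_modul t Cf) (Cc_modul t Cphi)).1.
  by move=> x xr; rewrite /modul cfr.2// cphi.2// mulr0 subrr.
have D1 := D _ K (hms n) K0 (hK n); have D2 := D _ L hm L0 hL.
have := cmod_tri (mus n (modul t phi)) (mus n (modul t f)) (mu (modul t f)).
have := cmod_tri (mu (modul t phi)) (mus n (modul t phi)) (mu (modul t f)).
rewrite (cmodC (mu (modul t phi)) (mu (modul t f))).
have : (K + L) * eta < e / 3 + eta by rewrite -etaE; lra.
have : eta <= e / 3 by rewrite -etaE ler_pMr//; lra.
move: D1 D2; lra.
Qed.

End UniformBoundedness.

(** * Density of Fourier transforms *)

Section Poisson.
Variable R : realType.
Local Notation C := (R[i]).
Local Notation mu := (@lebesgue_measure R).
Implicit Types (f g a : R -> C).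

Lemma segment_integrable (u : R -> R) (p q : R) : continuous u ->
  mu.-integrable `[p, q]%classic (EFin \o u).
Proof.
move=> cu; apply: continuous_compact_integrable; first exact: segment_compact.
exact: continuous_subspaceT.
Qed.

Lemma Rintegral_FTC (F u : R -> R) (p q : R) : p < q ->
  (forall x, is_derive x (1 : R) F (u x)) -> continuous u ->
  Rintegral mu `[p, q]%classic u = F q - F p.
Proof.
move=> pq dF cu; have cF : continuous F.
  move=> x; apply: differentiable_continuous; apply/derivable1_diffP.
  by have [] := dF x.
rewrite /Rintegral (@continuous_FTC2 _ u F)//.
- exact: continuous_subspaceT.
- split.
  + by move=> x _; have [] := dF x.
  + by apply: cvg_at_right_filter; exact: cF.
  + by apply: cvg_at_left_filter; exact: cF.
- by move=> x _; rewrite derive1E; have [] := dF x.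
Qed.

Lemma Rintegral_fold (A : R) (u : R -> R) : 0 < A -> continuous u -> Rsupp_in A u ->
  Rintegral mu setT u =
  Rintegral mu `[0, A]%classic u + Rintegral mu `[0, A]%classic (fun x => u (- x)).
Proof.
move=> A0 cu hu; rewrite (Rintegral_supp hu).
have iu : mu.-integrable [set` Interval (BLeft (- A)) (BRight A)] (EFin \o u).
  exact: segment_integrable.
have a1 : (BLeft (- A) <= BRight (0 : R))%O by rewrite bnd_simp; lra.
have a2 : (BRight (0 : R) <= BRight A)%O by rewrite bnd_simp ltW.
have h := Rintegral_itvB iu a1 a2.
have e1 : Rintegral mu [set` Interval (BLeft (- A)) (BRight (0 : R))] u =
    Rintegral mu `[0, A]%classic (fun x => u (- x)).
  have := @integration_by_substitution_oppr R u 0 A (ltW A0).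
  rewrite oppr0 => k; rewrite /Rintegral k//.
  exact: continuous_subspaceT.
have e2 : Rintegral mu [set` Interval (BRight (0 : R)) (BRight A)] u =
    Rintegral mu `[0, A]%classic u.
  rewrite Rintegral_itv_obnd_cbnd//.
  apply: integrableS (segment_integrable 0 A cu) => //.
  by apply: subset_itvr; rewrite bnd_simp.
by rewrite -e2 -h -e1 subrK.
Qed.

Definition check1 f (y : R) : C := cint1 (fun x => f x * expi (2 * pi * (x * y))).

Lemma cc_char1 (y : R) : cc (fun x : R => expi (2 * pi * (x * y))).
Proof.
apply: cc_expi; apply: rcontM; first exact: rcont_cst.
by apply: rcontM; [move=> x; exact: cvg_id|exact: rcont_cst].
Qed.

Lemma Cc1_char r f y : Cc1 r f -> Cc1 r (fun x => f x * expi (2 * pi * (x * y))).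
Proof. by move=> cf; apply: Cc1_mulr => //; exact: cc_char1. Qed.

(** Membership in the sup-norm closure of the transforms of C_c(R). *)
Definition check_limit a := forall e : R, 0 < e -> exists r f,
  [/\ 0 < r, Cc1 r f & forall y, cmod (a y - check1 f y) <= e].

Lemma check_limitD a b : check_limit a -> check_limit b ->
  check_limit (fun y => a y + b y).
Proof.
move=> ha hb e e0.
have [r [f [r0 cf hf]]] := ha _ (divr_gt0 e0 (ltr0n _ 2)).
have [s [g [s0 cg hg]]] := hb _ (divr_gt0 e0 (ltr0n _ 2)).
have cf' : Cc1 (r + s) f by apply: Cc1_le cf; lra.
have cg' : Cc1 (r + s) g by apply: Cc1_le cg; lra.
exists (r + s), (fun x => f x + g x); split; [lra|exact: Cc1_add|move=> y].
have -> : check1 (fun x => f x + g x) y = check1 f y + check1 g y.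
  rewrite /check1 -(cint1D (Cc1_char y cf') (Cc1_char y cg')); congr cint1.
  by apply/funext => x; rewrite mulrDl.
rewrite (_ : _ - _ = (a y - check1 f y) + (b y - check1 g y)); last by ring.
by apply: le_trans (cmodD _ _) _; have := hf y; have := hg y; lra.
Qed.

Lemma check_limitZ (c : C) a : check_limit a -> check_limit (fun y => c * a y).
Proof.
move=> ha e e0; have c1 : 0 < cmod c + 1 by rewrite ltr_wpDl ?cmod_ge0.
have [r [f [r0 cf hf]]] := ha _ (divr_gt0 e0 c1).
exists r, (fun x => c * f x); split => //; first exact: Cc1_scale.
move=> y; have -> : check1 (fun x => c * f x) y = c * check1 f y.
  rewrite /check1 -(cint1Z c (Cc1_char y cf)); congr cint1.
  by apply/funext => x; exact/esym/mulrA.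
rewrite -mulrBr cmodM; have := hf y; rewrite ler_pdivlMr// => h.
apply: le_trans h; rewrite mulrC; apply: ler_wpM2l; first exact: cmod_ge0.
by rewrite lerDl.
Qed.

Lemma check_limit_sum n (a : nat -> R -> C) : (forall i, check_limit (a i)) ->
  check_limit (fun y => \sum_(i < n) a i y).
Proof.
move=> ha; elim: n => [|n ih].
  have h0 : check_limit (fun=> 0) by have := check_limitZ 0 (ha 0%N); under [Y in check_limit Y -> _]eq_fun do rewrite mul0r.
  by under [Y in check_limit Y]eq_fun do rewrite big_ord0.
by under [Y in check_limit Y]eq_fun do rewrite big_ord_recr /=; exact: check_limitD.
Qed.

Lemma check_limit_shift (s : R) a : check_limit a -> check_limit (fun y => a (y - s)).
Proof.
move=> ha e e0; have [r [f [r0 cf hf]]] := ha e e0.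
exists r, (fun x => f x * expi (2 * pi * (x * - s))); split => //; first exact: Cc1_char.
move=> y; rewrite (_ : check1 _ y = check1 f (y - s)); first exact: hf.
rewrite /check1; congr cint1; apply/funext => x; rewrite -mulrA -expiD.
by congr (_ * expi _); ring.
Qed.

Lemma check_limit_closed a :
  (forall e : R, 0 < e -> exists b, check_limit b /\ forall y, cmod (a y - b y) <= e) ->
  check_limit a.
Proof.
move=> h e e0; have [b [hb hab]] := h _ (divr_gt0 e0 (ltr0n _ 2)).
have [r [f [r0 cf hf]]] := hb _ (divr_gt0 e0 (ltr0n _ 2)).
exists r, f; split => // y; apply: le_trans (cmod_tri (b y) _ _) _.
by have := hf y; have := hab y; lra.
Qed.

(** The transform of exp(-c|x|) in the normalization with 2 pi in the exponent. *)
Definition poisson (c y : R) : R := 2 * c / (c ^+ 2 + (2 * pi * y) ^+ 2).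

Lemma poisson_den (c b : R) : 0 < c -> 0 < c ^+ 2 + b ^+ 2.
Proof. by move=> c0; rewrite ltr_wpDr ?sqr_ge0// exprn_gt0. Qed.

(** The explicit antiderivative [F] takes the value -c/D at 0, so the difference on the left is
    exactly [F A]; the constant comes from c (|b| + c) <= 2 D. *)
Lemma int_expcos (c b A : R) : 0 < c -> 0 < A ->
  `|Rintegral mu `[0, A]%classic (fun x => expR (- (c * x)) * cos (b * x))
     - c / (c ^+ 2 + b ^+ 2)| <= 2 / c * expR (- (c * A)).
Proof.
move=> c0 A0; have D0 := poisson_den b c0; set D := c ^+ 2 + b ^+ 2 in D0 *.
pose F (x : R) := expR (- (c * x)) * (b * sin (b * x) - c * cos (b * x)) / D.
have dF x : is_derive x (1 : R) F (expR (- (c * x)) * cos (b * x)).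
  have d1 : is_derive x (1 : R) (fun x => expR (- (c * x))) (expR (- (c * x)) * (- c)).
    apply: (@is_derive1_comp R expR (fun x => - (c * x))).
    apply: is_deriveN; have := @is_deriveZ R _ _ id c x 1 1 (is_derive_id x 1).
    by rewrite [c *: 1]mulr1.
  have dl : is_derive x (1 : R) (fun x => b * x) b.
    have := @is_deriveZ R _ _ id b x 1 1 (is_derive_id x 1).
    by rewrite [b *: 1]mulr1.
  have d2 : is_derive x (1 : R) (fun x => sin (b * x)) (cos (b * x) * b).
    exact: (@is_derive1_comp R sin (fun x => b * x)).
  have d3 : is_derive x (1 : R) (fun x => cos (b * x)) (- sin (b * x) * b).
    exact: (@is_derive1_comp R cos (fun x => b * x)).
  have d4 := is_deriveB (is_deriveZ b d2) (is_deriveZ c d3).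
  have d5 := is_deriveZ D^-1 (is_deriveM d1 d4).
  rewrite (_ : F = D^-1 \*: ((fun x => expR (- (c * x))) * (b \*: (fun x => sin (b * x)) - c \*: (fun x => cos (b * x))))); last first.
    by apply/funext => z; rewrite /F mulrC.
  apply: is_derive_eq; rewrite /GRing.scale /= !fctE /= /GRing.scale /=.
  rewrite (_ : D^-1 * _ = D^-1 * (D * (expR (- (c * x)) * cos (b * x)))); last first.
    by rewrite /D; ring.
  by rewrite mulKf// lt0r_neq0.
have cu : continuous (fun x => expR (- (c * x)) * cos (b * x)).
  have cl (t : R) : continuous (fun x : R => t * x).
    by apply: rcontM; [exact: rcont_cst|move=> x; exact: cvg_id].
  apply: rcontM; last by apply: rcont_comp; [exact: cl|exact: continuous_cos].
  by apply: rcont_comp; [apply: rcontN; exact: cl|exact: continuous_expR].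
rewrite (Rintegral_FTC A0 dF cu) /F !mulr0 oppr0 expR0 sin0 cos0 mul1r mulr0 sub0r mulr1.
rewrite mulNr opprK addrK !normrM (ger0_norm (expR_ge0 _)) mulrC mulrA.
rewrite [leLHS]mulrAC ler_wpM2r ?expR_ge0// normfV (gtr0_norm D0) mulrC.
rewrite ler_pdivrMr// mulrAC ler_pdivlMr//.
have h1 : `|b * sin (b * A) - c * cos (b * A)| <= `|b| + c.
  apply: le_trans (ler_normB _ _) _; rewrite !normrM (gtr0_norm c0).
  have : `|sin (b * A)| <= 1 by rewrite ler_norml sin_geN1 sin_le1.
  have : `|cos (b * A)| <= 1 by rewrite ler_norml cos_geN1 cos_le1.
  have := normr_ge0 b; nra.
apply: (@le_trans _ _ ((`|b| + c) * c)); first by rewrite ler_wpM2r// ltW.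
rewrite /D -[b ^+ 2]real_normK ?num_real//; nra.
Qed.

Lemma norm_int_cos (b A : R) : 0 < A ->
  `|Rintegral mu `[0, A]%classic (fun x => cos (b * x))| <= A.
Proof.
move=> A0; have cu : continuous (fun x : R => cos (b * x)).
  apply: rcont_comp; last exact: continuous_cos.
  by apply: rcontM; [exact: rcont_cst|move=> x; exact: cvg_id].
apply: le_trans (le_normr_Rintegral _ (segment_integrable 0 A cu)) _ => //.
apply: (@le_trans _ _ (Rintegral mu `[0, A]%classic (cst 1))).
  apply: le_Rintegral => // [| |x _].
  - by apply: (segment_integrable (u := fun x => `|cos (b * x)|)); apply: rcont_comp => //; exact: norm_continuous.
  - by apply: (segment_integrable (u := cst 1)); exact: rcont_cst.
  - by rewrite ler_norml cos_geN1 cos_le1.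
rewrite Rintegral_cst//.
have h : lebesgue_measure (`[0, A]%classic : set R) = A%:E.
  by rewrite lebesgue_measure_itv /= lte_fin A0 sube0.
by rewrite [X in fine X]h /= mul1r.
Qed.

(** The function exp(-c|x|) must be cut off without losing continuity: it is lowered by its value at
    [A], and the positive part [u] is kept. Lowering costs exp(-cA) times an integral of a cosine
    over [0, A], at most A exp(-cA), uniformly in [y]. *)
Lemma poisson_check_limit (c : R) : 0 < c -> check_limit (fun y => cofR (poisson c y)).
Proof.
move=> c0 e e0.
(* After multiplication by c^2 A, the tolerance [e] becomes 12, while the error is at most 4 + 2 * 2
   = 8, since E (cA) <= 1 and E (cA)^2 <= 2 for E = exp(-cA). *)
pose A := 12 / (c ^+ 2 * e).
have ce : 0 < c ^+ 2 * e by rewrite mulr_gt0// exprn_gt0.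
have A0 : 0 < A by rewrite divr_gt0.
pose w (x : R) : R := expR (- (c * `|x|)) - expR (- (c * A)).
pose u (x : R) : R := (w x + `|w x|) / 2.
have cw : continuous w.
  apply: rcontD; last exact: rcont_cst.
  apply: (rcont_comp (v := expR)); last exact: continuous_expR.
  apply: rcontN; apply: rcontM; first exact: rcont_cst.
  exact: norm_continuous.
have cu : continuous u.
  apply: rcontM; last exact: rcont_cst.
  by apply: rcontD => //; apply: rcont_comp => //; exact: norm_continuous.
have hu : Rsupp_in A u.
  move=> x xA; rewrite /u ler0_norm ?subrr ?mul0r// subr_le0 ler_expR lerN2 ler_pM2l//.
  exact: ltW.
have uE x : 0 <= x <= A -> u x = expR (- (c * x)) - expR (- (c * A)).
  move=> /andP[x0 xA]; rewrite /u ger0_norm; last first.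
    by rewrite subr_ge0 ler_expR lerN2 ler_pM2l// ger0_norm.
  by rewrite /w (ger0_norm x0); lra.
have uN x : u (- x) = u x by rewrite /u /w normrN.
exists A, (fun x => cofR (u x)); split => //.
  by split; [exact: cofR_cont|move=> x /hu ->].
move=> y; pose b := 2 * pi * y.
have bE x : 2 * pi * (x * y) = b * x by rewrite /b; ring.
have cl : continuous (fun x : R => b * x).
  by apply: rcontM; [exact: rcont_cst|move=> x; exact: cvg_id].
have ccos : continuous (fun x : R => u x * cos (b * x)).
  by apply: rcontM => //; apply: rcont_comp => //; exact: continuous_cos.
have csin : continuous (fun x : R => u x * sin (b * x)).
  by apply: rcontM => //; apply: rcont_comp => //; exact: continuous_sin.
have hre : cre (check1 (fun x => cofR (u x)) y) =
    2 * Rintegral mu `[0, A]%classic (fun x => u x * cos (b * x)).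
  transitivity (Rintegral mu setT (fun x => u x * cos (b * x))).
    rewrite -[LHS]/(Rintegral mu setT (fun x => cre (cofR (u x) * expi (2 * pi * (x * y))))).
    by apply: eq_Rintegral => x _; rewrite creM /= mul0r subr0 bE.
  rewrite (Rintegral_fold A0 ccos); last by move=> x /hu ->; rewrite mul0r.
  under [X in _ + X]eq_Rintegral do rewrite uN mulrN cosN.
  by rewrite mulr_natl mulr2n.
(* The sine part cancels because [u] is even. *)
have him : cim (check1 (fun x => cofR (u x)) y) = 0.
  transitivity (Rintegral mu setT (fun x => u x * sin (b * x))).
    rewrite -[LHS]/(Rintegral mu setT (fun x => cim (cofR (u x) * expi (2 * pi * (x * y))))).
    by apply: eq_Rintegral => x _; rewrite cimM /= mul0r addr0 bE.
  rewrite (Rintegral_fold A0 csin); last by move=> x /hu ->; rewrite mul0r.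
  under [X in _ + X]eq_Rintegral do rewrite uN mulrN sinN mulrN -mulN1r.
  by rewrite RintegralZl// ?mulN1r ?subrr//; exact: segment_integrable.
have hI : Rintegral mu `[0, A]%classic (fun x => u x * cos (b * x)) =
   Rintegral mu `[0, A]%classic (fun x => expR (- (c * x)) * cos (b * x)) -
   expR (- (c * A)) * Rintegral mu `[0, A]%classic (fun x => cos (b * x)).
  have c1 : continuous (fun x : R => cos (b * x)) by apply: rcont_comp => //; exact: continuous_cos.
  have c2 : continuous (fun x : R => expR (- (c * x)) * cos (b * x)).
    apply: rcontM => //; apply: (rcont_comp (v := expR)); last exact: continuous_expR.
    by apply: rcontN; apply: rcontM; [exact: rcont_cst|move=> x; exact: cvg_id].
  have c3 : continuous (fun x : R => expR (- (c * A)) * cos (b * x)).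
    by apply: rcontM => //; exact: rcont_cst.
  rewrite -RintegralZl//; last exact: segment_integrable.
  rewrite -RintegralB//; [|exact: segment_integrable|exact: segment_integrable].
  apply: eq_Rintegral => x; rewrite inE /= in_itv /= => xA.
  by rewrite uE// mulrBl.
apply: le_trans (cmod_le_sum _) _.
rewrite creD cimD creN cimN him hre hI oppr0 addr0 [cim (cofR _)]/= normr0 addr0 [cre (cofR _)]/=.
have h1 := int_expcos b c0 A0; have h2 := norm_int_cos b A0.
set I1 := Rintegral _ _ _ in h1 *; set I2 := Rintegral _ _ _ in h2 *.
set E := expR (- (c * A)) in h1 *; have E0 : 0 <= E by exact: expR_ge0.
have cA0 : 0 < c * A by rewrite mulr_gt0.
have E1 : E * (c * A) <= 1.
  rewrite /E expRN mulrC ler_pdivrMr ?expR_gt0// mul1r.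
  by apply: le_trans (expR_ge1Dx _); rewrite lerDr.
have E2 : E * (c * A) ^+ 2 <= 2.
  rewrite /E expRN mulrC ler_pdivrMr ?expR_gt0//.
  have := @expR_ge1Dxn R (c * A) 1 (ltW cA0); rewrite (_ : 2`! = 2)//.
  by set s := _ ^+ 2; lra.
have -> : poisson c y = 2 * (c / (c ^+ 2 + b ^+ 2)) by rewrite /poisson -/b mulrA.
rewrite (_ : _ - _ = 2 * (- (I1 - c / (c ^+ 2 + b ^+ 2)) + E * I2)); last by ring.
rewrite normrM normr_nat.
have h3 : `|- (I1 - c / (c ^+ 2 + b ^+ 2)) + E * I2| <= 2 / c * E + E * A.
  apply: le_trans (ler_normD _ _) _; rewrite normrN lerD// normrM (ger0_norm E0).
  by rewrite ler_wpM2l.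
apply: (@le_trans _ _ (2 * (2 / c * E + E * A))); first by rewrite ler_pM2l.
have c2 : 0 < c ^+ 2 * A by rewrite mulr_gt0// exprn_gt0.
rewrite -(ler_pM2r c2).
have -> : e * (c ^+ 2 * A) = 12.
  rewrite [LHS](_ : _ = A * (c ^+ 2 * e)); last by ring.
  by rewrite /A divfK// lt0r_neq0.
have -> : 2 * (2 / c * E + E * A) * (c ^+ 2 * A) = 4 * (E * (c * A)) + 2 * (E * (c * A) ^+ 2).
  by field; rewrite lt0r_neq0.
lra.
Qed.

(** The difference of the fractions has the numerator (b + a)(b - a); since 2c|a| <= c^2 + a^2, and
    likewise for b, the product of the denominators absorbs c^3 |b + a|. *)
Lemma poisson_lip (c x y : R) : 0 < c ->
  `|poisson c x - poisson c y| <= 4 * pi / c ^+ 2 * `|x - y|.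
Proof.
move=> c0; pose a := 2 * pi * x; pose b := 2 * pi * y.
have Da := poisson_den a c0; have Db := poisson_den b c0.
have -> : poisson c x - poisson c y =
  2 * c * ((b + a) * (b - a)) / ((c ^+ 2 + a ^+ 2) * (c ^+ 2 + b ^+ 2)).
  rewrite /poisson -/a -/b; field; by rewrite !lt0r_neq0.
rewrite !normrM normr_nat (gtr0_norm c0) normfV normrM (gtr0_norm Da) (gtr0_norm Db).
rewrite ler_pdivrMr ?mulr_gt0//.
have -> : `|b - a| = 2 * pi * `|x - y|.
  by rewrite /a /b -mulrBr !normrM normr_nat (gtr0_norm (pi_gt0 R)) distrC.
have h : c * `|b + a| * c ^+ 2 <= (c ^+ 2 + a ^+ 2) * (c ^+ 2 + b ^+ 2).
  have [hab|hab] := leP 0 (b + a).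
    by rewrite (ger0_norm hab); have := sqr_ge0 (c - a); have := sqr_ge0 (c - b); nra.
  by rewrite (ltr0_norm hab); have := sqr_ge0 (c + a); have := sqr_ge0 (c + b); nra.
rewrite -(ler_pM2r (exprn_gt0 2 c0)).
have -> : 4 * pi / c ^+ 2 * `|x - y| * ((c ^+ 2 + a ^+ 2) * (c ^+ 2 + b ^+ 2)) * c ^+ 2 =
  4 * pi * `|x - y| * ((c ^+ 2 + a ^+ 2) * (c ^+ 2 + b ^+ 2)).
  by field; rewrite lt0r_neq0.
have -> : 2 * c * (`|b + a| * (2 * pi * `|x - y|)) * c ^+ 2 =
  4 * pi * `|x - y| * (c * `|b + a| * c ^+ 2) by ring.
by rewrite ler_wpM2l// !mulr_ge0// pi_ge0.
Qed.

(** The distribution function of the Poisson kernel with parameter [2 * pi / lam]; it steepens as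
    [lam] grows. *)
Definition atan_step (lam y : R) : R := 1 / 2 + atan (lam * y) / pi.

Lemma is_derive_atan_step (lam y : R) : 0 < lam ->
  is_derive y (1 : R) (atan_step lam) (poisson (2 * pi / lam) y).
Proof.
move=> l0; have p0 := pi_gt0 R.
have dl : is_derive y (1 : R) (fun x => lam * x) lam.
  have := @is_deriveZ R _ _ id lam y 1 1 (is_derive_id y 1).
  by rewrite [lam *: 1]mulr1.
have da : is_derive y (1 : R) (fun x => atan (lam * x)) ((1 + (lam * y) ^+ 2)^-1 * lam).
  exact: (@is_derive1_comp R atan (fun x => lam * x)).
rewrite (_ : atan_step lam = cst (1 / 2) + pi^-1 \*: (fun x => atan (lam * x))); last first.
  by apply/funext => z; rewrite /atan_step [atan _ / _]mulrC.
apply: is_derive_eq; rewrite add0r /GRing.scale /= /poisson.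
have h : 0 < 1 + (lam * y) ^+ 2 by rewrite ltr_wpDr ?sqr_ge0.
have h2 : (2 * pi / lam) ^+ 2 + (2 * pi * y) ^+ 2 = (2 * pi / lam) ^+ 2 * (1 + (lam * y) ^+ 2).
  by field; rewrite lt0r_neq0.
rewrite h2; move: h p0 l0; clear; set Q := 1 + _; move: Q (@pi R) => Q p Q0 p0 l0.
by field; rewrite !lt0r_neq0.
Qed.

Lemma atan_step_ge0le1 (lam y : R) : 0 <= atan_step lam y <= 1.
Proof.
have p0 := pi_gt0 R.
rewrite /atan_step; have := atan_gtNpi2 (lam * y); have := atan_ltpi2 (lam * y).
set a := atan _ => h1 h2.
have : a / pi <= 1 / 2 by rewrite ler_pdivrMr//; lra.
have : - (1 / 2) <= a / pi by rewrite ler_pdivlMr//; lra.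
lra.
Qed.

Lemma atan_step_is_step (del eps : R) : 0 < del -> 0 < eps ->
  exists2 lam, 0 < lam & is_step (atan_step lam) del eps.
Proof.
move=> del0 eps0; have p0 := pi_gt0 R.
(* [lam] is chosen so that the arctangent at [lam * del] is pi/2 - th; the step then misses 0 and 1
   at [- del] and [del] by th/pi, at most [eps]. The bound pi/4 makes the tangent, hence [lam],
   positive. *)
pose th := Num.min (pi * eps) (pi / 4).
have th0 : 0 < th by rewrite lt_min mulr_gt0// divr_gt0.
have th1 : th <= pi * eps by rewrite ge_min lexx.
have th2 : th <= pi / 4 by rewrite ge_min lexx orbT.
pose lam := tan (pi / 2 - th) / del.
have inpi : pi / 2 - th \in `](- (pi / 2)), (pi / 2)[ by rewrite in_itv /=; lra.
have lam0 : 0 < lam.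
  rewrite divr_gt0// -(tan0 R) ltr_tan// ?in_itv /=; first by lra.
  by apply/andP; split; lra.
have lE : lam * del = tan (pi / 2 - th) by rewrite divfK// lt0r_neq0.
have thp : th / pi <= eps by rewrite ler_pdivrMr// mulrC.
exists lam => //; split.
- move=> x y xy; rewrite lerD2l ler_pM2r ?invr_gt0// le_atan// ler_pM2l//.
- exact: atan_step_ge0le1.
- rewrite /atan_step mulrN atanN lE tanK//.
  rewrite (_ : 1 / 2 + _ = th / pi + (1 / 2) * (1 - pi / pi)); last by ring.
  by rewrite divff ?lt0r_neq0// subrr mulr0 addr0.
- rewrite /atan_step lE tanK//.
  rewrite (_ : 1 / 2 + _ = (1 / 2) * (1 + pi / pi) - th / pi); last by ring.
  by rewrite divff ?lt0r_neq0//; lra.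
Qed.

(* Riemann sums: the increment is the integral of the Poisson kernel over a
   segment of length [del] *)
Lemma incr_check_limit (lam del s : R) : 0 < lam -> 0 < del ->
  check_limit (fun y => cofR (incr (atan_step lam) del s y)).
Proof.
move=> l0 del0; have p0 := pi_gt0 R.
pose c := 2 * pi / lam; have c0 : 0 < c by rewrite divr_gt0// mulr_gt0.
pose L := 4 * pi / c ^+ 2; have L0 : 0 < L by apply: divr_gt0; [exact: mulr_gt0|exact: exprn_gt0].
have mvt (z h : R) : 0 < h ->
    `|atan_step lam z - atan_step lam (z - h) - h * poisson c z| <= L * h ^+ 2.
  move=> h0; have zh : z - h < z by rewrite gtrBl.
  have dT x : x \in `]z - h, z[ -> is_derive x (1 : R) (atan_step lam) (poisson c x).
    by move=> _; exact: is_derive_atan_step.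
  have cT : {within `[z - h, z], continuous (atan_step lam)}.
    apply: derivable_within_continuous => x _.
    by have [] := is_derive_atan_step x l0.
  have [x + ->] := MVT zh dT cT; rewrite in_itv /= => /andP[x1 x2].
  rewrite (_ : _ - _ = h * (poisson c x - poisson c z)); last by ring.
  rewrite normrM (gtr0_norm h0) expr2 mulrA mulrC ler_wpM2r ?(ltW h0)//.
  apply: le_trans (poisson_lip x z c0) _; rewrite -/L ler_pM2l//.
  by rewrite ler_norml; lra.
apply: check_limit_closed => e e0.
(* By [mvt] each of the [n] cells of length [del / n%:R] contributes an error [L * h ^+ 2]; together
   they give [L * del ^+ 2 / n%:R], at most [e]. *)
pose n := (Num.truncn (L * del ^+ 2 / e)).+1.
have n0 : (0 : R) < n%:R by rewrite ltr0n.
have hn : L * del ^+ 2 / e <= n%:R by apply: ltW; exact: truncnS_gt.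
pose h := del / n%:R; have h0 : 0 < h by rewrite divr_gt0.
exists (fun y => \sum_(i < n) cofR h * cofR (poisson c (y - (s + i%:R * h)))).
split.
  apply: (@check_limit_sum n (fun i y => cofR h * cofR (poisson c (y - (s + i%:R * h))))) => i.
  apply: check_limitZ.
  exact: (check_limit_shift (s + i%:R * h) (poisson_check_limit c0)).
move=> y.
have tel : incr (atan_step lam) del s y =
  \sum_(i < n) (atan_step lam (y - (s + i%:R * h)) - atan_step lam (y - (s + i%:R * h) - h)).
  rewrite -(big_mkord xpredT (fun i => atan_step lam (y - (s + i%:R * h)) - atan_step lam (y - (s + i%:R * h) - h))).
  rewrite (eq_big_nat _ _ (F2 := fun i => - (atan_step lam (y - (s + i.+1%:R * h)) - atan_step lam (y - (s + i%:R * h))))).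
    rewrite sumrN telescope_sumr// opprB mul0r addr0 /incr; congr (_ - atan_step lam _).
    by rewrite /h [n%:R * _]mulrC divfK ?lt0r_neq0// opprD addrA.
  move=> i _; rewrite opprB; congr (_ - atan_step lam _).
  by rewrite -natr1; ring.
rewrite tel cofR_sum -sumrB; apply: le_trans (cmod_sum _ _ _) _.
apply: (@le_trans _ _ (\sum_(i < n) L * h ^+ 2)).
  apply: ler_sum => i _; rewrite -cofRM -cofRN -cofRD cmod_cofR.
  exact: mvt.
rewrite sumr_const card_ord -[leLHS]mulr_natl.
rewrite (_ : n%:R * (L * h ^+ 2) = L * del ^+ 2 / n%:R); last first.
  by rewrite /h; field; rewrite lt0r_neq0.
by rewrite ler_pdivrMr// [e * _]mulrC -ler_pdivrMr.
Qed.

End Poisson.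

(** * The convolution theorem on the line *)

Section Convolution1.
Variable R : realType.
Local Notation C := (R[i]).
Local Notation mu := (@lebesgue_measure R).
Let mR : measurableType _ := measurableTypeR R.
Implicit Types (f g : R -> C).

Lemma Rintegral_supp_itv (p q : R) (u : R -> R) :
  (forall x, ~~ (p <= x <= q) -> u x = 0) ->
  Rintegral mu setT u = Rintegral mu `[p, q]%classic u.
Proof.
move=> hu; rewrite [RHS]Rintegral_mkcond; congr (Rintegral mu setT _).
apply/funext => x; rewrite patchE; case: ifPn => //.
by rewrite notin_setE /= in_itv /= => /negP /hu.
Qed.

Lemma Rintegral_translation (r s : R) (u : R -> R) : 0 < r -> continuous u ->
  Rsupp_in r u -> Rintegral mu setT (fun z => u (z - s)) = Rintegral mu setT u.
Proof.
move=> r0 cu hu; pose B := r + `|s|.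
have s0 := normr_ge0 s; have hs := ler_norm s; have hs' := ler_norm (- s).
rewrite normrN in hs'.
have B0 : - B <= B by rewrite /B; lra.
rewrite (@Rintegral_supp_itv (- B) B (fun z => u (z - s))); last first.
  move=> x hx; apply: hu; move: hx; rewrite -ler_norml -ltNge /B => hx.
  by have := lerB_dist x s; lra.
rewrite (@Rintegral_supp_itv (- B - s) (B - s) u); last first.
  move=> x hx; apply: hu; rewrite ltNge; apply: contra hx; rewrite ler_norml /B; lra.
have dF (x : R) : is_derive x (1 : R) (fun z : R => z - s) 1.
  exact: is_derive_shift.
have dFE : derive1 (fun z : R => z - s) = cst (1 : R).
  by apply/funext => z; rewrite derive1E; have [] := dF z.
rewrite /Rintegral (@integration_by_substitution_increasing R (fun z => z - s) u (- B) B)//.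
- congr fine; apply: eq_integral => x _ /=; congr EFin.
  by rewrite dFE /= !fctE mulr1.
- by move=> x y _ _ xy; rewrite ltrD2r.
- by rewrite dFE => x _; exact: cst_continuous.
- by rewrite dFE; exact: is_cvg_cst.
- by rewrite dFE; exact: is_cvg_cst.
- have cs : continuous (fun z : R => z - s).
    by apply: rcontD; [move=> z; exact: cvg_id|exact: rcont_cst].
  split.
  + by move=> x _; have [] := dF x.
  + by apply: cvg_at_right_filter; exact: cs.
  + by apply: cvg_at_left_filter; exact: cs.
- exact: continuous_subspaceT.
Qed.

Lemma cint1_translation (r s : R) f : 0 < r -> Cc1 r f ->
  cint1 (fun z => f (z - s)) = cint1 f.
Proof.
move=> r0 [[fr fi] hf]; rewrite /cint1; congr Complex.
  apply: (@Rintegral_translation r s (fun x => cre (f x))) => // x /hf ->; by [].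
apply: (@Rintegral_translation r s (fun x => cim (f x))) => // x /hf ->; by [].
Qed.

(** Fubini's theorem: integrability on the plane holds because [P] is bounded, measurable and
    supported in a square of finite product measure. Separate continuity makes the inner integrals
    finite, so that [fine] may be moved inside. *)
Lemma Rintegral_swap (r M : R) (P : R -> R -> R) : 0 < r ->
  measurable_fun setT (fun p : mR * mR => P p.1 p.2) ->
  (forall x z, `|P x z| <= M) ->
  (forall x z, r < `|x| \/ r < `|z| -> P x z = 0) ->
  (forall x, continuous (P x)) -> (forall z, continuous (P ^~ z)) ->
  Rintegral mu setT (fun x => Rintegral mu setT (P x)) =
  Rintegral mu setT (fun z => Rintegral mu setT (P ^~ z)).
Proof.
move=> r0 mP bP sP c1 c2.
have i1 x : mu.-integrable setT (EFin \o P x).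
  by apply: (@supp_integrable _ r) => // z zr; apply: sP; right.
have i2 z : mu.-integrable setT (EFin \o P ^~ z).
  by apply: (@supp_integrable _ r) => // x xr; apply: sP; left.
pose A := (`[- r, r]%classic `*` `[- r, r]%classic : set (mR * mR)).
have mA : measurable A by apply: measurableX; exact: measurable_itv.
have fin : ((mu \x mu) A < +oo)%E.
  rewrite product_measure1E; try exact: measurable_itv.
  have h : lebesgue_measure (`[- r, r]%classic : set R) = (r - - r)%:E.
    by rewrite lebesgue_measure_itv /= lte_fin ifT//; lra.
  by rewrite [X in (X * _)%E]h [X in (_ * X)%E]h -EFinM ltry.
have iP : ((mu \x mu)%E).-integrable setT (EFin \o (fun p : mR * mR => P p.1 p.2)).
  have -> : (EFin \o (fun p : mR * mR => P p.1 p.2)) = (EFin \o (fun p : mR * mR => P p.1 p.2)) \_ A.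
    apply/funext => -[x z]; rewrite patchE /=; case: ifPn => //.
    rewrite notin_setE /A /= !in_itv /= -!ler_norml => /not_andP h.
    rewrite sP//; case: h => /negP; rewrite -ltNge => h; by [left|right].
  apply/(integrable_mkcond _ mA); apply: measurable_bounded_integrable => //.
    exact: measurable_funS mP.
  by exists M; split; rewrite ?num_real// => N MN [x z] _ /=; apply: le_trans (bP x z) (ltW MN).
have F := Fubini iP; rewrite /Rintegral.
transitivity (fine (\int[mu]_x \int[mu]_z (P x z)%:E)%E).
  congr fine; apply: eq_integral => x _; rewrite fineK//.
  exact: (integrable_fin_num _ (i1 x)).
rewrite F; congr fine; apply: eq_integral => z _; rewrite fineK//.
exact: (integrable_fin_num _ (i2 z)).
Qed.

Lemma cint1_swap (r M : R) (P : R -> R -> C) : 0 < r ->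
  measurable_fun setT (fun p : mR * mR => cre (P p.1 p.2)) ->
  measurable_fun setT (fun p : mR * mR => cim (P p.1 p.2)) ->
  (forall x z, cmod (P x z) <= M) ->
  (forall x z, r < `|x| \/ r < `|z| -> P x z = 0) ->
  (forall x, cc (P x)) -> (forall z, cc (P ^~ z)) ->
  cint1 (fun x => cint1 (P x)) = cint1 (fun z => cint1 (P ^~ z)).
Proof.
move=> r0 mr mi bP sP c1 c2.
have re := @Rintegral_swap r M (fun x z => cre (P x z)) r0 mr
  (fun x z => le_trans (cre_le_cmod _) (bP x z))
  (fun x z h => congr1 (@cre R) (sP x z h)) (fun x => (c1 x).1) (fun z => (c2 z).1).
have im := @Rintegral_swap r M (fun x z => cim (P x z)) r0 mi
  (fun x z => le_trans (cim_le_cmod _) (bP x z))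
  (fun x z h => congr1 (@cim R) (sP x z h)) (fun x => (c1 x).2) (fun z => (c2 z).2).
rewrite -[LHS]/(Complex (Rintegral mu setT (fun x => Rintegral mu setT (fun z => cre (P x z))))
  (Rintegral mu setT (fun x => Rintegral mu setT (fun z => cim (P x z))))).
by rewrite re im.
Qed.

Definition conv1 f g : R -> C := fun z => cint1 (fun x => f x * g (z - x)).

Lemma cc_comp (T : topologicalType) f (h : T -> R) : continuous h -> cc f ->
  cc (fun x => f (h x)).
Proof.
move=> ch [fr fi]; split; first exact: (rcont_comp (v := fun y => cre (f y))).
exact: (rcont_comp (v := fun y => cim (f y))).
Qed.

(** Read off from row vectors of length 1, on which [f] is a tensor product with a single factor. *)
Lemma Cc1_unif_cont r f (e : R) : 0 < r -> Cc1 r f -> 0 < e ->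
  exists2 del : R, 0 < del & forall x y, `|x - y| < del -> cmod (f x - f y) < e.
Proof.
move=> r0 cf e0; have cF := @Ccr_prod R 1 r (fun=> f) (fun=> cf) r0.
have [del del0 h] := Cc_unif_cont (Ccr_Cc cF) e0.
exists del => // x y xy.
have := h (\row_j x) (\row_j y); rewrite !big_ord1 !mxE; apply.
apply: le_lt_trans xy; rewrite mx_norm_le//; apply/forallP => j; by rewrite !mxE.
Qed.

Lemma cc_sub (x : R) g : cc g -> cc (fun z => g (z - x)).
Proof.
apply: (@cc_comp R g (fun z => z - x)).
by apply: rcontD; [move=> z; exact: cvg_id|exact: rcont_cst].
Qed.

Lemma cc_rsub (z : R) g : cc g -> cc (fun x => g (z - x)).
Proof.
apply: (@cc_comp R g (fun x => z - x)).
by apply: rcontD; [exact: rcont_cst|apply: rcontN => x; exact: cvg_id].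
Qed.

Lemma Cc1_conv r s f g : 0 < r -> 0 < s -> Cc1 r f -> Cc1 s g -> Cc1 (r + s) (conv1 f g).
Proof.
move=> r0 s0 cf cg; have [M M0 hM] := Cc1_bounded cf.
have ci z : Cc1 r (fun x => f x * g (z - x)).
  by apply: Cc1_mulr => //; apply: cc_rsub; exact: cg.1.
split; last first.
  move=> z zrs; apply: cmod_eq0; apply/eqP; rewrite eq_le cmod_ge0 andbT.
  rewrite -(mulr0 (4 * r)); apply: cint1_bound => // x.
  have [xr|xr] := leP `|x| r; last by rewrite cf.2// mul0r cmod0.
  rewrite cg.2 ?mulr0 ?cmod0//; have := lerB_dist z x; lra.
apply: cc1_eps => z e e0.
pose K := 4 * r * M; have K0 : 0 < K by rewrite !mulr_gt0.
have [del del0 h] := Cc1_unif_cont s0 cg (divr_gt0 (divr_gt0 e0 (ltr0n _ 2)) K0).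
exists del => // z' zz'.
have -> : conv1 f g z - conv1 f g z' = cint1 (fun x => f x * g (z - x) + (-1) * (f x * g (z' - x))).
  by rewrite (cint1D (ci z) (Cc1_scale (-1) (ci z'))) (cint1Z _ (ci z')) mulN1r.
apply: (@le_lt_trans _ _ (e / 2)); last by rewrite ltr_pdivrMr// ltr_pMr// ltr1n.
rewrite (_ : e / 2 = 4 * r * (M * (e / 2 / K))); last first.
  by rewrite [RHS]mulrA -/K [RHS]mulrC divfK// lt0r_neq0.
apply: cint1_bound => //.
  by apply: Cc1_add => //; exact: Cc1_scale.
move=> x; rewrite mulN1r -mulrBr cmodM; apply: ler_pM; rewrite ?cmod_ge0//.
by apply: ltW; apply: h; rewrite opprB addrA subrK.
Qed.

Definition mc (F : mR * mR -> C) :=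
  measurable_fun setT (fun p => cre (F p)) /\ measurable_fun setT (fun p => cim (F p)).

Lemma mcM (F G : mR * mR -> C) : mc F -> mc G -> mc (fun p => F p * G p).
Proof.
move=> [Fr Fi] [Gr Gi]; split.
  under [X in measurable_fun _ X]eq_fun do rewrite creM.
  by apply: measurable_funB; exact: measurable_funM.
under [X in measurable_fun _ X]eq_fun do rewrite cimM.
by apply: measurable_funD; exact: measurable_funM.
Qed.

Lemma mc_comp f (h : mR * mR -> R) : cc f -> measurable_fun setT h -> mc (fun p => f (h p)).
Proof.
move=> [fr fi] mh; split.
  apply: (@measurableT_comp _ _ _ _ _ _ (fun x => cre (f x)) setT h) => //.
  exact: continuous_measurable_fun.
apply: (@measurableT_comp _ _ _ _ _ _ (fun x => cim (f x)) setT h) => //.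
exact: continuous_measurable_fun.
Qed.

(** After exchanging the integrals, the character splits as [ch (z - x) * ch x] and the inner
    integral is a translate. One variable is enough, as convolutions are only formed inside the
    factors of tensor products. *)
Lemma check1_conv r s f g y : 0 < r -> 0 < s -> Cc1 r f -> Cc1 s g ->
  check1 (conv1 f g) y = check1 f y * check1 g y.
Proof.
move=> r0 s0 cf cg; pose ch (x : R) : C := expi (2 * pi * (x * y)).
have cch : cc ch by exact: cc_char1.
have chD x z : ch (x + z) = ch x * ch z by rewrite /ch -expiD; congr expi; ring.
pose P z x := f x * g (z - x) * ch z.
have rs : 0 < r + s by lra.
have [M M0 hM] := Cc1_bounded cf; have [N N0 hN] := Cc1_bounded cg.
have e1 : check1 (conv1 f g) y = cint1 (fun z => cint1 (P z)).
  rewrite /check1; congr cint1; apply/funext => z; rewrite mulrC.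
  have ci : Cc1 r (fun x => f x * g (z - x)).
    by apply: Cc1_mulr => //; apply: cc_rsub; exact: cg.1.
  rewrite -(cint1Z _ ci); congr cint1; apply/funext => x.
  by rewrite /P /ch mulrC.
have mP : mc (fun p : mR * mR => P p.1 p.2).
  apply: mcM; last by apply: mc_comp => //; exact: measurable_fst.
  apply: mcM; first by apply: mc_comp; [exact: cf.1|exact: measurable_snd].
  apply: (mc_comp (h := fun p => p.1 - p.2)); first exact: cg.1.
  by apply: measurable_funB; [exact: measurable_fst|exact: measurable_snd].
have c2 x : cc (P ^~ x).
  apply: ccM => //; apply: ccM; first exact: cc_cst.
  by apply: cc_sub; exact: cg.1.
have c1 z : cc (P z).
  apply: ccM; last exact: cc_cst.
  by apply: ccM; [exact: cf.1|apply: cc_rsub; exact: cg.1].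
have sP z x : r + s < `|z| \/ r + s < `|x| -> P z x = 0.
  move=> h; rewrite /P; have [xr|xr] := leP `|x| r; last by rewrite cf.2// !mul0r.
  rewrite cg.2 ?mulr0 ?mul0r//; have := lerB_dist z x.
  by case: h => h; lra.
have bP z x : cmod (P z x) <= M * N.
  by rewrite /P !cmodM cmod_expi mulr1; apply: ler_pM; rewrite ?cmod_ge0.
rewrite e1 (cint1_swap rs mP.1 mP.2 bP sP c1 c2).
have e2 x : cint1 (P ^~ x) = check1 g y * (f x * ch x).
  have cg' : Cc1 s (fun u => g u * ch u) by exact: Cc1_char.
  rewrite [RHS]mulrC -[check1 g y]/(cint1 (fun u => g u * ch u)).
  rewrite -(cint1_translation x s0 cg').
  have cgx : Cc1 (s + `|x|) (fun z => g (z - x) * ch (z - x)).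
    split; first by apply: (cc_sub x (g := fun u => g u * ch u)); exact: cg'.1.
    by move=> z zs; apply: cg'.2; have := lerB_dist z x; lra.
  rewrite -(cint1Z _ cgx); congr cint1; apply/funext => z.
  have chz : ch z = ch (z - x) * ch x by rewrite -chD subrK.
  by rewrite /P chz; ring.
rewrite (_ : (fun z => cint1 (P ^~ z)) = fun x => check1 g y * (f x * ch x)); last first.
  by apply/funext => x; exact: e2.
by rewrite (cint1Z _ (Cc1_char y cf)) mulrC.
Qed.

(** The Poisson kernel is positive and decreases with |y|, so it is at least its value [m] at the
    end of the interval; a transform within [m / 2] of it keeps the lower bound [m / 2]. *)
Lemma poisson_nonvanishing (rho : R) : exists r k m, [/\ 0 < r, Cc1 r k, 0 < m &
  forall y, `|y| <= rho -> m <= cmod (check1 k y)].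
Proof.
have p0 := pi_gt0 R.
pose m : R := 2 / (1 + (2 * pi * rho) ^+ 2).
have d0 (b : R) : 0 < 1 + b ^+ 2 by rewrite ltr_wpDr ?sqr_ge0.
have m0 : 0 < m by rewrite divr_gt0.
have [r [k [r0 ck hk]]] := poisson_check_limit (@ltr01 R) (divr_gt0 m0 (ltr0n _ 2)).
exists r, k, (m / 2); split => //; first by rewrite divr_gt0.
move=> y yr; have := hk y; have := cmod_tri 0 (cofR (poisson 1 y)) (check1 k y).
have := cmodB (cofR (poisson 1 y) - check1 k y) (- check1 k y).
rewrite opprK subrK cmodN cmod_cofR.
have h : m <= poisson 1 y.
  rewrite /poisson /m mulr1 expr1n ler_pM2l// lef_pV2 ?posrE// lerD2l !exprMn.
  rewrite ler_pM2l; last by rewrite mulr_gt0// exprn_gt0.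
  rewrite -[y ^+ 2]real_normK ?num_real// lerXn2r ?nnegrE//.
  exact: le_trans (normr_ge0 y) yr.
have := ler_norm (poisson 1 y); lra.
Qed.

End Convolution1.

(** * Tensor products of transforms, and approximation by squares *)

Section SquareApproximation.
Variables (R : realType) (d : nat).
Local Notation C := (R[i]).
Local Notation pt := ('rV[R]_d).

Lemma expi_sum (I : Type) (s : seq I) (F : I -> R) :
  expi (\sum_(i <- s) F i) = \prod_(i <- s) expi (F i).
Proof. by apply: (big_morph (@expi R)) => //; [exact: expiD|exact: expi0]. Qed.

Lemma fcheck_prod r (f : 'I_d -> R -> C) (y : pt) : 0 < r -> (forall j, Cc1 r (f j)) ->
  fcheck (fun x : pt => \prod_j f j (x ord0 j)) y = \prod_j check1 (f j) (y ord0 j).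
Proof.
move=> r0 cf; rewrite /fcheck /check1.
rewrite -(intRd_gen_prod (f := fun j t => f j t * expi (2 * pi * (t * y ord0 j))) (r := r))//; last first.
  by move=> j; exact: Cc1_char.
congr intRd_gen; apply/funext => x; rewrite big_split /=; congr (_ * _).
by rewrite -expi_sum /dot mulr_sumr.
Qed.

(** Factors are replaced one at a time. As [eta <= 1] gives [cmod (b j) <= 2], the errors satisfy
    E(n+1) <= eta + 2 E(n), which 2^n - 1 solves. *)
Lemma prod_approx n (a b : 'I_n -> C) (eta : R) : 0 <= eta <= 1 ->
  (forall j, cmod (a j) <= 1) -> (forall j, cmod (a j - b j) <= eta) ->
  cmod (\prod_(j < n) a j - \prod_(j < n) b j) <= (2 ^+ n - 1) * eta.
Proof.
move=> /andP[e0 e1]; elim: n a b => [|n ih] a b ha hab.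
  by rewrite !big_ord0 subrr cmod0 expr0 subrr mul0r.
rewrite !big_ord_recl.
have := ih (fun j => a (lift ord0 j)) (fun j => b (lift ord0 j)) (fun j => ha _) (fun j => hab _).
have : cmod (\prod_(j < n) a (lift ord0 j)) <= 1.
  by rewrite cmod_prod; apply: prodr_ile1 => j _; rewrite cmod_ge0 ha.
set A := \prod_(i < n) _; set B := \prod_(i < n) _ => hA hAB.
rewrite (_ : _ - _ = (a ord0 - b ord0) * A + b ord0 * (A - B)); last by ring.
apply: le_trans (cmodD _ _) _; rewrite !cmodM.
have hb : cmod (b ord0) <= 2.
  have := cmodB (a ord0) (a ord0 - b ord0); rewrite opprB addrC subrK.
  by have := ha ord0; have := hab ord0; lra.
have h1 : cmod (a ord0 - b ord0) * cmod A <= eta.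
  by rewrite -[eta]mulr1; apply: ler_pM; rewrite ?cmod_ge0.
have h2 : cmod (b ord0) * cmod (A - B) <= 2 * ((2 ^+ n - 1) * eta).
  by apply: ler_pM; rewrite ?cmod_ge0.
by apply: le_trans (lerD h1 h2) _; rewrite exprS; lra.
Qed.

Definition ptens (f : 'I_d -> R -> C) : pt -> C := fun x => \prod_j f j (x ord0 j).

Lemma uniform_radius (f : 'I_d -> R -> C) :
  (forall j, exists2 r, 0 < r & Cc1 r (f j)) -> exists2 r, 0 < r & forall j, Cc1 r (f j).
Proof.
move=> h; have /choice[rr hr] j : exists r, 0 < r /\ Cc1 r (f j) by have [r] := h j; exists r.
exists (1 + \sum_j rr j).
  by rewrite ltr_wpDr// sumr_ge0// => j _; case: (hr j) => /ltW.
move=> j; have [r0 cf] := hr j; apply: Cc1_le cf.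
rewrite (bigD1 j)//= addrCA lerDl addr_ge0// sumr_ge0// => i _.
by case: (hr i) => /ltW.
Qed.

Lemma tensor_check_approx (a : 'I_d -> R -> C) (e : R) :
  (forall j, check_limit (a j)) -> (forall j y, cmod (a j y) <= 1) -> 0 < e ->
  exists r f, [/\ 0 < r, forall j, Cc1 r (f j) &
    forall y : pt, cmod (\prod_j a j (y ord0 j) - \prod_j check1 (f j) (y ord0 j)) <= e].
Proof.
move=> ha a1 e0; pose eta := Num.min 1 (e / 2 ^+ d).
have p2 : (0 : R) < 2 ^+ d by rewrite exprn_gt0.
have eta0 : 0 < eta by rewrite lt_min ltr01 divr_gt0.
have eta1 : eta <= 1 by rewrite ge_min lexx.
have eta2 : eta <= e / 2 ^+ d by rewrite ge_min lexx orbT.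
have ex j : exists f, (exists2 r, 0 < r & Cc1 r f) /\ forall y, cmod (a j y - check1 f y) <= eta.
  have [r [f [r0 cf hf]]] := ha j eta eta0; exists f; split => //; by exists r.
have [f hf] := choice ex.
have [r r0 cf] := uniform_radius (fun j => (hf j).1).
exists r, f; split => // y.
apply: le_trans (prod_approx (eta := eta) _ _ _) _ => [|j|j|].
- by rewrite (ltW eta0).
- exact: a1.
- exact: (hf j).2.
- apply: (@le_trans _ _ (2 ^+ d * eta)); first by rewrite ler_wpM2r ?(ltW eta0)// gerBl.
  by rewrite mulrC -ler_pdivlMr.
Qed.

Lemma check_dense (psi : pt -> C) (e : R) : Cc psi -> 0 < e ->
  exists (I : finType) (c : I -> C) (f : I -> 'I_d -> R -> C),
    (forall i, exists2 r, 0 < r & forall j, Cc1 r (f i j)) /\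
    forall y : pt, cmod (psi y - \sum_i c i * \prod_j check1 (f i j) (y ord0 j)) <= e.
Proof.
move=> cpsi e0.
have [del [eps [K [/andP[del0 _] eps0 h]]]] := grid_approx cpsi (divr_gt0 e0 (ltr0n _ 2)).
have [lam lam0 sT] := atan_step_is_step del0 eps0.
pose I := {ffun 'I_d -> 'I_(K + K)}.
have [M M0 hM] := Cc_bounded cpsi.
(* The grid, and with it the number of terms, is fixed before the tensor products are replaced by
   transforms; the accumulated error is thus at most e/2. *)
pose eta := e / 2 / (#|I|.+1%:R * M).
have IM0 : 0 < #|I|.+1%:R * M by rewrite mulr_gt0// ltr0n.
have eta0 : 0 < eta by rewrite divr_gt0// divr_gt0.
have ex (m : I) : exists f : 'I_d -> R -> C, (exists2 r, 0 < r & forall j, Cc1 r (f j)) /\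
    forall y : pt, cmod (cofR (\prod_j incr (atan_step lam) del (gridpt K del (m j)) (y ord0 j))
      - \prod_j check1 (f j) (y ord0 j)) <= eta.
  have [||r [f [r0 cf hf]]] := @tensor_check_approx
      (fun j y => cofR (incr (atan_step lam) del (gridpt K del (m j)) y)) eta _ _ eta0.
  - by move=> j; exact: incr_check_limit.
  - move=> j y; rewrite cmod_cofR /incr; have := atan_step_ge0le1 lam.
    move=> h1; have := h1 (y - gridpt K del (m j)); have := h1 (y - gridpt K del (m j) - del).
    by rewrite ler_norml; lra.
  exists f; split; first by exists r.
  by move=> y; rewrite cofR_prod; exact: hf.
have [f hf] := choice ex.
exists I, (fun m => psi (gridvec del m)), f; split; first by move=> m; case: (hf m).
move=> y; apply: le_trans (cmod_tri (grid_sum (atan_step lam) del K psi y) _ _) _.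
rewrite (splitr e); apply: lerD; first exact: h.
rewrite /grid_sum -sumrB; apply: le_trans (cmod_sum _ _ _) _.
apply: (@le_trans _ _ (\sum_(m : I) M * eta)).
  apply: ler_sum => m _; rewrite -mulrBr cmodM; apply: ler_pM; rewrite ?cmod_ge0//.
  exact: (hf m).2.
have eE : eta * (#|I|.+1%:R * M) = e / 2 by rewrite divfK// lt0r_neq0.
rewrite sumr_const -[leLHS]mulr_natl -eE [leRHS]mulrC -mulrA.
apply: ler_wpM2r; first by rewrite mulr_ge0 ?(ltW M0) ?(ltW eta0).
by rewrite ler_nat; exact: leqnSn.
Qed.

(* [p] is, relatively to the fixed weight |k^|^2, uniformly approximated by
   squares |H^|^2 with [H] in C_c: approximate [sqrt p / k^] by a transform
   [f^] and take [H] = [f * k]. *)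
Lemma square_approx (p : pt -> R) : Cc (fun x => cofR (p x)) -> (forall x, 0 <= p x) ->
  exists2 k, Cc k & forall e : R, 0 < e -> exists2 H, Cc H &
    forall y, `|p y - cmod (fcheck H y) ^+ 2| <= e * cmod (fcheck k y) ^+ 2.
Proof.
move=> cp p0; have [rho rho0 [cp1 cp2]] := Cc_Ccr cp.
have [r [ka [m [r0 cka m0 hka]]]] := poisson_nonvanishing rho.
pose k := ptens (fun=> ka).
have ck : Cc k by apply: (@Ccr_Cc _ _ r); exact: Ccr_prod.
pose kc y := fcheck k y.
have kcE y : kc y = \prod_j check1 ka (y ord0 j) by exact: (@fcheck_prod r (fun=> ka) y r0 (fun=> cka)).
have cck : ccont kc by exact: ccont_fcheck.
pose w := (m ^+ d) ^+ 2; have w0 : 0 < w by rewrite !exprn_gt0.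
have kw y : `|y| <= rho -> w <= cmod (kc y) ^+ 2.
  move=> yr; rewrite lerXn2r ?nnegrE ?cmod_ge0 ?exprn_ge0 ?(ltW m0)//.
  rewrite kcE cmod_prod -[X in m ^+ X]card_ord -prodr_const.
  apply: ler_prod => j _; rewrite (ltW m0) /= hka//.
  exact: le_trans (coord_le_norm y j) yr.
(* This is the maximum of |k^|^2 and [w]: it equals |k^|^2 on the box containing the support of [p],
   and stays away from 0 everywhere. *)
pose den y := (cmod (kc y) ^+ 2 + w + `|cmod (kc y) ^+ 2 - w|) / 2.
have denw y : w <= den y.
  by rewrite /den; have := ler_norm (w - cmod (kc y) ^+ 2); rewrite distrC; lra.
have den0 y : 0 < den y by exact: lt_le_trans (denw y).
have denE y : `|y| <= rho -> den y = cmod (kc y) ^+ 2.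
  by move=> /kw h; rewrite /den ger0_norm ?subr_ge0//; lra.
have ckc2 : continuous (fun y => cmod (kc y) ^+ 2).
  by apply: rcontM; exact: cmod_continuous.
have cden : continuous den.
  apply: rcontM; last exact: rcont_cst.
  apply: rcontD; first by apply: rcontD => //; exact: rcont_cst.
  apply: (rcont_comp (v := Num.Def.normr)); last exact: norm_continuous.
  by apply: rcontD => //; exact: rcont_cst.
(* On the box this is sqrt p / k^; dividing the conjugate of k^ by [den] keeps it continuous at
   possible zeros of k^ outside. *)
pose psi y := cofR (Num.sqrt (p y)) * cconj (kc y) * cofR (den y)^-1.
have cpsi : Cc psi.
  apply: (@Ccr_Cc _ _ rho); split.
    apply: ccontM; last first.
      by apply: ccont_cofR; apply: rcontV => // y; rewrite lt0r_neq0.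
    apply: ccontM; last exact: ccont_conj.
    apply: ccont_cofR; apply: (rcont_comp (v := Num.sqrt)); last exact: sqrt_continuous.
    by have /ccontP[] := cp1.
  move=> y yr; rewrite /psi; have /(congr1 (@cre R)) /= -> := cp2 y yr.
  by rewrite sqrtr0 -[cofR 0]/(0 : C) !mul0r.
have psik y : p y = cmod (psi y) ^+ 2 * cmod (kc y) ^+ 2.
  have [yr|yr] := leP `|y| rho; last first.
    rewrite /psi; have /(congr1 (@cre R)) /= -> := cp2 y yr.
    by rewrite sqrtr0 -[cofR 0]/(0 : C) !mul0r cmod0 expr0n mul0r.
  have kn : cmod (kc y) != 0.
    by have := kw y yr; apply: contraTneq => ->; rewrite expr0n -ltNge.
  rewrite /psi !cmodM !cmod_cofR cmod_conj (denE y yr) ger0_norm ?sqrtr_ge0//.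
  rewrite ger0_norm ?invr_ge0 ?sqr_ge0// !exprMn sqr_sqrtr// exprVn.
  by field.
have [M M0 hM] := Cc_bounded cpsi.
(* [k] is fixed before [e]. If |psi - F| <= eta <= 1 and |psi| <= M, the squared moduli differ by at
   most eta (2M + 1), whence the choice of [eta]. *)
exists k => // e e0; pose eta := Num.min 1 (e / (2 * M + 1)).
have M1 : 0 < 2 * M + 1 by lra.
have eta0 : 0 < eta by rewrite lt_min ltr01 divr_gt0.
have eta1 : eta <= 1 by rewrite ge_min lexx.
have eta2 : eta * (2 * M + 1) <= e by rewrite -ler_pdivlMr// ge_min lexx orbT.
have [I [c [f [cf hf]]]] := check_dense cpsi eta0.
pose Fc (y : pt) := \sum_i c i * \prod_j check1 (f i j) (y ord0 j).
(* Convolving every tensor factor with [ka] multiplies each term of the transform, and hence the sum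
   [Fc], by k^. *)
pose H x := \sum_(i : I) c i * ptens (fun j => conv1 (f i j) ka) x.
have cg i : exists2 s, 0 < s & forall j, Cc1 s (conv1 (f i j) ka).
  have [s s0 hs] := cf i; exists (s + r); first by lra.
  by move=> j; exact: Cc1_conv.
have cHi i : Cc (ptens (fun j => conv1 (f i j) ka)).
  by have [s s0 hs] := cg i; apply: (@Ccr_Cc _ _ s); exact: Ccr_prod.
exists H.
  by apply: Cc_sum => i; exact: Cc_scale.
move=> y; have -> : fcheck H y = Fc y * kc y.
  rewrite /fcheck; under [X in intRd X]eq_fun do rewrite /H mulr_suml.
  rewrite intRd_sum; last by move=> i; apply: Cc_char; exact: Cc_scale.
  rewrite /Fc mulr_suml; apply: eq_bigr => i _.
  under [X in intRd X]eq_fun do rewrite -mulrA.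
  rewrite intRdZ; last exact: Cc_char.
  rewrite -mulrA; congr (_ * _); rewrite -/(fcheck _ y).
  have [s s0 hs] := cg i; rewrite (fcheck_prod (r := s))// kcE -big_split /=.
  apply: eq_bigr => j _; have [t t0 ht] := cf i.
  exact: check1_conv t0 r0 (ht j) cka.
rewrite psik cmodM exprMn -mulrBl normrM (ger0_norm (sqr_ge0 (cmod (kc y)))).
apply: ler_wpM2r; first exact: sqr_ge0.
have h1 := hf y; rewrite -/(Fc y) in h1; have h2 := hM y.
have h3 := cmod_tri 0 (Fc y) (psi y); have h4 := cmod_ge0 (psi y); have h5 := cmod_ge0 (Fc y).
have a1 : cmod (psi y) <= cmod (Fc y) + eta.
  by have := cmodD (psi y - Fc y) (Fc y); rewrite subrK; lra.
have a2 : cmod (Fc y) <= cmod (psi y) + eta.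
  by have := cmodB (psi y) (psi y - Fc y); rewrite opprB addrC subrK; lra.
apply: le_trans eta2; rewrite subr_sqr normrM.
apply: ler_pM => //; first by rewrite ler_norml; lra.
by rewrite ger0_norm; lra.
Qed.

End SquareApproximation.

(** * Transforms of measures and convergence *)

Section FourierTransform.
Variables (R : realType) (d : nat).
Local Notation C := (R[i]).
Local Notation pt := ('rV[R]_d).
Implicit Types (mu nu : measure_on R d) (f g : pt -> C) (h p : pt -> R).

Lemma real_cauchy (u : nat -> R) :
  (forall e : R, 0 < e -> exists K, forall k, (K <= k)%N -> `|u K - u k| < e) ->
  exists l : R, forall e : R, 0 < e -> exists K, forall k, (K <= k)%N -> `|l - u k| < e.
Proof.
move=> h; have cu : cauchy (u @ \oo).
  apply: cauchy_exP => e e0; have [K hK] := h e e0.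
  by exists (u K), K => // k Kk; exact: hK.
have /cvg_ex[l hl] : cvg (u @ \oo) by apply: cauchy_cvg.
exists l => e e0; move/(@cvgrPdist_lt R) : hl => /(_ e e0)[K _ hK].
by exists K => k; exact: hK.
Qed.

Lemma complex_cauchy (z : nat -> C) :
  (forall e : R, 0 < e -> exists K, forall k l, (K <= k)%N -> (K <= l)%N ->
     cmod (z k - z l) < e) ->
  exists w, forall e : R, 0 < e -> exists K, forall k, (K <= k)%N -> cmod (z k - w) < e.
Proof.
move=> h; have [a ha] : exists a, forall e, 0 < e -> exists K, forall k, (K <= k)%N -> `|a - cre (z k)| < e.
  apply: real_cauchy => e e0; have [K hK] := h e e0; exists K => k Kk.
  by rewrite -creN -creD; apply: le_lt_trans (cre_le_cmod _) _; exact: hK.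
have [b hb] : exists b, forall e, 0 < e -> exists K, forall k, (K <= k)%N -> `|b - cim (z k)| < e.
  apply: real_cauchy => e e0; have [K hK] := h e e0; exists K => k Kk.
  by rewrite -cimN -cimD; apply: le_lt_trans (cim_le_cmod _) _; exact: hK.
exists (Complex a b) => e e0.
have [K hK] := ha _ (divr_gt0 e0 (ltr0n _ 2)).
have [L hL] := hb _ (divr_gt0 e0 (ltr0n _ 2)).
exists (maxn K L) => k; rewrite geq_max => /andP[/hK h1 /hL h2].
rewrite cmodC; apply: le_lt_trans (cmod_le_sum _) _.
by rewrite creD cimD creN cimN /= (splitr e) ltrD.
Qed.

(** The integral of [h] against |nu| is at most [V], expressed through complex test functions: the
    form in which finiteness of [upint_tv] is used. *)
Definition dominated nu h (V : R) :=
  forall psi, Cc psi -> (forall x, cmod (psi x) <= h x) -> cmod (nu psi) <= V.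

Lemma upint_dominated nu h : is_measure nu -> (upint_tv nu h < +oo)%E ->
  exists V, dominated nu h V.
Proof.
move=> mn fin; exists (fine (upint_tv nu h)) => psi cpsi hpsi.
pose phi x := cmod (psi x).
have cphi : Cc (fun x => cofR (phi x)).
  have [r r0 [c1 c2]] := Cc_Ccr cpsi; apply: (@Ccr_Cc _ _ r); split.
    by apply: ccont_cofR; exact: cmod_continuous.
  by move=> x xr; rewrite /phi c2// cmod0.
have [r r0 cr] := Cc_Ccr cpsi; have [M M0 hM] := Cc_bounded cpsi.
have [K K0 hK] := meas_bound r mn.
(* A supremum in [R] bounds its set only if the set is bounded; here this follows from the
   continuity of [nu] on functions supported in the ball of [psi]. *)
have tv : cmod (nu psi) <= totvar nu phi.
  apply: sup_upper_bound; last by exists psi => //; split => // x; rewrite /phi.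
  split; first by exists (cmod (nu psi)), psi => //; split => // x; rewrite /phi.
  exists (K * M) => _ [q [cq hq] <-]; apply: hK.
    split; first exact: cq.1.
    move=> x xr; apply: cmod_eq0; apply/eqP; rewrite eq_le cmod_ge0 andbT.
    by apply: le_trans (hq x) _; rewrite /phi cr.2// cmod0.
  by move=> x; apply: le_trans (hq x) (hM x).
have up : ((totvar nu phi)%:E <= upint_tv nu h)%E.
  apply: ereal_sup_ubound; exists phi => //; split => // x.
  by rewrite /phi cmod_ge0 hpsi.
have fn : upint_tv nu h \is a fin_num.
  by rewrite fin_numE (lt_eqF fin) andbT gt_eqF//; apply: lt_le_trans up; exact: ltNyr.
by rewrite -lee_fin (le_trans _ (le_trans up _))// ?fineK// lee_fin.
Qed.

Lemma dominated_scale nu h V (e : R) psi : is_measure nu -> dominated nu h V -> 0 < e ->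
  Cc psi -> (forall x, cmod (psi x) <= e * h x) -> cmod (nu psi) <= e * V.
Proof.
move=> mn dV e0 cpsi hpsi.
have := dV (fun x => cofR e^-1 * psi x) (Cc_scale _ cpsi).
rewrite measZ// cmodM cmod_cofR ger0_norm ?invr_ge0 ?(ltW e0)// mulrC ler_pdivrMr//.
rewrite mulrC => ->// x.
by rewrite cmodM cmod_cofR ger0_norm ?invr_ge0 ?(ltW e0)// mulrC ler_pdivrMr// mulrC.
Qed.

Lemma Cc_cut k f : ccont f -> Cc (fun x => f x * cofR (cutoff k x)).
Proof. by move=> cf; apply: Cc_mull => //; exact: Cc_cutoff. Qed.

(* If [nu psi0] nearly exhausts the total mass of [h], functions dominated by
   [h] that vanish on the support of [psi0] have small integral, so the
   truncations of [h] form a Cauchy sequence. *)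
Lemma ext_lim_ex nu h V : is_measure nu -> continuous h -> (forall x, 0 <= h x) ->
  dominated nu h V -> exists z, ext_lim nu (fun x => cofR (h x)) z.
Proof.
move=> mn ch h0 dV.
pose A := [set cmod (nu psi) | psi in [set psi | Cc psi /\ forall x, cmod (psi x) <= h x]].
have supA : has_sup A.
  split; first by exists (cmod (nu (fun=> 0))), (fun=> 0) => //; split => [|x]; [exact: Cc_0|rewrite cmod0].
  by exists V => _ [psi [c1 c2] <-]; exact: dV.
apply: complex_cauchy => e e0.
have [_ [psi0 [c0 hp0] <-] hs] : exists2 x, A x & sup A - e < x.
  by apply: sup_gt; [exact: supA.1|rewrite gtrBl].
have [r r0 [_ s0]] := Cc_Ccr c0.
have [K hK] := @eventually_cutoff R d r.
exists K => k l Kk Kl.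
have cc k' : Cc (fun x : pt => cofR (h x) * cofR (cutoff k' x) : C).
  by apply: Cc_cut; exact: ccont_cofR.
rewrite -measB//.
pose eta x : C := cofR (h x) * cofR (cutoff k x) - cofR (h x) * cofR (cutoff l x).
rewrite -/eta; have ceta : Cc eta by exact: Cc_sub.
have etah x : cmod (eta x) <= h x.
  rewrite /eta -mulrBr -cofRN -cofRD cmodM !cmod_cofR (ger0_norm (h0 x)).
  rewrite ler_piMr//; have := cutoff_ge0le1 k x; have := cutoff_ge0le1 l x.
  by rewrite ler_norml; lra.
have eta0 x : `|x| <= r -> eta x = 0.
  by move=> xr; rewrite /eta (hK k)// (hK l)// subrr.
(* Rotating both values to the nonnegative half-line makes their moduli add up. The rotated sum is
   still dominated by [h], as [eta] vanishes on the ball that contains the support of [psi0]. *)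
have [c [c1 ce]] := rotation (nu psi0); have [c' [c1' ce']] := rotation (nu eta).
have : cmod (nu (fun x => c * psi0 x + c' * eta x)) <= sup A.
  apply: sup_upper_bound => //; exists (fun x => c * psi0 x + c' * eta x) => //.
  split; first by apply: Cc_add; exact: Cc_scale.
  move=> x; have [xr|xr] := leP `|x| r.
    by rewrite eta0// mulr0 addr0 cmodM c1 mul1r.
  by rewrite s0// mulr0 add0r cmodM c1' mul1r.
rewrite measD ?measZ//; try exact: Cc_scale.
rewrite ce ce' -cofRD cmod_cofR ger0_norm ?addr_ge0 ?cmod_ge0//.
by move: hs; lra.
Qed.

Lemma ext_lim_Cc nu g : Cc g -> ext_lim nu g (nu g).
Proof.
move=> /Cc_Ccr[r r0 [_ hg]] e e0.
have [K hK] := @eventually_cutoff R d r; exists K => k /hK hk.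
rewrite (_ : (fun x => _) = g) ?subrr ?cmod0//.
apply/funext => x; have [xr|xr] := leP `|x| r; last by rewrite hg// mul0r.
by rewrite hk// -[cofR 1]/(1 : C) mulr1.
Qed.

Lemma ext_lim_compare nu g1 g2 g3 z1 z2 z3 (e B : R) : 0 <= e ->
  ext_lim nu g1 z1 -> ext_lim nu g2 z2 -> ext_lim nu g3 z3 ->
  (forall k, cmod (nu (fun x => g1 x * cofR (cutoff k x)) - nu (fun x => g2 x * cofR (cutoff k x)))
     <= e * cmod (nu (fun x => g3 x * cofR (cutoff k x))) + B) ->
  cmod (z1 - z2) <= e * cmod z3 + B.
Proof.
move=> e0 l1 l2 l3 hk; rewrite leNgt; apply/negP => hlt.
(* Three approximations within [del] cost (2 + e) del in total, less than the supposed gap (3 + e)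
   del. *)
pose del := (cmod (z1 - z2) - (e * cmod z3 + B)) / (3 + e).
have e3 : 0 < 3 + e by lra.
have del0 : 0 < del by rewrite divr_gt0// subr_gt0.
have delE : del * (3 + e) = cmod (z1 - z2) - (e * cmod z3 + B) by rewrite divfK// lt0r_neq0.
have [K1 h1] := l1 _ del0; have [K2 h2] := l2 _ del0; have [K3 h3] := l3 _ del0.
pose k := (K1 + K2 + K3)%N.
have {}h1 := h1 k (leq_trans (leq_addr _ _) (leq_addr _ _)).
have {}h2 := h2 k (leq_trans (leq_addl _ _) (leq_addr _ _)).
have {}h3 := h3 k (leq_addl _ _).
have := hk k; move: h1 h2 h3.
set a := nu _; set b := nu _; set c := nu _ => h1 h2 h3 hab.
have i1 := cmod_tri a z1 z2; have i2 := cmod_tri b a z2.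
have i3 : cmod c <= cmod z3 + del.
  by have := cmodD (c - z3) z3; rewrite subrK; lra.
have i4 : e * cmod c <= e * (cmod z3 + del) by rewrite ler_wpM2l.
rewrite (cmodC z1 a) in i1; nra.
Qed.

(** [ext] takes the default value 0 when there is no limit, so the identity in [is_FT] becomes
    informative only through existence of the limit; this follows from the finite upper integral by
    [ext_lim_ex]. *)
Lemma FT_lim mu nu f : is_FT mu nu -> Cc f ->
  ext_lim nu (fun y => cofR (cmod (fcheck f y) ^+ 2)) (mu (fconv f (ftilde f))) /\
  exists V, dominated nu (fun y => cmod (fcheck f y) ^+ 2) V.
Proof.
move=> [mn hft] cf; have [fin ->] := hft f cf.
have [V dV] := upint_dominated mn fin; split; last by exists V.
have [|x|z hz] := ext_lim_ex mn _ _ dV.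
- by apply: rcontM; apply: cmod_continuous; exact: ccont_fcheck.
- exact: sqr_ge0.
by rewrite (ext_eq hz).
Qed.

Lemma FT_cut k f : Cc f -> Cc (fun y : pt => cofR (cmod (fcheck f y) ^+ 2) * cofR (cutoff k y) : C).
Proof.
move=> cf; apply: Cc_cut; apply: ccont_cofR.
by apply: rcontM; apply: cmod_continuous; exact: ccont_fcheck.
Qed.

Lemma FT_positive mu nu p : pos_def mu -> is_FT mu nu ->
  Cc (fun x => cofR (p x)) -> (forall x, 0 <= p x) ->
  cim (nu (fun x => cofR (p x))) = 0 /\ 0 <= cre (nu (fun x => cofR (p x))).
Proof.
move=> pd ft cp p0; have mn := ft.1.
have [k ck hk] := square_approx cp p0.
have [lk [V dV]] := FT_lim ft ck.
set z := nu _.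
(* [V] bounds the mass of |k^|^2 and does not depend on [e]; hence [z] lies within any positive
   distance of the nonnegative half-line. *)
have near e : 0 < e -> `|cim z| <= e * V /\ - (e * V) <= cre z.
  move=> e0; have [H cH hH] := hk e e0; have [lH _] := FT_lim ft cH.
  have := @ext_lim_compare nu _ _ _ _ _ _ 0 (e * V) (lexx 0) (ext_lim_Cc nu cp) lH lk.
  rewrite mul0r add0r => /(_ _)/le_trans hz.
  have {}hz : cmod (z - mu (fconv H (ftilde H))) <= e * V.
    apply: hz => // j; rewrite mul0r add0r -measB//; [|exact: Cc_cut cp.1|exact: FT_cut].
    apply: (dominated_scale mn dV e0).
      by apply: Cc_sub; [exact: Cc_cut cp.1|exact: FT_cut].
    move=> x; rewrite -mulrBl -cofRN -cofRD cmodM !cmod_cofR.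
    apply: le_trans (hH x); rewrite ler_piMr//.
    by rewrite ler_norml; have := cutoff_ge0le1 j x; lra.
  have [i0 r0] := pd H cH.
  have := cim_le_cmod (z - mu (fconv H (ftilde H))).
  have := cre_le_cmod (z - mu (fconv H (ftilde H))).
  rewrite creD cimD creN cimN i0 oppr0 addr0 => h1 h2; split; first exact: le_trans hz.
  by have := le_trans h1 hz; rewrite ler_norml; lra.
have V0 : 0 <= V.
  have := dV (fun=> 0) (@Cc_0 R d) (fun x => _); move/(_ _)/(le_trans (cmod_ge0 _)); apply => x.
  by rewrite cmod0 sqr_ge0.
have V1 : 0 < V + 1 by lra.
split.
  apply/eqP; rewrite -normr_eq0 eq_le normr_ge0 andbT leNgt; apply/negP => hz.
  have [h _] := near _ (divr_gt0 hz V1).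
  move: h; rewrite mulrAC ler_pdivlMr// ler_pM2l//; lra.
rewrite leNgt; apply/negP => hz.
have hz' : 0 < - cre z by rewrite oppr_gt0.
have [_] := near _ (divr_gt0 hz' V1).
rewrite lerNl mulrAC ler_pdivlMr// ler_pM2l//; lra.
Qed.

(** Domination by a mass [V] would give a constant depending on [nu] and [t]. Instead, positivity
    turns |q| <= e w into |nu(q)| <= e nu(w), and as the cutoff disappears nu(w) tends to [mu] at
    the modulated k * k~, which can be bounded uniformly. *)
Lemma FT_translate_approx mu nu p H k (e : R) t : pos_def mu -> is_FT mu nu ->
  Cc (fun x => cofR (p x)) -> Cc H -> Cc k -> 0 <= e ->
  (forall y, `|p y - cmod (fcheck H y) ^+ 2| <= e * cmod (fcheck k y) ^+ 2) ->
  cmod (nu (fun y => cofR (p (y - t))) - mu (modul t (fconv H (ftilde H)))) <=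
  e * cmod (mu (modul t (fconv k (ftilde k)))).
Proof.
move=> pd ft cp cH ck e0 hH; have mn := ft.1.
have cpt := Cc_shift t cp; have cHt := Cc_modul t cH; have ckt := Cc_modul t ck.
have [lH _] := FT_lim ft cHt; have [lk _] := FT_lim ft ckt.
move: lH lk; rewrite !fconv_modul// => lH lk.
rewrite -[leRHS]addr0; apply: (ext_lim_compare e0 (ext_lim_Cc nu cpt) lH lk) => j.
rewrite addr0 -measB//; [|exact: Cc_cut cpt.1|exact: FT_cut].
pose q x := (p (x - t) - cmod (fcheck (modul t H) x) ^+ 2) * cutoff j x.
pose w x := cmod (fcheck (modul t k) x) ^+ 2 * cutoff j x.
have qE : (fun x => cofR (p (x - t)) * cofR (cutoff j x) -
    cofR (cmod (fcheck (modul t H) x) ^+ 2) * cofR (cutoff j x)) = fun x => cofR (q x).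
  by apply/funext => x; rewrite -mulrBl -cofRN -cofRD -cofRM.
have wE : (fun x => cofR (cmod (fcheck (modul t k) x) ^+ 2) * cofR (cutoff j x)) =
   fun x => cofR (w x) by apply/funext => x; rewrite -cofRM.
have cq : Cc (fun x => cofR (q x)).
  by rewrite -qE; apply: Cc_sub; [exact: Cc_cut cpt.1|exact: FT_cut].
have cw : Cc (fun x => cofR (w x)) by rewrite -wE; exact: FT_cut.
have qw x : `|q x| <= e * w x.
  have /andP[k0 _] := cutoff_ge0le1 j x.
  rewrite /q /w normrM (ger0_norm k0) mulrA ler_wpM2r// !fcheck_modul; exact: hH.
rewrite qE wE.
(* Both e w + q and e w - q are nonnegative functions of C_c, so their integrals are real and
   nonnegative. *)
have sgn (s : R) : s = 1 \/ s = -1 ->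
    cim (cofR e * nu (fun x => cofR (w x)) + cofR s * nu (fun x => cofR (q x))) = 0 /\
    0 <= cre (cofR e * nu (fun x => cofR (w x)) + cofR s * nu (fun x => cofR (q x))).
  move=> hs; rewrite -!measZ// -measD//; try exact: Cc_scale.
  rewrite (_ : (fun x => _) = fun x => cofR (e * w x + s * q x)); last first.
    by apply/funext => x; rewrite cofRD !cofRM.
  apply: (FT_positive pd ft).
    rewrite (_ : (fun x => _) = fun x => cofR e * cofR (w x) + cofR s * cofR (q x)).
      by apply: Cc_add; exact: Cc_scale.
    by apply/funext => x; rewrite cofRD !cofRM.
  by move=> x; have := qw x; rewrite ler_norml; case: hs => ->; lra.
have [] := sgn 1 (or_introl erefl); have [] := sgn (-1) (or_intror erefl).
set a := nu _; set b := nu _.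
rewrite !creD !cimD !creM !cimM /= !mul0r !subr0 !addr0 => i1 r1 i2 r2.
have ib : cim b = 0 by lra.
have -> : cmod b = `|cre b| by rewrite /cmod ib expr0n addr0 sqrtr_sqr.
have : `|cre b| <= e * cre a by rewrite ler_norml; lra.
move/le_trans; apply; rewrite ler_wpM2l//.
by apply: le_trans (ler_norm _) _; exact: cre_le_cmod.
Qed.

End FourierTransform.

(** * Convergence of the transforms, uniformly over translates *)

Section Convergence.
Variables (R : realType) (d : nat).
Local Notation C := (R[i]).
Local Notation pt := ('rV[R]_d).
Variables (mus : nat -> measure_on R d) (mu : measure_on R d).
Hypothesis mmus : forall n, is_measure (mus n).
Hypothesis pmus : forall n, pos_def (mus n).
Hypothesis mmu : is_measure mu.
Hypothesis vb : vaguely_bounded mus.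
Hypothesis unif : forall f, Cc f -> forall e : R, 0 < e -> exists N : nat,
  forall n, (N <= n)%N -> forall t : pt, cmod (mus n (modul t f) - mu (modul t f)) < e.

Lemma modul0 (f : pt -> C) : modul 0 f = f.
Proof.
apply/funext => x; rewrite /modul (_ : dot 0 x = 0); first by rewrite mulr0 oppr0 expi0 mul1r.
by apply: big1 => i _; rewrite mxE mul0r.
Qed.

Lemma pos_def_limit : pos_def mu.
Proof.
move=> f cf; have cF := Cc_fconv cf (Cc_ftilde cf).
set F := fconv f (ftilde f) in cF *.
have near e : 0 < e -> `|cim (mu F)| < e /\ - e < cre (mu F).
  move=> e0; have [N hN] := unif cF e0; have := hN N (leqnn N) 0; rewrite modul0 => h.
  have [i0 r0] := pmus N cf.
  have h1 := le_lt_trans (cre_le_cmod _) h; have h2 := le_lt_trans (cim_le_cmod _) h.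
  move: h1 h2; rewrite creD cimD creN cimN -/F i0 sub0r normrN => h1 h2; split => //.
  by move: h1 r0; rewrite ltr_norml -/F; lra.
split.
  apply/eqP; rewrite -normr_eq0 eq_le normr_ge0 andbT leNgt; apply/negP => hz.
  by have [] := near _ hz; rewrite ltxx.
rewrite leNgt; apply/negP => hz.
have hz' : 0 < - cre (mu F) by rewrite oppr_gt0.
by have [_] := near _ hz'; rewrite opprK ltxx.
Qed.

Variables (nus : nat -> measure_on R d) (nu : measure_on R d).
Hypothesis ftn : forall n, is_FT (mus n) (nus n).
Hypothesis ft : is_FT mu nu.

(** The order of choices matters: [k] depends on [p] alone, so the bound [S] on all modulated values
    at k * k~ is available before [e] determines [eta], then [H], and finally [N]. *)
Lemma translates_cvg (p : pt -> R) : Cc (fun x => cofR (p x)) -> (forall x, 0 <= p x) ->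
  forall e : R, 0 < e -> exists N : nat, forall n, (N <= n)%N -> forall x,
    cmod (nus n (fun y => cofR (p (y - x))) - nu (fun y => cofR (p (y - x)))) < e.
Proof.
move=> cp p0 e e0; have [k ck hk] := square_approx cp p0.
have cK := Cc_fconv ck (Cc_ftilde ck).
have [r r0 [_ cr]] := Cc_Ccr cK; have [M M0 hM] := Cc_bounded cK.
have [K K0 hK] := uniform_boundedness r mmus vb; have [L L0 hL] := meas_bound r mmu.
have cKt t : Ccr r (modul t (fconv k (ftilde k))).
  by split; [exact: (Cc_modul t cK).1|move=> x xr; rewrite /modul cr// mulr0].
have bK n t : cmod (mus n (modul t (fconv k (ftilde k)))) <= K * M.
  by apply: hK => // x; rewrite cmod_modul.
have bL t : cmod (mu (modul t (fconv k (ftilde k)))) <= L * M.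
  by apply: hL => // x; rewrite cmod_modul.
pose S := K * M + L * M + 1.
have S0 : 0 < S by rewrite ltr_wpDl// addr_ge0// mulr_ge0// ltW.
pose eta := e / 2 / S; have eta0 : 0 < eta by rewrite !divr_gt0.
have etaE : eta * S = e / 2 by rewrite divfK// lt0r_neq0.
have [H cH hH] := hk eta eta0.
have [N hN] := unif (Cc_fconv cH (Cc_ftilde cH)) (divr_gt0 e0 (ltr0n _ 2)).
exists N => n /hN h x; have {h} := h x.
have := FT_translate_approx x (@pmus n) (ftn n) cp cH ck (ltW eta0) hH.
have := FT_translate_approx x pos_def_limit ft cp cH ck (ltW eta0) hH.
have a1 : eta * cmod (mus n (modul x (fconv k (ftilde k)))) <= eta * (K * M).
  by rewrite ler_pM2l.
have a2 : eta * cmod (mu (modul x (fconv k (ftilde k)))) <= eta * (L * M).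
  by rewrite ler_pM2l.
set a := nus n _; set b := nu _; set a' := mus n _; set b' := mu _ => h1 h2 h3.
have i1 := cmod_tri a' a b; have i2 := cmod_tri b' a' b.
rewrite (cmodC b' b) in i2.
by move: etaE; rewrite /S; lra.
Qed.

Lemma FT_prod_top_cvg : prod_top_cvg nus nu.
Proof.
move=> g cg e e0.
(* After reflection [g (x - y)] is [G (y - x)], so [mconv] at [x] evaluates the measure on a
   translate of [G]. *)
pose G y := g (0 - y); have cG : Cc G by exact: Cc_refl.
(* Positive part for [s = 1], negative part for [s = -1]; applied to the real and imaginary parts of
   [G], they give four nonnegative functions. *)
pose pos (s : R) (u : pt -> R) y := (`|u y| + s * u y) / 2.
have pos0 s u y : s = 1 \/ s = -1 -> 0 <= pos s u y.
  move=> hs; rewrite /pos divr_ge0//; have := ler_norm (u y); have := ler_norm (- u y).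
  by rewrite normrN; case: hs => ->; lra.
have cpos s (u : pt -> R) : Cc (fun x => cofR (u x)) -> Cc (fun x => cofR (pos s u x)).
  move=> /Cc_Ccr[r r0 [c1 c2]]; apply: (@Ccr_Cc _ _ r); split.
    have cu : continuous u by have /ccontP[] := c1.
    apply: ccont_cofR; apply: rcontM; last exact: rcont_cst.
    apply: rcontD; last by apply: rcontM => //; exact: rcont_cst.
    by apply: (rcont_comp (v := Num.Def.normr)) => //; exact: norm_continuous.
  move=> x xr; have /(congr1 (@cre R)) /= ux := c2 x xr.
  by rewrite /pos ux normr0 mulr0 addr0 mul0r.
have cre_G : Cc (fun x => cofR (cre (G x))).
  have [r r0 [c1 c2]] := Cc_Ccr cG; apply: (@Ccr_Cc _ _ r); split.
    by apply: ccont_cofR; have /ccontP[] := c1.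
  by move=> x /c2 ->.
have cim_G : Cc (fun x => cofR (cim (G x))).
  have [r r0 [c1 c2]] := Cc_Ccr cG; apply: (@Ccr_Cc _ _ r); split.
    by apply: ccont_cofR; have /ccontP[] := c1.
  by move=> x /c2 ->.
pose p1 := pos 1 (fun y => cre (G y)); pose p2 := pos (-1) (fun y => cre (G y)).
pose p3 := pos 1 (fun y => cim (G y)); pose p4 := pos (-1) (fun y => cim (G y)).
have e4 : 0 < e / 4 by rewrite divr_gt0.
have C1 : Cc (fun x => cofR (p1 x)) by exact: cpos.
have C2 : Cc (fun x => cofR (p2 x)) by exact: cpos.
have C3 : Cc (fun x => cofR (p3 x)) by exact: cpos.
have C4 : Cc (fun x => cofR (p4 x)) by exact: cpos.
have [N1 h1] := translates_cvg C1 (fun x => pos0 _ _ x (or_introl erefl)) e4.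
have [N2 h2] := translates_cvg C2 (fun x => pos0 _ _ x (or_intror erefl)) e4.
have [N3 h3] := translates_cvg C3 (fun x => pos0 _ _ x (or_introl erefl)) e4.
have [N4 h4] := translates_cvg C4 (fun x => pos0 _ _ x (or_intror erefl)) e4.
pose ii : C := Complex 0 1.
have ii1 : cmod ii = 1 by rewrite /cmod /= expr0n expr1n add0r sqrtr1.
have split4 (m : measure_on R d) x : is_measure m ->
  mconv m g x = m (fun y => cofR (p1 (y - x))) - m (fun y => cofR (p2 (y - x)))
    + ii * (m (fun y => cofR (p3 (y - x))) - m (fun y => cofR (p4 (y - x)))).
  move=> mm; have S1 := Cc_shift x C1; have S2 := Cc_shift x C2.
  have S3 := Cc_shift x C3; have S4 := Cc_shift x C4.
  rewrite -!measB// -measZ//; last exact: Cc_sub.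
  rewrite -measD//; [|exact: Cc_sub|by apply: Cc_scale; exact: Cc_sub].
  congr m; apply/funext => y.
  have -> : g (x - y) = G (y - x) by rewrite /G sub0r opprB.
  rewrite /p1 /p2 /p3 /p4 /pos; case: (G (y - x)) => a b /=.
  by apply: complex_ext; rewrite ?creD ?cimD ?creN ?cimN ?creM ?cimM /=; field.
exists (N1 + N2 + N3 + N4)%N => n hn x.
have l1 : (N1 <= n)%N by apply: leq_trans hn; rewrite -!addnA leq_addr.
have l2 : (N2 <= n)%N by apply: leq_trans hn; rewrite -!addnA addnCA leq_addr.
have l3 : (N3 <= n)%N by apply: leq_trans hn; rewrite addnAC leq_addl.
have l4 : (N4 <= n)%N by apply: leq_trans hn; rewrite leq_addl.
move: (h1 n l1 x) (h2 n l2 x) (h3 n l3 x) (h4 n l4 x).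
rewrite (split4 _ x (ftn n).1) (split4 _ x ft.1).
set a1 := nus n _; set a2 := nus n _; set a3 := nus n _; set a4 := nus n _.
set b1 := nu _; set b2 := nu _; set b3 := nu _; set b4 := nu _ => d1 d2 d3 d4.
rewrite (_ : _ - _ = ((a1 - b1) - (a2 - b2)) + ii * ((a3 - b3) - (a4 - b4))); last by ring.
apply: le_lt_trans (cmodD _ _) _; rewrite cmodM ii1 mul1r.
have := cmodB (a1 - b1) (a2 - b2); have := cmodB (a3 - b3) (a4 - b4).
lra.
Qed.

End Convergence.

Theorem theorem8p5 (R : realType) (d : nat)
  (mus : nat -> measure_on R d) (mu : measure_on R d) :
  (forall n, is_measure (mus n)) ->
  (forall n, pos_def (mus n)) ->
  is_measure mu ->
  tempered mu ->
  (forall f, schwartz f -> forall e : R, 0 < e -> exists N : nat,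
     forall n, (N <= n)%N -> forall t : 'rV[R]_d,
       cmod (ext (mus n) (modul t f) - ext mu (modul t f)) < e) ->
  vaguely_bounded mus ->
  pos_def mu /\
  (forall (nus : nat -> measure_on R d) (nu : measure_on R d),
     (forall n, is_FT (mus n) (nus n)) -> is_FT mu nu ->
     prod_top_cvg nus nu).
Proof.
move=> mmus pmus mmu _ hyp vb; have unif := unif_cvg_Cc mmus mmu hyp vb.
split; first exact: pos_def_limit pmus unif.
move=> nus nu ftn ft.
exact (@FT_prod_top_cvg R d mus mu mmus pmus mmu vb unif nus nu ftn ft).
Qed.
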